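(* Let $\mathcal{N}$ be a Type $\mathcal{B}$ structure on $\mathbb{R}^+\times\mathbb{R}$. (1) $\dim\{\mathfrak{K}(\mathcal{N})\}\in\{2,3,4,6\}$. (2) $\dim\{\mathfrak{K}(\mathcal{N})\}=3$ if and only if $\mathcal{N}$ is linearly equivalent to $\mathcal{N}_i^3(\cdot)$ for some $i$. (3) The following assertions are equivalent. (a) $\dim\{\mathfrak{K}(\mathcal{N})\}=4$. (b) $\mathcal{N}$ is linearly equivalent to $\mathcal{N}_i^4(\cdot)$ for some $i$. (c) $\mathcal{N}$ is also Type $\mathcal{A}$. (4) The following assertions are equivalent. (a) $\dim\{\mathfrak{K}(\mathcal{N})\}=6$. (b) $\mathcal{N}$ is linearly equivalent to $\mathcal{N}_i^6(\cdot)$ for some $i$. (c) $\mathcal{N}$ is flat.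
   Context: A Type $\mathcal{B}$ structure on $\mathbb{R}^+\times\mathbb{R}$ (coordinates $(x^1,x^2)$, $x^1>0$) is a left invariant affine structure on the $ax+b$ group. Equivalently, it is a torsion free connection $\nabla$ on the tangent bundle of $\mathbb{R}^+\times\mathbb{R}$ whose Christoffel symbols, defined by $\nabla_{\partial_{x^i}}\partial_{x^j}=\Gamma_{ij}{}^k\partial_{x^k}$, have the form $\Gamma_{ij}{}^k=(x^1)^{-1}A_{ij}{}^k$ with $A_{ij}{}^k=A_{ji}{}^k$ constant. Denote by $\mathcal{N}((x^1)^{-1}\Gamma(a,b,c,d,e,f))$ the structure with $A_{11}{}^1=a$, $A_{11}{}^2=b$, $A_{12}{}^1=c$, $A_{12}{}^2=d$, $A_{22}{}^1=e$, $A_{22}{}^2=f$. Two Type $\mathcal{B}$ structures are linearly equivalent if they are intertwined by some map of the form $(x^1,x^2)\mapsto(x^1,ax^1+bx^2)$ with $a,b\in\mathbb{R}$, $b\ne0$. A Type $\mathcal{A}$ structure is a left invariant affine structure on the translation group $\mathbb{R}^2$, i.e. a torsion free connection on $\mathbb{R}^2$ with constant Christoffel symbols. Saying that $\mathcal{N}$ is also Type $\mathcal{A}$ means that it is also, up to affine isomorphism (a diffeomorphism intertwining the connections), such a structure. $\mathfrak{K}(\mathcal{N})$ is the real Lie algebra of affine Killing vector fields, i.e. smooth vector fields $X$ on $\mathbb{R}^+\times\mathbb{R}$ with $[X,\nabla_YZ]-\nabla_Y[X,Z]-\nabla_{[X,Y]}Z=0$ for all smooth vector fields $Y,Z$. Flat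 means that the curvature of $\nabla$ vanishes. In the following lists, the parameters are real and range over all admissible values. The structures $\mathcal{N}_i^3(\cdot)$ are: - $\mathcal{N}_1^3(\pm)=\mathcal{N}((x^1)^{-1}\Gamma(-\frac32,0,0,-\frac12,\mp\frac12,0))$. - $\mathcal{N}_2^3(c)=\mathcal{N}((x^1)^{-1}\Gamma(-\frac32,0,1,-\frac12,c,2))$. - $\mathcal{N}_3^3=\mathcal{N}((x^1)^{-1}\Gamma(-1,0,0,-1,-1,0))$, the affine structure of the Lorentzian-hyperbolic plane with metric $ds^2=\frac{(dx^1)^2-(dx^2)^2}{(x^1)^2}$. - $\mathcal{N}_4^3=\mathcal{N}((x^1)^{-1}\Gamma(-1,0,0,-1,1,0))$, the affine structure of the hyperbolic plane with metric $ds^2=\frac{(dx^1)^2+(dx^2)^2}{(x^1)^2}$. The structures $\mathcal{N}_i^4(\cdot)$ are: - $\mathcal{N}_1^4(\kappa)=\mathcal{N}((x^1)^{-1}\Gamma(2\kappa,1,0,\kappa,0,0))$ for $\kappa\notin\{0,-1\}$. - $\mathcal{N}_2^4(\kappa,\theta)=\mathcal{N}((x^1)^{-1}\Gamma(2\kappa+\theta-1,0,0,\kappa,0,0))$ for $\kappa\notin\{0,-\theta\}$ and $\theta\ne0$. - $\mathcal{N}_3^4(\kappa)=\mathcal{N}((x^1)^{-1}\Gamma(2\kappa-1,0,0,\kappa,0,0))$ for $\kappa\ne0$. The structures $\mathcal{N}_i^6(\cdot)$ are: - $\mathcal{N}_0^6=\mathcal{N}((x^1)^{-1}\Gamma(0,0,0,0,0,0))$.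 - $\mathcal{N}_1^6(\pm)=\mathcal{N}((x^1)^{-1}\Gamma(1,0,0,0,\pm1,0))$. - $\mathcal{N}_2^6(c)=\mathcal{N}((x^1)^{-1}\Gamma(c-1,0,0,c,0,0))$ for $c\ne0$. - $\mathcal{N}_3^6=\mathcal{N}((x^1)^{-1}\Gamma(-2,1,0,-1,0,0))$. - $\mathcal{N}_4^6=\mathcal{N}((x^1)^{-1}\Gamma(0,1,0,0,0,0))$. - $\mathcal{N}_5^6=\mathcal{N}((x^1)^{-1}\Gamma(-1,0,0,0,0,0))$. - $\mathcal{N}_6^6(c)=\mathcal{N}((x^1)^{-1}\Gamma(c,0,0,0,0,0))$ for $c\ne0,-1$.
   Formalization: In (3)(c), ''N is also Type A'' is read as ''N is also Type A and N is not flat'', since the flat structure N_5^6 is also Type A (via (log x^1, x^2)) but has dim K = 6. *)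

(* Defs.v *)
From Stdlib Require Import Reals.
From Coquelicot Require Import Coquelicot.
Open Scope R_scope.

(* Everything lives on an open subset of R^2, given as a predicate [U].
   Functions, vector fields, connections and maps are total on R^2, but only
   their values on [U] are meaningful. *)

Inductive idx : Set := i1 | i2.

Definition sum_idx (f : idx -> R) : R := f i1 + f i2.

Definition domain := R -> R -> Prop.
Definition half_plane : domain := fun x _ => 0 < x.
Definition plane : domain := fun _ _ => True.

(* Each of these is given by its components in the coordinate frame. *)
Definition vfield := idx -> R -> R -> R.
Definition smap := idx -> R -> R -> R.
(* [N i j k] is the Christoffel symbol Gamma_{ij}^k. *)
Definition connection := idx -> idx -> idx -> R -> R -> R.

Definition partial (i : idx) (f : R -> R -> R) (x y : R) : R :=
  match i with
  | i1 => Derive (fun t => f t y) x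
  | i2 => Derive (fun t => f x t) y
  end.

(* [ex_diff_n f n x y] speaks of the partial derivatives at the single point
   (x, y); demanded at all points of an open set it is the C^n property. *)
Definition smooth_on (U : domain) (f : R -> R -> R) : Prop :=
  forall n x y, U x y -> ex_diff_n f n x y.

Definition smooth_field (U : domain) (X : vfield) : Prop :=
  forall k, smooth_on U (X k).

Definition eq_field (U : domain) (X Y : vfield) : Prop :=
  forall k x y, U x y -> X k x y = Y k x y.

Definition zero_field : vfield := fun _ _ _ => 0.

Definition sub_field (X Y : vfield) : vfield :=
  fun k x y => X k x y - Y k x y.

Definition bracket (X Y : vfield) : vfield :=
  fun k x y =>
    sum_idx (fun i => X i x y * partial i (Y k) x y
                      - Y i x y * partial i (X k) x y).

Definition nabla (N : connection) (Y Z : vfield) : vfield :=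
  fun k x y =>
    sum_idx (fun i => Y i x y *
      (partial i (Z k) x y + sum_idx (fun j => N i j k x y * Z j x y))).

Definition killing (U : domain) (N : connection) (X : vfield) : Prop :=
  smooth_field U X /\
  forall Y Z : vfield, smooth_field U Y -> smooth_field U Z ->
    eq_field U
      (sub_field (sub_field (bracket X (nabla N Y Z)) (nabla N Y (bracket X Z)))
                 (nabla N (bracket X Y) Z))
      zero_field.

(* c_1 b_1 + ... + c_n b_n; the sum is empty for n = 0. *)
Definition lincomb (n : nat) (c : nat -> R) (b : nat -> vfield) : vfield :=
  fun k x y => sum_n_m (fun i => c i * b i k x y) 1 n.

Definition killing_dim (U : domain) (N : connection) (n : nat) : Prop :=
  exists b : nat -> vfield,
    (forall i, (1 <= i <= n)%nat -> killing U N (b i)) /\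
    (forall c : nat -> R, eq_field U (lincomb n c b) zero_field ->
       forall i, (1 <= i <= n)%nat -> c i = 0) /\
    (forall X, killing U N X ->
       exists c : nat -> R, eq_field U X (lincomb n c b)).

Definition flat (U : domain) (N : connection) : Prop :=
  forall X Y Z : vfield,
    smooth_field U X -> smooth_field U Y -> smooth_field U Z ->
    eq_field U
      (sub_field (sub_field (nabla N X (nabla N Y Z)) (nabla N Y (nabla N X Z)))
                 (nabla N (bracket X Y) Z))
      zero_field.

Definition maps_to (U V : domain) (Phi : smap) : Prop :=
  (forall k, smooth_on U (Phi k)) /\
  forall x y, U x y -> V (Phi i1 x y) (Phi i2 x y).

Definition left_inverse_on (U : domain) (Psi Phi : smap) : Prop :=
  forall x y, U x y ->
    Psi i1 (Phi i1 x y) (Phi i2 x y) = x /\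
    Psi i2 (Phi i1 x y) (Phi i2 x y) = y.

Definition diffeo (U V : domain) (Phi : smap) : Prop :=
  maps_to U V Phi /\
  exists Psi : smap,
    maps_to V U Psi /\ left_inverse_on U Psi Phi /\ left_inverse_on V Phi Psi.

(* X' (Phi p) = dPhi_p (X p) on U; for a diffeomorphism of U onto V this says
   that X' is the push-forward of X. *)
Definition related (U : domain) (Phi : smap) (X X' : vfield) : Prop :=
  forall k x y, U x y ->
    X' k (Phi i1 x y) (Phi i2 x y)
    = sum_idx (fun i => partial i (Phi k) x y * X i x y).

(* Phi_* (nabla_X Y) = nabla'_{Phi_* X} (Phi_* Y), for a diffeomorphism Phi of
   U onto V. *)
Definition intertwines (U V : domain) (Phi : smap) (N N' : connection) : Prop :=
  forall X Y X' Y' : vfield,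
    smooth_field U X -> smooth_field U Y ->
    smooth_field V X' -> smooth_field V Y' ->
    related U Phi X X' -> related U Phi Y Y' ->
    related U Phi (nabla N X Y) (nabla N' X' Y').

Definition affine_iso (U V : domain) (N N' : connection) : Prop :=
  exists Phi : smap, diffeo U V Phi /\ intertwines U V Phi N N'.

Definition symmetric_symbols (A : idx -> idx -> idx -> R) : Prop :=
  forall i j k, A i j k = A j i k.

Definition typeA (N : connection) : Prop :=
  exists A, symmetric_symbols A /\
    forall i j k x y, plane x y -> N i j k x y = A i j k.

Definition typeB (N : connection) : Prop :=
  exists A, symmetric_symbols A /\
    forall i j k x y, half_plane x y -> N i j k x y = / x * A i j k.

Definition also_typeA (N : connection) : Prop :=
  exists M : connection, typeA M /\ affine_iso half_plane plane N M.

Definition Gamma (a b c d e f : R) (i j k : idx) : R :=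
  match i, j, k with
  | i1, i1, i1 => a
  | i1, i1, i2 => b
  | i1, i2, i1 | i2, i1, i1 => c
  | i1, i2, i2 | i2, i1, i2 => d
  | i2, i2, i1 => e
  | i2, i2, i2 => f
  end.

Definition NB (a b c d e f : R) : connection :=
  fun i j k x _ => / x * Gamma a b c d e f i j k.

Definition shear (a b : R) : smap :=
  fun k x y => match k with i1 => x | i2 => a * x + b * y end.

Definition linearly_equivalent (N M : connection) : Prop :=
  exists a b : R, b <> 0 /\ intertwines half_plane half_plane (shear a b) N M.

Definition is_sign (s : R) : Prop := s = 1 \/ s = -1.

Inductive family3 : connection -> Prop :=
| N3_1 s : is_sign s -> family3 (NB (-(3/2)) 0 0 (-(1/2)) (- s * (1/2)) 0)
| N3_2 c : family3 (NB (-(3/2)) 0 1 (-(1/2)) c 2)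
| N3_3 : family3 (NB (-1) 0 0 (-1) (-1) 0)
| N3_4 : family3 (NB (-1) 0 0 (-1) 1 0).

Inductive family4 : connection -> Prop :=
| N4_1 kappa : kappa <> 0 -> kappa <> -1 ->
    family4 (NB (2 * kappa) 1 0 kappa 0 0)
| N4_2 kappa theta : kappa <> 0 -> kappa <> - theta -> theta <> 0 ->
    family4 (NB (2 * kappa + theta - 1) 0 0 kappa 0 0)
| N4_3 kappa : kappa <> 0 -> family4 (NB (2 * kappa - 1) 0 0 kappa 0 0).

Inductive family6 : connection -> Prop :=
| N6_0 : family6 (NB 0 0 0 0 0 0)
| N6_1 s : is_sign s -> family6 (NB 1 0 0 0 s 0)
| N6_2 c : c <> 0 -> family6 (NB (c - 1) 0 0 c 0 0)
| N6_3 : family6 (NB (-2) 1 0 (-1) 0 0)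
| N6_4 : family6 (NB 0 1 0 0 0 0)
| N6_5 : family6 (NB (-1) 0 0 0 0 0)
| N6_6 c : c <> 0 -> c <> -1 -> family6 (NB c 0 0 0 0 0).

(* Main.v *)
Require Import Defs.
From Stdlib Require Import Reals.
From Coquelicot Require Import Coquelicot.
From Stdlib Require Import Lra Lia List Classical ClassicalEpsilon.
Open Scope R_scope.

(** Write the structure in the left-invariant frame of the ax+b group: every
    invariant tensor then has constant components, up to powers of x. Two Killing
    fields are always present, the translation d/dy and the dilation
    x d/dx + y d/dy, and they move every point to every other. Hence the dimension is
    2 plus the dimension of the isotropy algebra at one point, and the proof
    computes that algebra.

    The Killing equation expresses all second derivatives of X through its 1-jet,
    so that a Killing field with vanishing 1-jet at (1,0) is zero
    ([killing_zero_of_jet], by Gronwall along horizontal and vertical lines). A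
    field that vanishes at (1,0) is therefore known from the matrix A of its
    first derivatives there. Equality of the third derivatives gives
    L_X Ric = 0 ([lie2_ricci_zero]), and since L_X commutes with the covariant
    derivative, A annihilates Ric and nabla Ric. If Ric is not symmetric, its
    alternating part is an invariant area form, whose connection form and the
    covariant derivative of that form are annihilated too. These conditions are
    collected in [isotropy].

    A shear brings Ric to a normal form, and a nonzero A is then very restrictive.
    When the alternating part is nonzero, A is nilpotent and one gets N_2^3. When Ric
    is a metric, A generates its rotations or boosts, which have no fixed vector
    among tensors of odd degree, so nabla Ric = 0 and one gets the (Lorentzian)
    hyperbolic plane. When Ric = +-alpha^2, the form alpha and nabla alpha are
    annihilated; if a shear makes alpha a multiple of dy one gets N_1^3,
    and if alpha is a multiple of dx one gets c = e = f = 0. In the last case, the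
    symbols become constant in the coordinates ln x and y + g(x), and the isotropy
    algebra has dimension 2. These alternatives are
    [classification_asymmetric], [classification_symmetric] and [classification].
    The flat structures are those with Ric = 0, a system of polynomial equations
    that is solved in [family6_of_ricci].

    Conversely, explicit Killing fields show that the listed structures have the
    dimension claimed: an sl(2) spanned by the translation, the dilation and one
    quadratic field for the first list, and products of an affine function with a
    parallel field in the flat case. Dimensions are carried along linear equivalences
    by [killing_dim_transport] and are unique by [killing_dim_unique], which turns
    the implications obtained for each list into equivalences.

    Finally, a structure that is also translation invariant has two commuting
    independent Killing fields. Neither the ax+b algebra nor sl(2,R) contains such
    a pair ([no_commuting_pair]), so a non-flat one has dimension 4. *)

(** * Calculus on open subsets of the plane *)

Definition open_domain (U : Defs.domain) : Prop :=
  forall x y, U x y -> locally_2d U x y.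

Definition is_partial (i : idx) (f : R -> R -> R) (x y l : R) : Prop :=
  match i with
  | i1 => is_derive (fun t => f t y) x l
  | i2 => is_derive (fun t => f x t) y l
  end.

(** [smooth_on] is a conjunction over all orders and does not support induction;
    the closure properties are proved order by order. *)
Definition Cn (U : Defs.domain) (n : nat) (f : R -> R -> R) : Prop :=
  forall x y, U x y -> ex_diff_n f n x y.

Lemma is_partial_unique : forall i f x y l,
  is_partial i f x y l -> partial i f x y = l.
Proof. intros [|] f x y l H; exact (is_derive_unique _ _ _ H). Qed.

Lemma partial_ext_loc : forall i f g x y,
  locally_2d (fun u v => f u v = g u v) x y ->
  partial i f x y = partial i g x y.
Proof.
  intros [|] f g x y H; simpl; apply Derive_ext_loc.
  - exact (locally_2d_1d_const_y _ _ _ H).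
  - exact (locally_2d_1d_const_x _ _ _ H).
Qed.

Lemma eq_on_open_locally : forall (U : Defs.domain) f g x y, open_domain U -> U x y ->
  (forall u v, U u v -> f u v = g u v) ->
  locally_2d (fun u v => f u v = g u v :> R) x y.
Proof.
  intros U f g x y HU Hxy H. destruct (HU _ _ Hxy) as [d Hd].
  exists d. intros u v Hu Hv. apply H, Hd; assumption.
Qed.

Lemma partial_ext_on : forall (U : Defs.domain) i f g x y, open_domain U -> U x y ->
  (forall u v, U u v -> f u v = g u v) ->
  partial i f x y = partial i g x y.
Proof.
  intros. apply partial_ext_loc. now apply eq_on_open_locally with U.
Qed.

Lemma Cn_ext_on : forall (U : Defs.domain) n f g, open_domain U ->
  (forall u v, U u v -> f u v = g u v) -> Cn U n f -> Cn U n g.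
Proof.
  intros U n f g HU H Hf x y Hxy. apply ex_diff_n_ext_loc with f.
  - now apply eq_on_open_locally with U.
  - now apply Hf.
Qed.

Lemma Cn_continuity : forall (U : Defs.domain) n f x y, Cn U n f -> U x y ->
  continuity_2d_pt f x y.
Proof. intros U n f x y H Hxy. specialize (H x y Hxy). destruct n; apply H. Qed.

Lemma Cn_pred : forall (U : Defs.domain) n f, Cn U (S n) f -> Cn U n f.
Proof.
  intros U n f H x y Hxy. apply ex_diff_n_m with (S n); [lia|now apply H].
Qed.

Lemma Cn_is_partial : forall (U : Defs.domain) n i f x y, Cn U (S n) f -> U x y ->
  is_partial i f x y (partial i f x y).
Proof.
  intros U n i f x y H Hxy. destruct (H x y Hxy) as (_ & H1 & H2 & _).
  destruct i; apply Derive_correct; assumption.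
Qed.

Lemma Cn_partial : forall (U : Defs.domain) n i f, Cn U (S n) f -> Cn U n (partial i f).
Proof.
  intros U n i f H x y Hxy. destruct (H x y Hxy) as (_ & _ & _ & H1 & H2).
  destruct i; assumption.
Qed.

(** The smoothness predicate only mentions partial derivatives, whereas the chain
    rule needs a total differential; continuity of the partial derivatives supplies
    it. *)
Lemma C1_differentiable : forall (U : Defs.domain) f x y, open_domain U -> Cn U 1 f -> U x y ->
  differentiable_pt_lim f x y (partial i1 f x y) (partial i2 f x y).
Proof.
  intros U f x y HU H Hxy.
  apply filterdiff_differentiable_pt_lim.
  apply (is_derive_filterdiff f x y (partial i1 f) (partial i2 f x y)).
  - apply (locally_2d_locally (fun u v => is_derive (fun z => f z v) u (partial i1 f u v))).
    destruct (HU _ _ Hxy) as [d Hd]. exists d. intros u v Hu Hv.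
    apply (Cn_is_partial U 0 i1 f u v H). now apply Hd.
  - exact (Cn_is_partial U 0 i2 f x y H Hxy).
  - apply (continuity_2d_pt_filterlim (partial i1 f) x y).
    apply (Cn_continuity U 0); [now apply (Cn_partial U 0 i1)|assumption].
Qed.

(** Needed to build C^n functions from their partial derivatives alone: continuity
    of the function itself is part of [ex_diff_n]. *)
Lemma continuous_partials_continuity : forall (U : Defs.domain) f (D : idx -> R -> R -> R) x y,
  open_domain U ->
  (forall i u v, U u v -> is_partial i f u v (D i u v)) ->
  continuity_2d_pt (D i1) x y -> U x y -> continuity_2d_pt f x y.
Proof.
  intros U f D x y HU HD Hc Hxy.
  apply differentiable_continuity_pt. exists (D i1 x y), (D i2 x y).
  apply filterdiff_differentiable_pt_lim.
  apply (is_derive_filterdiff f x y (D i1) (D i2 x y)).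
  - apply (locally_2d_locally (fun u v => is_derive (fun z => f z v) u (D i1 u v))).
    destruct (HU _ _ Hxy) as [d Hd]. exists d. intros u v Hu Hv.
    apply (HD i1). now apply Hd.
  - now apply (HD i2).
  - now apply (continuity_2d_pt_filterlim (D i1) x y).
Qed.

Lemma Cn_S_intro : forall (U : Defs.domain) n f (D : idx -> R -> R -> R), open_domain U ->
  (forall i u v, U u v -> is_partial i f u v (D i u v)) ->
  (forall i, Cn U n (D i)) -> Cn U (S n) f.
Proof.
  intros U n f D HU HD Hn x y Hxy.
  assert (Hp : forall i u v, U u v -> partial i f u v = D i u v).
  { intros. now apply is_partial_unique, HD. }
  split; [|split; [|split; [|split]]].
  - apply continuous_partials_continuity with U D; try assumption.
    now apply (Cn_continuity U n).
  - exists (D i1 x y). now apply (HD i1).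
  - exists (D i2 x y). now apply (HD i2).
  - apply (Cn_ext_on U n (D i1) (partial i1 f)); auto.
    intros; symmetry; auto.
  - apply (Cn_ext_on U n (D i2) (partial i2 f)); auto.
    intros; symmetry; auto.
Qed.

Lemma is_partial_const : forall i c x y, is_partial i (fun _ _ => c) x y 0.
Proof. intros [|] c x y; apply (is_derive_const c). Qed.

Lemma is_partial_plus : forall i f g x y l m,
  is_partial i f x y l -> is_partial i g x y m ->
  is_partial i (fun u v => f u v + g u v) x y (l + m).
Proof.
  intros [|] f g x y l m Hf Hg.
  - exact (is_derive_plus (fun t => f t y) (fun t => g t y) x l m Hf Hg).
  - exact (is_derive_plus (fun t => f x t) (fun t => g x t) y l m Hf Hg).
Qed.

Lemma is_partial_opp : forall i f x y l,
  is_partial i f x y l -> is_partial i (fun u v => - f u v) x y (- l).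
Proof.
  intros [|] f x y l Hf.
  - exact (is_derive_opp (fun t => f t y) x l Hf).
  - exact (is_derive_opp (fun t => f x t) y l Hf).
Qed.

Lemma is_partial_minus : forall i f g x y l m,
  is_partial i f x y l -> is_partial i g x y m ->
  is_partial i (fun u v => f u v - g u v) x y (l - m).
Proof.
  intros i f g x y l m Hf Hg. apply is_partial_plus; [assumption|].
  now apply is_partial_opp.
Qed.

Lemma is_partial_mult : forall i f g x y l m,
  is_partial i f x y l -> is_partial i g x y m ->
  is_partial i (fun u v => f u v * g u v) x y (l * g x y + f x y * m).
Proof.
  intros [|] f g x y l m Hf Hg.
  - apply (is_derive_mult (fun t => f t y) (fun t => g t y)); auto.
    intros; apply Rmult_comm.
  - apply (is_derive_mult (fun t => f x t) (fun t => g x t)); auto.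
    intros; apply Rmult_comm.
Qed.

Lemma Cn_const : forall (U : Defs.domain) n c, open_domain U -> Cn U n (fun _ _ => c).
Proof.
  intros U n c HU. revert c. induction n; intros c.
  - intros x y _. split; [apply continuity_2d_pt_const|exact I].
  - apply Cn_S_intro with (fun _ _ _ => 0); auto.
    intros; apply is_partial_const.
Qed.

Lemma Cn_plus : forall (U : Defs.domain) n f g, open_domain U -> Cn U n f -> Cn U n g ->
  Cn U n (fun u v => f u v + g u v).
Proof.
  intros U n f g HU. revert f g. induction n; intros f g Hf Hg.
  - intros x y Hxy. split; [|exact I].
    apply continuity_2d_pt_plus; eapply Cn_continuity; eassumption.
  - apply Cn_S_intro with (fun i u v => partial i f u v + partial i g u v); auto.
    + intros. apply is_partial_plus; eapply Cn_is_partial; eassumption.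
    + intros. apply IHn; now apply Cn_partial.
Qed.

Lemma Cn_mult : forall (U : Defs.domain) n f g, open_domain U -> Cn U n f -> Cn U n g ->
  Cn U n (fun u v => f u v * g u v).
Proof.
  intros U n f g HU. revert f g. induction n; intros f g Hf Hg.
  - intros x y Hxy. split; [|exact I].
    apply continuity_2d_pt_mult; eapply Cn_continuity; eassumption.
  - apply Cn_S_intro with
      (fun i u v => partial i f u v * g u v + f u v * partial i g u v); auto.
    + intros. apply is_partial_mult; eapply Cn_is_partial; eassumption.
    + intros. apply Cn_plus; trivial; apply IHn;
        (now apply Cn_partial) || now apply Cn_pred.
Qed.

Lemma is_partial_comp : forall U V i f g h x y,
  open_domain U -> open_domain V -> U x y -> V (g x y) (h x y) ->
  Cn V 1 f -> Cn U 1 g -> Cn U 1 h ->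
  is_partial i (fun u v => f (g u v) (h u v)) x y
    (partial i1 f (g x y) (h x y) * partial i g x y
     + partial i2 f (g x y) (h x y) * partial i h x y).
Proof.
  intros U V i f g h x y HU HV Hxy Hgh Hf Hg Hh.
  assert (Df := C1_differentiable V f _ _ HV Hf Hgh).
  assert (Dg := Cn_is_partial U 0 i g x y Hg Hxy).
  assert (Dh := Cn_is_partial U 0 i h x y Hh Hxy).
  destruct i; apply is_derive_Reals.
  - apply (derivable_pt_lim_comp_2d f (fun t => g t y) (fun t => h t y));
      [exact Df | apply is_derive_Reals, Dg | apply is_derive_Reals, Dh].
  - apply (derivable_pt_lim_comp_2d f (fun t => g x t) (fun t => h x t));
      [exact Df | apply is_derive_Reals, Dg | apply is_derive_Reals, Dh].
Qed.

Lemma continuity_2d_pt_comp : forall f g h x y,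
  continuity_2d_pt f (g x y) (h x y) ->
  continuity_2d_pt g x y -> continuity_2d_pt h x y ->
  continuity_2d_pt (fun u v => f (g u v) (h u v)) x y.
Proof.
  intros f g h x y Hf Hg Hh eps.
  destruct (Hf eps) as [d Hd]. destruct (Hg d) as [d1 H1], (Hh d) as [d2 H2].
  exists (mkposreal _ (Rmin_stable_in_posreal d1 d2)). simpl. intros u v Hu Hv.
  apply Hd.
  - apply H1; eapply Rlt_le_trans; eauto; apply Rmin_l.
  - apply H2; eapply Rlt_le_trans; eauto; apply Rmin_r.
Qed.

Lemma Cn_comp : forall U V n f g h, open_domain U -> open_domain V ->
  (forall x y, U x y -> V (g x y) (h x y)) ->
  Cn V n f -> Cn U n g -> Cn U n h ->
  Cn U n (fun u v => f (g u v) (h u v)).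
Proof.
  intros U V n f g h HU HV HUV. revert f.
  induction n; intros f Hf Hg Hh.
  - intros x y Hxy. split; [|exact I].
    apply continuity_2d_pt_comp; eapply Cn_continuity; eauto.
  - assert (C1 : forall W k, Cn W (S n) k -> Cn W 1 k).
    { intros W k Hk x y Hxy. apply ex_diff_n_m with (S n); [lia|auto]. }
    apply Cn_S_intro with (fun i u v =>
       partial i1 f (g u v) (h u v) * partial i g u v
     + partial i2 f (g u v) (h u v) * partial i h u v); auto.
    + intros. apply is_partial_comp with U V; auto.
    + intros. apply Cn_plus; trivial; apply Cn_mult; trivial;
        try (now apply Cn_partial); apply IHn;
        try (now apply Cn_partial); now apply Cn_pred.
Qed.

Lemma smooth_Cn : forall (U : Defs.domain) f n, smooth_on U f -> Cn U n f.
Proof. intros U f n H x y Hxy. now apply H. Qed.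

Lemma smooth_is_partial : forall (U : Defs.domain) i f x y, smooth_on U f -> U x y ->
  is_partial i f x y (partial i f x y).
Proof.
  intros U i f x y H Hxy. apply (Cn_is_partial U 0); trivial.
  now apply smooth_Cn.
Qed.

Lemma smooth_partial : forall (U : Defs.domain) i f, smooth_on U f -> smooth_on U (partial i f).
Proof. intros U i f H n. apply Cn_partial. exact (H (S n)). Qed.

Lemma smooth_ext_on : forall (U : Defs.domain) f g, open_domain U ->
  (forall u v, U u v -> f u v = g u v) -> smooth_on U f -> smooth_on U g.
Proof. intros U f g HU H Hf n. apply Cn_ext_on with f; auto. exact (Hf n). Qed.

Lemma smooth_intro : forall (U : Defs.domain) f (D : idx -> R -> R -> R), open_domain U ->
  (forall i u v, U u v -> is_partial i f u v (D i u v)) ->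
  (forall i, smooth_on U (D i)) -> smooth_on U f.
Proof.
  intros U f D HU HD Hs n. apply Cn_pred.
  apply Cn_S_intro with D; trivial. intros i. exact (Hs i n).
Qed.

Lemma smooth_const : forall (U : Defs.domain) c, open_domain U -> smooth_on U (fun _ _ => c).
Proof. intros U c HU n. now apply Cn_const. Qed.

Lemma smooth_plus : forall (U : Defs.domain) f g, open_domain U ->
  smooth_on U f -> smooth_on U g -> smooth_on U (fun u v => f u v + g u v).
Proof. intros U f g HU Hf Hg n. apply Cn_plus; auto; intros x y; auto. Qed.

Lemma smooth_mult : forall (U : Defs.domain) f g, open_domain U ->
  smooth_on U f -> smooth_on U g -> smooth_on U (fun u v => f u v * g u v).
Proof. intros U f g HU Hf Hg n. apply Cn_mult; auto; intros x y; auto. Qed.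

Lemma smooth_opp : forall (U : Defs.domain) f, open_domain U ->
  smooth_on U f -> smooth_on U (fun u v => - f u v).
Proof.
  intros U f HU Hf. apply smooth_ext_on with (fun u v => (-1) * f u v); trivial.
  - intros; ring.
  - apply smooth_mult; trivial. now apply smooth_const.
Qed.

Lemma smooth_minus : forall (U : Defs.domain) f g, open_domain U ->
  smooth_on U f -> smooth_on U g -> smooth_on U (fun u v => f u v - g u v).
Proof.
  intros U f g HU Hf Hg. apply smooth_plus; trivial. now apply smooth_opp.
Qed.

Lemma smooth_comp : forall U V f g h, open_domain U -> open_domain V ->
  (forall x y, U x y -> V (g x y) (h x y)) ->
  smooth_on V f -> smooth_on U g -> smooth_on U h ->
  smooth_on U (fun u v => f (g u v) (h u v)).
Proof.
  intros U V f g h HU HV HUV Hf Hg Hh n.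
  apply (Cn_comp U V); trivial; intros x y; auto.
Qed.

Lemma smooth_fst : forall U, open_domain U -> smooth_on U (fun u _ => u).
Proof.
  intros U HU.
  apply smooth_intro with (fun i _ _ => match i with i1 => 1 | i2 => 0 end); trivial.
  - intros [|] u v _; simpl; [apply (is_derive_id u)|apply (is_derive_const u)].
  - intros [|]; now apply smooth_const.
Qed.

Lemma smooth_snd : forall U, open_domain U -> smooth_on U (fun _ v => v).
Proof.
  intros U HU.
  apply smooth_intro with (fun i _ _ => match i with i1 => 0 | i2 => 1 end); trivial.
  - intros [|] u v _; simpl; [apply (is_derive_const v)|apply (is_derive_id v)].
  - intros [|]; now apply smooth_const.
Qed.

Lemma smooth_Schwarz : forall (U : Defs.domain) f x y, open_domain U -> smooth_on U f -> U x y ->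
  partial i2 (partial i1 f) x y = partial i1 (partial i2 f) x y.
Proof.
  intros U f x y HU Hf Hxy. symmetry. apply Schwarz.
  - destruct (HU _ _ Hxy) as [d Hd]. exists d. intros u v Hu Hv.
    specialize (Hd u v Hu Hv). repeat split.
    + eexists; exact (smooth_is_partial U i1 f u v Hf Hd).
    + eexists; exact (smooth_is_partial U i2 f u v Hf Hd).
    + eexists; exact (smooth_is_partial U i1 _ u v (smooth_partial U i2 f Hf) Hd).
    + eexists; exact (smooth_is_partial U i2 _ u v (smooth_partial U i1 f Hf) Hd).
  - apply (Cn_continuity U 0 (partial i1 (partial i2 f))); trivial.
    now apply smooth_Cn, smooth_partial, smooth_partial.
  - apply (Cn_continuity U 0 (partial i2 (partial i1 f))); trivial.
    now apply smooth_Cn, smooth_partial, smooth_partial.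
Qed.

Lemma open_half_plane : open_domain half_plane.
Proof.
  intros x y Hx. unfold half_plane in *. exists (mkposreal x Hx). simpl.
  intros u v Hu _. apply Rabs_def2 in Hu. lra.
Qed.

Lemma open_plane : open_domain plane.
Proof. intros x y _. exists (mkposreal 1 Rlt_0_1). intros; exact I. Qed.

(** * The component form of the Killing equation and of the curvature *)

Definition smooth_connection (U : Defs.domain) (N : connection) : Prop :=
  forall i j k, smooth_on U (N i j k).

Ltac smooth :=
  try assumption;
  lazymatch goal with
  | H : smooth_field ?U ?X |- smooth_on ?U (?X _) => apply H
  | H : smooth_connection ?U ?N |- smooth_on ?U (?N _ _ _) => apply H
  | |- smooth_on _ (partial _ _) => apply smooth_partial; smooth
  | |- smooth_on _ (fun u v => partial ?i ?f u v) =>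
      apply (smooth_partial _ i f); smooth
  | |- smooth_on _ (fun _ _ => _ + _) => apply smooth_plus; [smooth|smooth|smooth]
  | |- smooth_on _ (fun _ _ => _ - _) => apply smooth_minus; [smooth|smooth|smooth]
  | |- smooth_on _ (fun _ _ => _ * _) => apply smooth_mult; [smooth|smooth|smooth]
  | |- smooth_on _ (fun _ _ => - _) => apply smooth_opp; [smooth|smooth]
  | |- smooth_on _ (fun u _ => u) => apply smooth_fst; smooth
  | |- smooth_on _ (fun _ v => v) => apply smooth_snd; smooth
  | |- smooth_on _ (fun _ _ => ?c) => apply smooth_const; smooth
  | |- smooth_on ?U (fun u v => ?f u v) => change (smooth_on U f); smooth
  | _ => auto using open_half_plane, open_plane
  end.

Ltac differentiate :=
  lazymatch goal with
  | |- is_partial _ (fun _ _ => _ + _) _ _ _ =>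
      eapply is_partial_plus; [differentiate|differentiate]
  | |- is_partial _ (fun _ _ => _ - _) _ _ _ =>
      eapply is_partial_minus; [differentiate|differentiate]
  | |- is_partial _ (fun _ _ => _ * _) _ _ _ =>
      eapply is_partial_mult; [differentiate|differentiate]
  | |- is_partial _ (fun _ _ => ?c) _ _ _ => apply is_partial_const
  | |- is_partial _ (fun u v => ?f u v) _ _ _ =>
      eapply (smooth_is_partial _ _ f); [|eassumption]; smooth
  | |- is_partial _ ?f _ _ _ =>
      eapply (smooth_is_partial _ _ f); [|eassumption]; smooth
  end.

Lemma partial_eq : forall i f x y l m,
  is_partial i f x y l -> l = m -> partial i f x y = m.
Proof. intros i f x y l m H <-. now apply is_partial_unique. Qed.

Lemma smooth_nabla : forall (U : Defs.domain) N Y Z, open_domain U ->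
  smooth_connection U N -> smooth_field U Y -> smooth_field U Z ->
  smooth_field U (nabla N Y Z).
Proof. intros U N Y Z HU HN HY HZ k. unfold nabla, sum_idx. smooth. Qed.

Lemma smooth_bracket : forall (U : Defs.domain) X Y, open_domain U ->
  smooth_field U X -> smooth_field U Y -> smooth_field U (bracket X Y).
Proof. intros U X Y HU HX HY k. unfold bracket, sum_idx. smooth. Qed.

Lemma partial_nabla : forall (U : Defs.domain) N Y Z m k x y, open_domain U ->
  smooth_connection U N -> smooth_field U Y -> smooth_field U Z -> U x y ->
  partial m (nabla N Y Z k) x y =
  sum_idx (fun i =>
    partial m (Y i) x y
      * (partial i (Z k) x y + sum_idx (fun j => N i j k x y * Z j x y))
    + Y i x y * (partial m (partial i (Z k)) x y
      + sum_idx (fun j => partial m (N i j k) x y * Z j x y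
                        + N i j k x y * partial m (Z j) x y))).
Proof.
  intros U N Y Z m k x y HU HN HY HZ Hxy.
  unfold nabla, sum_idx. eapply partial_eq; [differentiate|cbv beta; ring].
Qed.

Lemma partial_bracket : forall (U : Defs.domain) X Y m k x y, open_domain U ->
  smooth_field U X -> smooth_field U Y -> U x y ->
  partial m (bracket X Y k) x y =
  sum_idx (fun i =>
    partial m (X i) x y * partial i (Y k) x y
    + X i x y * partial m (partial i (Y k)) x y
    - (partial m (Y i) x y * partial i (X k) x y
       + Y i x y * partial m (partial i (X k)) x y)).
Proof.
  intros U X Y m k x y HU HX HY Hxy.
  unfold bracket, sum_idx. eapply partial_eq; [differentiate|cbv beta; ring].
Qed.

(** The Lie derivative of the connection along [X], a tensor because the difference
    of two connections is one. *)
Definition lie_connection (N : connection) (X : vfield) (i j k : idx) (x y : R) : R :=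
  partial i (partial j (X k)) x y
  + sum_idx (fun l =>
      X l x y * partial l (N i j k) x y
      - N i j l x y * partial l (X k) x y
      + N l j k x y * partial i (X l) x y
      + N i l k x y * partial j (X l) x y).

Definition curvature_tensor (N : connection) (i j k l : idx) (x y : R) : R :=
  partial i (N j k l) x y - partial j (N i k l) x y
  + sum_idx (fun m => N i m l x y * N j k m x y - N j m l x y * N i k m x y).

(** The coordinate frame. At a point, [coord_field i k] is also the Kronecker
    symbol. *)
Definition coord_field (i : idx) : vfield := fun k _ _ =>
  match i, k with i1, i1 | i2, i2 => 1 | _, _ => 0 end.

Lemma smooth_coord_field : forall (U : Defs.domain) i, open_domain U ->
  smooth_field U (coord_field i).
Proof. intros U i HU k. unfold coord_field. smooth. Qed.

Lemma partial_const : forall i c x y, partial i (fun _ _ => c) x y = 0.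
Proof. intros. apply is_partial_unique, is_partial_const. Qed.

(** The derivatives of [Y] and [Z] cancel: the second derivatives of [Z] by the
    symmetry of mixed derivatives, those of first order because bracket and
    connection are derivations. *)
Lemma killing_operator_components : forall (U : Defs.domain) N X Y Z k x y,
  open_domain U -> smooth_connection U N ->
  smooth_field U X -> smooth_field U Y -> smooth_field U Z -> U x y ->
  sub_field (sub_field (bracket X (nabla N Y Z)) (nabla N Y (bracket X Z)))
            (nabla N (bracket X Y) Z) k x y
  = sum_idx (fun i => sum_idx (fun j =>
      Y i x y * Z j x y * lie_connection N X i j k x y)).
Proof.
  intros U N X Y Z k x y HU HN HX HY HZ Hxy.
  unfold sub_field.
  unfold bracket at 1. unfold nabla at 3 4. unfold sum_idx at 1 2 4.
  rewrite !(partial_nabla U), !(partial_bracket U) by trivial.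
  unfold lie_connection, nabla, bracket, sum_idx.
  rewrite !(fun k => smooth_Schwarz U (Z k)) by (trivial; apply HZ).
  rewrite !(fun k => smooth_Schwarz U (X k)) by (trivial; apply HX).
  destruct k; ring.
Qed.
Lemma curvature_components : forall (U : Defs.domain) N X Y Z l x y,
  open_domain U -> smooth_connection U N ->
  smooth_field U X -> smooth_field U Y -> smooth_field U Z -> U x y ->
  sub_field (sub_field (nabla N X (nabla N Y Z)) (nabla N Y (nabla N X Z)))
            (nabla N (bracket X Y) Z) l x y
  = sum_idx (fun i => sum_idx (fun j => sum_idx (fun k =>
      X i x y * Y j x y * Z k x y * curvature_tensor N i j k l x y))).
Proof.
  intros U N X Y Z l x y HU HN HX HY HZ Hxy.
  unfold sub_field.
  unfold nabla at 1 3 5. unfold sum_idx at 1 3 5.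
  rewrite !(partial_nabla U) by trivial.
  unfold curvature_tensor, nabla, bracket, sum_idx.
  rewrite !(fun k => smooth_Schwarz U (Z k)) by (trivial; apply HZ).
  ring.
Qed.

(** One direction tests the operator on the coordinate frame, the other is its
    tensoriality. *)
Lemma killing_iff : forall (U : Defs.domain) N X, open_domain U -> smooth_connection U N ->
  killing U N X <->
  smooth_field U X /\
  (forall i j k x y, U x y -> lie_connection N X i j k x y = 0).
Proof.
  intros U N X HU HN. split; intros [HX H]; split; trivial.
  - intros i j k x y Hxy.
    specialize (H (coord_field i) (coord_field j)
      (smooth_coord_field U i HU) (smooth_coord_field U j HU) k x y Hxy).
    rewrite (killing_operator_components U) in H;
      auto using smooth_coord_field.
    unfold zero_field in H. rewrite <- H. unfold sum_idx, coord_field.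
    destruct i, j; ring.
  - intros Y Z HY HZ k x y Hxy.
    rewrite (killing_operator_components U) by trivial.
    unfold sum_idx, zero_field. rewrite !H by trivial. ring.
Qed.

Lemma flat_iff : forall (U : Defs.domain) N, open_domain U -> smooth_connection U N ->
  flat U N <-> (forall i j k l x y, U x y -> curvature_tensor N i j k l x y = 0).
Proof.
  intros U N HU HN. split; intros H.
  - intros i j k l x y Hxy.
    specialize (H (coord_field i) (coord_field j) (coord_field k)
      (smooth_coord_field U i HU) (smooth_coord_field U j HU)
      (smooth_coord_field U k HU) l x y Hxy).
    rewrite (curvature_components U) in H; auto using smooth_coord_field.
    unfold zero_field in H. rewrite <- H. unfold sum_idx, coord_field.
    destruct i, j, k; ring.
  - intros X Y Z HX HY HZ l x y Hxy.
    rewrite (curvature_components U) by trivial.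
    unfold sum_idx, zero_field. rewrite !H by trivial. ring.
Qed.

Definition eq_connection (U : Defs.domain) (N N' : connection) : Prop :=
  forall i j k x y, U x y -> N i j k x y = N' i j k x y.

Lemma eq_connection_smooth : forall (U : Defs.domain) N N', open_domain U ->
  eq_connection U N N' -> smooth_connection U N -> smooth_connection U N'.
Proof.
  intros U N N' HU H HN i j k. apply smooth_ext_on with (N i j k); auto.
Qed.

Lemma eq_connection_sym : forall U N N',
  eq_connection U N N' -> eq_connection U N' N.
Proof. intros U N N' H i j k x y Hxy. symmetry; auto. Qed.

Lemma lie_connection_ext : forall (U : Defs.domain) N N' X Y i j k x y, open_domain U ->
  eq_connection U N N' -> eq_field U X Y -> U x y ->
  lie_connection N X i j k x y = lie_connection N' Y i j k x y.
Proof.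
  intros U N N' X Y i j k x y HU HN HX Hxy.
  assert (P : forall m l u v, U u v -> partial m (X l) u v = partial m (Y l) u v)
    by (intros; apply partial_ext_on with U; auto).
  unfold lie_connection. f_equal.
  - apply partial_ext_on with U; auto.
  - unfold sum_idx. rewrite !P by trivial. rewrite !HX, !HN by trivial.
    assert (Q : forall m, partial m (N i j k) x y = partial m (N' i j k) x y)
      by (intros; apply partial_ext_on with U; auto).
    now rewrite !Q.
Qed.

Lemma killing_ext : forall (U : Defs.domain) N N' X Y, open_domain U ->
  smooth_connection U N -> eq_connection U N N' -> eq_field U X Y ->
  killing U N X -> killing U N' Y.
Proof.
  intros U N N' X Y HU SN HN HX HK.
  apply killing_iff in HK; trivial. destruct HK as [SX HK].
  apply killing_iff; trivial.
  - now apply eq_connection_smooth with N.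
  - split.
    + intros k. apply smooth_ext_on with (X k); auto.
    + intros. rewrite <- (lie_connection_ext U N N' X Y); auto.
Qed.

Lemma eq_field_refl : forall U X, eq_field U X X.
Proof. now intros U X k x y _. Qed.

Lemma killing_dim_ext : forall (U : Defs.domain) N N' n, open_domain U ->
  smooth_connection U N -> eq_connection U N N' ->
  killing_dim U N n -> killing_dim U N' n.
Proof.
  intros U N N' n HU SN HN (b & Hb & Hi & Hs). exists b. split; [|split]; trivial.
  - intros i Hi'. apply (killing_ext U N N' (b i)); auto using eq_field_refl.
  - intros X HX. apply Hs.
    apply (killing_ext U N' N X); auto using eq_field_refl, eq_connection_sym.
    now apply eq_connection_smooth with N.
Qed.

(** * Linear algebra of vector fields *)

Definition lsum (f : nat -> R) (l : list nat) : R :=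
  fold_right Rplus 0 (map f l).

Lemma lsum_app : forall f l l', lsum f (l ++ l') = lsum f l + lsum f l'.
Proof.
  intros f l l'. induction l as [|a l IH]; unfold lsum in *; simpl; [ring|].
  rewrite IH; ring.
Qed.

Lemma lsum_ext : forall f g l, (forall i, In i l -> f i = g i) ->
  lsum f l = lsum g l.
Proof. intros f g l H. unfold lsum. f_equal. now apply map_ext_in. Qed.

Lemma lsum_linear : forall f g c l,
  lsum (fun i => f i + c * g i) l = lsum f l + c * lsum g l.
Proof.
  intros f g c l. induction l as [|a l IH]; unfold lsum in *; simpl; [ring|].
  rewrite IH; ring.
Qed.

Lemma lsum_zero : forall f l, (forall i, In i l -> f i = 0) -> lsum f l = 0.
Proof.
  intros f l H. rewrite (lsum_ext f (fun _ => 0)) by trivial.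
  induction l as [|a l IH]; unfold lsum in *; simpl; [ring|].
  rewrite IH; [ring|]. intros; apply H; now right.
Qed.

Lemma sum_n_m_lsum : forall f n m, sum_n_m f (S n) (n + m) = lsum f (seq (S n) m).
Proof.
  intros f n m. induction m.
  - rewrite sum_n_m_zero by lia. reflexivity.
  - rewrite <- plus_n_Sm, sum_n_Sm by lia. rewrite IHm, seq_S, lsum_app.
    unfold lsum; simpl. unfold plus; simpl. ring.
Qed.

(** Gaussian elimination: a vector with a nonzero last coordinate serves to clear
    that coordinate in all others, which are then dependent by induction. Lists of
    indices make it possible to remove the pivot. *)
Lemma linear_dependence : forall n (l : list nat) (v : nat -> nat -> R),
  NoDup l -> (n < length l)%nat ->
  exists d : nat -> R, (exists i, In i l /\ d i <> 0) /\
    forall j, (1 <= j <= n)%nat -> lsum (fun i => d i * v i j) l = 0.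
Proof.
  induction n; intros l v Hl Hn.
  - destruct l as [|a l]; simpl in Hn; [lia|].
    exists (fun _ => 1). split; [|lia]. exists a. split; [now left|lra].
  - destruct (classic (exists i, In i l /\ v i (S n) <> 0)) as [(i0 & Hi0 & Hp)|H0].
    + destruct (in_split _ _ Hi0) as (l1 & l2 & ->).
      assert (Hl' := NoDup_remove_1 _ _ _ Hl).
      assert (Hni := NoDup_remove_2 _ _ _ Hl).
      destruct (IHn (l1 ++ l2)
        (fun i j => v i j - v i (S n) / v i0 (S n) * v i0 j)) as (d & (i & Hi & Hd) & H);
        [trivial|rewrite length_app in *; simpl in Hn; lia|].
      pose (s := lsum (fun i => d i * v i (S n)) (l1 ++ l2)).
      exists (fun i => if Nat.eq_dec i i0 then - s / v i0 (S n) else d i). split.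
      * exists i. split.
        -- apply in_app_iff in Hi. apply in_app_iff. simpl. tauto.
        -- destruct (Nat.eq_dec i i0) as [->|_]; [contradiction|trivial].
      * assert (E : forall j, lsum (fun i => (if Nat.eq_dec i i0
            then - s / v i0 (S n) else d i) * v i j) (l1 ++ i0 :: l2)
            = lsum (fun i => d i * v i j) (l1 ++ l2) - s / v i0 (S n) * v i0 j).
        { intros j. change (i0 :: l2) with ((i0 :: nil) ++ l2).
          rewrite !lsum_app.
          assert (E' : forall l, incl l (l1 ++ l2) ->
             lsum (fun i => (if Nat.eq_dec i i0
               then - s / v i0 (S n) else d i) * v i j) l
             = lsum (fun i => d i * v i j) l).
          { intros l Hin. apply lsum_ext. intros k Hk.
            destruct (Nat.eq_dec k i0) as [->|_]; trivial.
            now apply Hin in Hk. }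
          rewrite (E' l1), (E' l2) by (intros k Hk; apply in_app_iff; tauto).
          unfold lsum at 2; simpl.
          destruct (Nat.eq_dec i0 i0); [|congruence]. field. trivial. }
        intros j Hj. rewrite E.
        destruct (Nat.eq_dec j (S n)) as [->|Hne].
        -- fold s. field. trivial.
        -- assert (Hj' : (1 <= j <= n)%nat) by lia.
           specialize (H j Hj').
           rewrite (lsum_ext _ (fun i => d i * v i j
              + (- / v i0 (S n) * v i0 j) * (d i * v i (S n)))) in H
             by (intros; field; trivial).
           rewrite lsum_linear in H. fold s in H.
           rewrite <- H. field. trivial.
    + destruct (IHn l v Hl) as (d & Hd & H); [lia|].
      exists d. split; trivial. intros j Hj.
      destruct (Nat.eq_dec j (S n)) as [->|Hne]; [|apply H; lia].
      apply lsum_zero. intros i Hi.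
      destruct (Req_dec (v i (S n)) 0) as [->|Hv]; [ring|].
      exfalso; apply H0; eauto.
Qed.

Lemma linear_dependence_sum : forall n m (v : nat -> nat -> R), (n < m)%nat ->
  exists d : nat -> R, (exists i, (1 <= i <= m)%nat /\ d i <> 0) /\
    forall j, (1 <= j <= n)%nat -> sum_n_m (fun i => d i * v i j) 1 m = 0.
Proof.
  intros n m v Hnm.
  destruct (linear_dependence n (seq 1 m) v) as (d & (i & Hi & Hd) & H);
    [apply seq_NoDup|now rewrite length_seq|].
  exists d. split.
  - exists i. split; trivial. apply in_seq in Hi. lia.
  - intros j Hj. change m with (0 + m)%nat. rewrite sum_n_m_lsum. auto.
Qed.

Lemma sum_exchange : forall (c : nat -> R) (f : nat -> nat -> R) n m,
  sum_n_m (fun i => c i * sum_n_m (f i) 1 n) 1 m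
  = sum_n_m (fun j => sum_n_m (fun i => c i * f i j) 1 m) 1 n.
Proof.
  intros c f n m. induction m.
  - rewrite sum_n_m_zero by lia. symmetry.
    erewrite sum_n_m_ext; [apply (@sum_n_m_const_zero R_AbelianMonoid)|]. intros k.
    now rewrite sum_n_m_zero by lia.
  - rewrite sum_n_Sm by lia. rewrite IHm.
    rewrite (sum_n_m_ext (fun j => sum_n_m (fun i => c i * f i j) 1 (S m))
      (fun j => plus (sum_n_m (fun i => c i * f i j) 1 m) (c (S m) * f (S m) j)))
      by (intros j; rewrite sum_n_Sm by lia; reflexivity).
    rewrite sum_n_m_plus. f_equal. symmetry.
    apply (@sum_n_m_mult_l R_Ring (c (S m)) (f (S m)) 1 n).
Qed.

Definition add_scaled (X : vfield) (c : R) (Y : vfield) : vfield :=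
  fun k x y => X k x y + c * Y k x y.

Lemma lincomb_S : forall n c b k x y,
  lincomb (S n) c b k x y = add_scaled (lincomb n c b) (c (S n)) (b (S n)) k x y.
Proof. intros. unfold lincomb. now rewrite sum_n_Sm by lia. Qed.

Lemma lincomb_0 : forall c b k x y, lincomb 0 c b k x y = 0.
Proof. intros. unfold lincomb. now rewrite sum_n_m_zero by lia. Qed.

Lemma lincomb_ext : forall n c c' b b' k x y,
  (forall i, (1 <= i <= n)%nat -> c i = c' i /\ b i k x y = b' i k x y) ->
  lincomb n c b k x y = lincomb n c' b' k x y.
Proof.
  intros n c c' b b' k x y H. apply sum_n_m_ext_loc. intros i Hi.
  destruct (H i Hi) as [-> ->]. reflexivity.
Qed.

Lemma smooth_add_scaled : forall (U : Defs.domain) X c Y, open_domain U ->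
  smooth_field U X -> smooth_field U Y -> smooth_field U (add_scaled X c Y).
Proof. intros U X c Y HU HX HY k. unfold add_scaled. smooth. Qed.

Lemma partial_add_scaled : forall (U : Defs.domain) X c Y i k x y, open_domain U ->
  smooth_field U X -> smooth_field U Y -> U x y ->
  partial i (add_scaled X c Y k) x y
  = partial i (X k) x y + c * partial i (Y k) x y.
Proof.
  intros U X c Y i k x y HU HX HY Hxy. unfold add_scaled.
  eapply partial_eq; [differentiate|cbv beta; ring].
Qed.

Lemma lie_connection_add_scaled : forall (U : Defs.domain) N X c Y i j k x y, open_domain U ->
  smooth_field U X -> smooth_field U Y -> U x y ->
  lie_connection N (add_scaled X c Y) i j k x y
  = lie_connection N X i j k x y + c * lie_connection N Y i j k x y.
Proof.
  intros U N X c Y i j k x y HU HX HY Hxy. unfold lie_connection.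
  rewrite (partial_ext_on U i (partial j (add_scaled X c Y k))
    (fun u v => partial j (X k) u v + c * partial j (Y k) u v)); trivial.
  - unfold sum_idx. rewrite !(partial_add_scaled U) by trivial.
    rewrite (partial_eq i _ x y
      (partial i (partial j (X k)) x y + (0 * partial j (Y k) x y + c * partial i (partial j (Y k)) x y))
      (partial i (partial j (X k)) x y + c * partial i (partial j (Y k)) x y)).
    + unfold add_scaled. ring.
    + apply is_partial_plus; [|apply is_partial_mult]; try apply is_partial_const;
        (eapply smooth_is_partial; [smooth|eassumption]).
    + ring.
  - intros. now apply partial_add_scaled with U.
Qed.

Lemma killing_add_scaled : forall (U : Defs.domain) N X c Y, open_domain U ->
  smooth_connection U N -> killing U N X -> killing U N Y ->
  killing U N (add_scaled X c Y).
Proof.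
  intros U N X c Y HU HN HX HY.
  apply killing_iff in HX, HY; trivial. destruct HX as [SX KX], HY as [SY KY].
  apply killing_iff; trivial. split; [now apply smooth_add_scaled|].
  intros. rewrite (lie_connection_add_scaled U) by trivial.
  rewrite KX, KY by trivial. ring.
Qed.

Lemma smooth_zero_field : forall U : Defs.domain, open_domain U ->
  smooth_field U zero_field.
Proof. intros U HU k. unfold zero_field. smooth. Qed.

Lemma killing_zero : forall (U : Defs.domain) N, open_domain U ->
  smooth_connection U N -> killing U N zero_field.
Proof.
  intros U N HU HN. apply killing_iff; trivial.
  split; [now apply smooth_zero_field|].
  intros. unfold lie_connection, zero_field, sum_idx.
  change (partial j (fun _ _ => 0)) with (fun u v => partial j (fun _ _ => 0) u v).
  rewrite (partial_ext_on U i _ (fun _ _ => 0)) by (trivial; intros; apply partial_const).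
  rewrite !partial_const. ring.
Qed.

Lemma killing_lincomb : forall (U : Defs.domain) N n c b, open_domain U ->
  smooth_connection U N -> (forall i, (1 <= i <= n)%nat -> killing U N (b i)) ->
  killing U N (lincomb n c b).
Proof.
  intros U N n c b HU HN Hb. induction n.
  - apply (killing_ext U N N zero_field); trivial.
    + now intros i j k x y _.
    + intros k x y _. now rewrite lincomb_0.
    + now apply killing_zero.
  - apply (killing_ext U N N (add_scaled (lincomb n c b) (c (S n)) (b (S n)))); trivial.
    + now intros i j k x y _.
    + intros k x y _. now rewrite lincomb_S.
    + apply killing_add_scaled; trivial.
      * apply IHn. intros; apply Hb; lia.
      * apply Hb; lia.
Qed.

(** The functionals of interest read off a component of the 1-jet at a point; they
    are linear on smooth fields only, where derivatives exist. *)
Definition linear_functional (U : Defs.domain) (phi : vfield -> R) : Prop :=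
  (forall X Y, eq_field U X Y -> phi X = phi Y) /\
  (forall X c Y, smooth_field U X -> smooth_field U Y ->
     phi (add_scaled X c Y) = phi X + c * phi Y).

Lemma linear_functional_eval : forall (U : Defs.domain) k x y, U x y ->
  linear_functional U (fun X => X k x y).
Proof. intros U k x y Hxy. split; [intros; auto|]. now intros. Qed.

Lemma linear_functional_partial : forall (U : Defs.domain) i k x y, open_domain U -> U x y ->
  linear_functional U (fun X => partial i (X k) x y).
Proof.
  intros U i k x y HU Hxy. split.
  - intros. apply partial_ext_on with U; auto.
  - intros. now apply partial_add_scaled with U.
Qed.

Lemma linear_functional_zero : forall (U : Defs.domain) phi, open_domain U ->
  linear_functional U phi -> phi zero_field = 0.
Proof.
  intros U phi HU [He Hl].
  assert (H := Hl zero_field (-1) zero_field (smooth_zero_field U HU) (smooth_zero_field U HU)).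
  rewrite (He _ zero_field) in H; [lra|].
  intros k x y _. unfold add_scaled, zero_field. ring.
Qed.

Lemma linear_functional_lincomb : forall (U : Defs.domain) phi n c b, open_domain U ->
  linear_functional U phi -> (forall i, (1 <= i <= n)%nat -> smooth_field U (b i)) ->
  smooth_field U (lincomb n c b) /\
  phi (lincomb n c b) = sum_n_m (fun i => c i * phi (b i)) 1 n.
Proof.
  intros U phi n c b HU Hphi Hb. destruct (Hphi) as [He Hl].
  induction n.
  - rewrite sum_n_m_zero by lia. split.
    + intros k. apply smooth_ext_on with (zero_field k);
        [trivial|intros; symmetry; apply lincomb_0|now apply smooth_zero_field].
    + rewrite (He _ zero_field); [now apply linear_functional_zero with U|].
      intros k x y _. apply lincomb_0.
  - destruct IHn as [Sn En]; [intros; apply Hb; lia|].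
    assert (SS : smooth_field U (b (S n))) by (apply Hb; lia).
    split.
    + intros k. apply smooth_ext_on
        with (add_scaled (lincomb n c b) (c (S n)) (b (S n)) k);
        [trivial|intros; symmetry; apply lincomb_S|now apply smooth_add_scaled].
    + rewrite (He _ (add_scaled (lincomb n c b) (c (S n)) (b (S n))))
        by (intros k x y _; apply lincomb_S).
      rewrite Hl, En, sum_n_Sm by (trivial; lia). reflexivity.
Qed.

Lemma choice : forall (A B : Type) (P : A -> B -> Prop),
  (forall x, exists y, P x y) -> exists f : A -> B, forall x, P x (f x).
Proof.
  intros A B P H.
  exists (fun x => proj1_sig (constructive_indefinite_description _ (H x))).
  intros x. apply proj2_sig.
Qed.

Lemma lincomb_snoc : forall n d b X k x y,
  lincomb (S n) d (fun i => if Nat.eq_dec i (S n) then X else b i) k x y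
  = lincomb n d b k x y + d (S n) * X k x y.
Proof.
  intros n d b X k x y. rewrite lincomb_S. unfold add_scaled. f_equal.
  - apply lincomb_ext. intros i Hi. split; trivial.
    destruct (Nat.eq_dec i (S n)); [lia|trivial].
  - destruct (Nat.eq_dec (S n) (S n)); [trivial|congruence].
Qed.

Definition independent (U : Defs.domain) (n : nat) (b : nat -> vfield) : Prop :=
  forall c, eq_field U (lincomb n c b) zero_field ->
    forall i, (1 <= i <= n)%nat -> c i = 0.

Definition killing_basis (U : Defs.domain) (N : connection) (n : nat)
    (b : nat -> vfield) : Prop :=
  (forall i, (1 <= i <= n)%nat -> killing U N (b i)) /\
  independent U n b /\
  (forall X, killing U N X -> exists c, eq_field U X (lincomb n c b)).

Lemma span_of_dependent : forall (U : Defs.domain) n b X d i0,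
  independent U n b -> (1 <= i0 <= S n)%nat -> d i0 <> 0 ->
  eq_field U (lincomb (S n) d (fun i => if Nat.eq_dec i (S n) then X else b i)) zero_field ->
  exists c, eq_field U X (lincomb n c b).
Proof.
  intros U n b X d i0 Hind Hi0 Hd Z.
  destruct (Req_dec (d (S n)) 0) as [D0|D0].
  - exfalso. apply Hd. destruct (Nat.eq_dec i0 (S n)) as [->|Hne]; trivial.
    apply Hind; [|lia]. intros k x y Hxy.
    rewrite <- (Z k x y Hxy), lincomb_snoc, D0. ring.
  - exists (fun i => - d i / d (S n)). intros k x y Hxy.
    assert (F : lincomb n (fun i => - d i / d (S n)) b k x y
       = - / d (S n) * lincomb n d b k x y).
    { unfold lincomb. rewrite <- (@sum_n_m_mult_l R_Ring).
      apply sum_n_m_ext. intros i. unfold mult; simpl. field. trivial. }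
    rewrite F. specialize (Z k x y Hxy). rewrite lincomb_snoc in Z.
    unfold zero_field in Z.
    replace (lincomb n d b k x y) with (- (d (S n) * X k x y)) by lra.
    field. trivial.
Qed.

(** The fields span because a further Killing field together with them gives
    [n + 1] vectors of R^n under [phi]; these are dependent, and [phi] is injective
    on Killing fields. *)
Lemma killing_basis_intro : forall (U : Defs.domain) N n b (phi : nat -> vfield -> R),
  open_domain U -> smooth_connection U N ->
  (forall j, linear_functional U (phi j)) ->
  (forall i, (1 <= i <= n)%nat -> killing U N (b i)) ->
  independent U n b ->
  (forall X, killing U N X -> (forall j, (1 <= j <= n)%nat -> phi j X = 0) ->
     eq_field U X zero_field) ->
  killing_basis U N n b.
Proof.
  intros U N n b phi HU HN Hphi Hb Hind Hdet. split; [|split]; trivial.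
  intros X HX.
  pose (b' := fun i => if Nat.eq_dec i (S n) then X else b i).
  assert (Hb' : forall i, (1 <= i <= S n)%nat -> killing U N (b' i)).
  { intros i Hi. unfold b'. destruct (Nat.eq_dec i (S n)); trivial. apply Hb; lia. }
  destruct (linear_dependence_sum n (S n) (fun i j => phi j (b' i)))
    as (d & (i0 & Hi0 & Hd) & H); [lia|].
  apply (span_of_dependent U n b X d i0); trivial. fold b'.
  apply Hdet; [now apply killing_lincomb|]. intros j Hj.
  destruct (linear_functional_lincomb U (phi j) (S n) d b') as [_ ->]; auto.
  intros; now apply Hb'.
Qed.

(** Expand the [m] fields in a basis with [n] elements; the coefficient vectors are
    dependent. *)
Lemma dependent_of_killing_dim : forall (U : Defs.domain) N n m b',
  killing_dim U N n -> (n < m)%nat ->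
  (forall i, (1 <= i <= m)%nat -> killing U N (b' i)) ->
  exists d : nat -> R, (exists i, (1 <= i <= m)%nat /\ d i <> 0) /\
    eq_field U (lincomb m d b') zero_field.
Proof.
  intros U N n m b' (b & Hb & _ & Hs) Hlt Hb'.
  assert (C : exists C : nat -> nat -> R, forall i, (1 <= i <= m)%nat ->
            eq_field U (b' i) (lincomb n (C i) b)).
  { apply (choice _ _
      (fun i (c : nat -> R) => (1 <= i <= m)%nat -> eq_field U (b' i) (lincomb n c b))).
    intros i. destruct (classic (1 <= i <= m)%nat) as [Hi|Hi].
    - destruct (Hs (b' i)) as [c Hc]; eauto.
    - exists (fun _ => 0). tauto. }
  destruct C as [C HC].
  destruct (linear_dependence_sum n m C Hlt) as (d & Hd & H).
  exists d. split; trivial. intros k x y Hxy. unfold lincomb, zero_field.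
  rewrite (sum_n_m_ext_loc _
    (fun i => d i * sum_n_m (fun j => C i j * b j k x y) 1 n))
    by (intros; now rewrite HC).
  rewrite sum_exchange.
  rewrite (sum_n_m_ext_loc _ (fun _ => zero)).
  - apply (@sum_n_m_const_zero R_AbelianMonoid).
  - intros j Hj. rewrite (sum_n_m_ext _ (fun i => mult (d i * C i j) (b j k x y)))
      by (intros; unfold mult; simpl; ring).
    etransitivity;
      [apply (@sum_n_m_mult_r R_Ring (b j k x y) (fun i => d i * C i j))|].
    specialize (H j Hj).
    change (@sum_n_m R_AbelianMonoid (fun i => d i * C i j) 1 m * b j k x y = 0).
    rewrite H. ring.
Qed.

Lemma killing_dim_le : forall (U : Defs.domain) N n m, killing_dim U N n -> killing_dim U N m ->
  (m <= n)%nat.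
Proof.
  intros U N n m Hn (b' & Hb' & Hi' & _).
  destruct (Nat.le_gt_cases m n) as [|Hlt]; trivial. exfalso.
  destruct (dependent_of_killing_dim U N n m b' Hn Hlt Hb') as (d & (i & Hi & Hd) & Z).
  apply Hd. now apply Hi'.
Qed.

Lemma killing_dim_unique : forall (U : Defs.domain) N n m, killing_dim U N n -> killing_dim U N m ->
  n = m.
Proof.
  intros U N n m Hn Hm.
  apply Nat.le_antisymm; eapply killing_dim_le; eassumption.
Qed.

(** * Transport of vector fields along a diffeomorphism *)

Lemma jacobian_left_inverse : forall (U V : Defs.domain) Phi Psi i j x y,
  open_domain U -> open_domain V ->
  maps_to U V Phi -> maps_to V U Psi -> left_inverse_on U Psi Phi -> U x y ->
  sum_idx (fun k => partial k (Psi i) (Phi i1 x y) (Phi i2 x y)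
                    * partial j (Phi k) x y)
  = coord_field j i x y.
Proof.
  intros U V Phi Psi i j x y HU HV [SPhi HPhi] [SPsi HPsi] HL Hxy.
  assert (D : is_partial j (fun u v => Psi i (Phi i1 u v) (Phi i2 u v)) x y
    (sum_idx (fun k => partial k (Psi i) (Phi i1 x y) (Phi i2 x y)
                    * partial j (Phi k) x y))).
  { unfold sum_idx. apply is_partial_comp with U V; auto; now apply smooth_Cn. }
  rewrite <- (is_partial_unique _ _ _ _ _ D).
  destruct i.
  - rewrite (partial_ext_on U j _ (fun u _ => u)); auto.
    + destruct j; simpl; [apply Derive_id|apply Derive_const].
    + intros u v Huv. apply HL, Huv.
  - rewrite (partial_ext_on U j _ (fun _ v => v)); auto.
    + destruct j; simpl; [apply Derive_const|apply Derive_id].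
    + intros u v Huv. apply HL, Huv.
Qed.

Lemma jacobian_injective : forall (U V : Defs.domain) Phi (w : idx -> R) x y,
  open_domain U -> open_domain V -> diffeo U V Phi -> U x y ->
  (forall k, sum_idx (fun i => partial i (Phi k) x y * w i) = 0) ->
  forall i, w i = 0.
Proof.
  intros U V Phi w x y HU HV [HPhi (Psi & HPsi & HL & _)] Hxy H i.
  assert (J := fun j => jacobian_left_inverse U V Phi Psi i j x y HU HV HPhi HPsi HL Hxy).
  transitivity (sum_idx (fun j => coord_field j i x y * w j)).
  - unfold sum_idx, coord_field. destruct i; ring.
  - assert (J1 := J i1). assert (J2 := J i2).
    assert (H1 := H i1). assert (H2 := H i2). unfold sum_idx in *.
    rewrite <- J1, <- J2.
    transitivity
      (partial i1 (Psi i) (Phi i1 x y) (Phi i2 x y)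
         * (partial i1 (Phi i1) x y * w i1 + partial i2 (Phi i1) x y * w i2)
       + partial i2 (Psi i) (Phi i1 x y) (Phi i2 x y)
         * (partial i1 (Phi i2) x y * w i1 + partial i2 (Phi i2) x y * w i2)).
    + ring.
    + rewrite H1, H2. ring.
Qed.

Lemma related_push : forall (U V : Defs.domain) Phi X, open_domain U -> open_domain V ->
  diffeo U V Phi -> smooth_field U X ->
  exists X', smooth_field V X' /\ related U Phi X X'.
Proof.
  intros U V Phi X HU HV [[SPhi HPhi] (Psi & [SPsi HPsi] & HL & _)] SX.
  exists (fun k u v => sum_idx (fun i =>
    partial i (Phi k) (Psi i1 u v) (Psi i2 u v) * X i (Psi i1 u v) (Psi i2 u v))).
  assert (S : forall f, smooth_on U f ->
    smooth_on V (fun u v => f (Psi i1 u v) (Psi i2 u v))).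
  { intros f Hf. apply smooth_comp with U; auto. }
  split.
  - intros k. unfold sum_idx.
    apply smooth_plus; trivial; apply smooth_mult; trivial; apply S;
      auto using smooth_partial.
  - intros k x y Hxy. destruct (HL x y Hxy) as [-> ->]. reflexivity.
Qed.

Lemma related_pull : forall (U V : Defs.domain) Phi X', open_domain U -> open_domain V ->
  diffeo U V Phi -> smooth_field V X' ->
  exists X, smooth_field U X /\ related U Phi X X'.
Proof.
  intros U V Phi X' HU HV [HPhi (Psi & HPsi & HL & HR)] SX.
  destruct (HPhi) as [SPhi MPhi], (HPsi) as [SPsi MPsi].
  exists (fun i x y => sum_idx (fun k =>
    partial k (Psi i) (Phi i1 x y) (Phi i2 x y) * X' k (Phi i1 x y) (Phi i2 x y))).
  assert (S : forall f, smooth_on V f ->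
    smooth_on U (fun u v => f (Phi i1 u v) (Phi i2 u v))).
  { intros f Hf. apply smooth_comp with V; auto. }
  split.
  - intros k. unfold sum_idx.
    apply smooth_plus; trivial; apply smooth_mult; trivial; apply S;
      auto using smooth_partial.
  - intros k x y Hxy.
    assert (J := fun j => jacobian_left_inverse V U Psi Phi k j _ _
      HV HU HPsi HPhi HR (MPhi x y Hxy)).
    destruct (HL x y Hxy) as [E1 E2]. rewrite E1, E2 in J.
    assert (J1 := J i1). assert (J2 := J i2).
    transitivity (sum_idx (fun j =>
      coord_field j k (Phi i1 x y) (Phi i2 x y) * X' j (Phi i1 x y) (Phi i2 x y))).
    + unfold sum_idx, coord_field. destruct k; ring.
    + unfold sum_idx in *. rewrite <- J1, <- J2. ring.
Qed.

(** The relation between two related fields, differentiated by the chain rule; all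
    naturality statements below are combinations of it. *)
Lemma related_derivative : forall (U V : Defs.domain) Phi X X' k j x y,
  open_domain U -> open_domain V -> maps_to U V Phi ->
  smooth_field U X -> smooth_field V X' -> related U Phi X X' -> U x y ->
  sum_idx (fun l => partial l (X' k) (Phi i1 x y) (Phi i2 x y)
                    * partial j (Phi l) x y)
  = sum_idx (fun i => partial j (partial i (Phi k)) x y * X i x y
                      + partial i (Phi k) x y * partial j (X i) x y).
Proof.
  intros U V Phi X X' k j x y HU HV [SPhi MPhi] SX SX' HR Hxy.
  transitivity (partial j (fun u v => X' k (Phi i1 u v) (Phi i2 u v)) x y).
  - symmetry. apply is_partial_unique. unfold sum_idx.
    apply is_partial_comp with U V; auto; apply smooth_Cn; auto.
  - rewrite (partial_ext_on U j _
      (fun u v => sum_idx (fun i => partial i (Phi k) u v * X i u v))) by auto.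
    unfold sum_idx. eapply partial_eq.
    + assert (S := SPhi k). differentiate.
    + cbv beta. ring.
Qed.

Lemma related_bracket : forall (U V : Defs.domain) Phi X X' Y Y',
  open_domain U -> open_domain V -> maps_to U V Phi ->
  smooth_field U X -> smooth_field V X' -> smooth_field U Y -> smooth_field V Y' ->
  related U Phi X X' -> related U Phi Y Y' ->
  related U Phi (bracket X Y) (bracket X' Y').
Proof.
  intros U V Phi X X' Y Y' HU HV HPhi SX SX' SY SY' RX RY k x y Hxy.
  assert (EX := fun j => related_derivative U V Phi X X' k j x y HU HV HPhi SX SX' RX Hxy).
  assert (EY := fun j => related_derivative U V Phi Y Y' k j x y HU HV HPhi SY SY' RY Hxy).
  transitivity
    (sum_idx (fun j => X j x y *
       sum_idx (fun l => partial l (Y' k) (Phi i1 x y) (Phi i2 x y)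
                         * partial j (Phi l) x y)
     - Y j x y *
       sum_idx (fun l => partial l (X' k) (Phi i1 x y) (Phi i2 x y)
                         * partial j (Phi l) x y))).
  - unfold bracket, sum_idx. rewrite !RX, !RY by trivial.
    unfold sum_idx. ring.
  - unfold bracket, sum_idx at 1. rewrite !EX, !EY. unfold sum_idx.
    destruct HPhi as [SPhi _].
    rewrite !(smooth_Schwarz U (Phi k)) by auto. ring.
Qed.

(** The hypothesis is the transformation law of Christoffel symbols. *)
Lemma intertwines_of_symbols : forall (U V : Defs.domain) Phi N M,
  open_domain U -> open_domain V -> maps_to U V Phi ->
  (forall i j k x y, U x y ->
     partial i (partial j (Phi k)) x y
     + sum_idx (fun l => sum_idx (fun m =>
         M l m k (Phi i1 x y) (Phi i2 x y)
         * partial i (Phi l) x y * partial j (Phi m) x y))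
     = sum_idx (fun l => N i j l x y * partial l (Phi k) x y)) ->
  intertwines U V Phi N M.
Proof.
  intros U V Phi N M HU HV HPhi H X Y X' Y' SX SY SX' SY' RX RY k x y Hxy.
  assert (EY := fun j => related_derivative U V Phi Y Y' k j x y HU HV HPhi SY SY' RY Hxy).
  transitivity
    (sum_idx (fun i => X i x y *
       (sum_idx (fun l => partial l (Y' k) (Phi i1 x y) (Phi i2 x y)
                         * partial i (Phi l) x y)
       + sum_idx (fun j => Y j x y * sum_idx (fun l => sum_idx (fun m =>
         M l m k (Phi i1 x y) (Phi i2 x y)
         * partial i (Phi l) x y * partial j (Phi m) x y)))))).
  - unfold nabla, sum_idx. rewrite !RX, !RY by trivial.
    unfold sum_idx. ring.
  - assert (H' : forall i j, sum_idx (fun l => sum_idx (fun m =>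
         M l m k (Phi i1 x y) (Phi i2 x y)
         * partial i (Phi l) x y * partial j (Phi m) x y))
       = sum_idx (fun l => N i j l x y * partial l (Phi k) x y)
         - partial i (partial j (Phi k)) x y)
      by (intros i j; rewrite <- (H i j k x y Hxy); ring).
    transitivity (sum_idx (fun i => X i x y *
       (sum_idx (fun l => partial i (partial l (Phi k)) x y * Y l x y
                          + partial l (Phi k) x y * partial i (Y l) x y)
        + sum_idx (fun j => Y j x y *
            (sum_idx (fun l => N i j l x y * partial l (Phi k) x y)
             - partial i (partial j (Phi k)) x y))))).
    + unfold sum_idx at 1. rewrite !EY. unfold sum_idx in H'.
      unfold sum_idx. rewrite !H'. reflexivity.
    + unfold nabla, sum_idx. ring.
Qed.

Lemma related_sub : forall U Phi X X' Y Y',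
  related U Phi X X' -> related U Phi Y Y' ->
  related U Phi (sub_field X Y) (sub_field X' Y').
Proof.
  intros U Phi X X' Y Y' RX RY k x y Hxy. unfold sub_field.
  rewrite RX, RY by trivial. unfold sum_idx. ring.
Qed.

Lemma related_eq_zero : forall (U V : Defs.domain) Phi X X',
  open_domain U -> open_domain V -> diffeo U V Phi -> related U Phi X X' ->
  (eq_field U X zero_field <-> eq_field V X' zero_field).
Proof.
  intros U V Phi X X' HU HV HD R. split; intros H.
  - destruct HD as [_ (Psi & [_ MPsi] & _ & HR)].
    intros k u v Huv. destruct (HR u v Huv) as [E1 E2].
    transitivity (X' k (Phi i1 (Psi i1 u v) (Psi i2 u v))
                       (Phi i2 (Psi i1 u v) (Psi i2 u v))).
    { now rewrite E1, E2. }
    rewrite R by auto.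
    unfold sum_idx. rewrite !H by auto. unfold zero_field. ring.
  - intros k x y Hxy.
    apply (jacobian_injective U V Phi (fun i => X i x y) x y HU HV HD Hxy).
    intros l. rewrite <- R by trivial. apply H. apply HD, Hxy.
Qed.

(** The Killing operator is built from brackets and covariant derivatives, both of
    which respect related fields; test fields are moved between the two sides by the
    diffeomorphism. *)
Lemma related_killing : forall (U V : Defs.domain) Phi N M X X',
  open_domain U -> open_domain V -> smooth_connection U N -> smooth_connection V M ->
  diffeo U V Phi -> intertwines U V Phi N M ->
  smooth_field U X -> smooth_field V X' -> related U Phi X X' ->
  (killing U N X <-> killing V M X').
Proof.
  intros U V Phi N M X X' HU HV SN SM HD HI SX SX' RX.
  assert (HPhi := proj1 HD).
  assert (R : forall Y Y' Z Z', smooth_field U Y -> smooth_field V Y' ->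
    smooth_field U Z -> smooth_field V Z' -> related U Phi Y Y' -> related U Phi Z Z' ->
    related U Phi
      (sub_field (sub_field (bracket X (nabla N Y Z)) (nabla N Y (bracket X Z)))
                 (nabla N (bracket X Y) Z))
      (sub_field (sub_field (bracket X' (nabla M Y' Z')) (nabla M Y' (bracket X' Z')))
                 (nabla M (bracket X' Y') Z'))).
  { intros Y Y' Z Z' SY SY' SZ SZ' RY RZ.
    apply related_sub; [apply related_sub|].
    - apply related_bracket with V; auto using smooth_nabla.
    - apply HI; auto using smooth_bracket. apply related_bracket with V; auto.
    - apply HI; auto using smooth_bracket. apply related_bracket with V; auto. }
  split; intros [_ HK]; split; trivial; intros Y Z SY SZ.
  - destruct (related_pull U V Phi Y HU HV HD SY) as (Y0 & SY0 & RY).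
    destruct (related_pull U V Phi Z HU HV HD SZ) as (Z0 & SZ0 & RZ).
    apply (related_eq_zero U V Phi _ _ HU HV HD (R Y0 Y Z0 Z SY0 SY SZ0 SZ RY RZ)).
    now apply HK.
  - destruct (related_push U V Phi Y HU HV HD SY) as (Y' & SY' & RY).
    destruct (related_push U V Phi Z HU HV HD SZ) as (Z' & SZ' & RZ).
    apply (related_eq_zero U V Phi _ _ HU HV HD (R Y Y' Z Z' SY SY' SZ SZ' RY RZ)).
    now apply HK.
Qed.

Lemma related_lincomb : forall U Phi n c b b',
  (forall i, (1 <= i <= n)%nat -> related U Phi (b i) (b' i)) ->
  related U Phi (lincomb n c b) (lincomb n c b').
Proof.
  intros U Phi n c b b' H k x y Hxy. induction n.
  - unfold sum_idx. rewrite !lincomb_0. ring.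
  - unfold sum_idx in *. rewrite !lincomb_S. unfold add_scaled.
    rewrite IHn by (intros; apply H; lia). rewrite (H (S n)) by (trivial; lia).
    unfold sum_idx. ring.
Qed.

Lemma killing_dim_transport : forall (U V : Defs.domain) Phi N M n,
  open_domain U -> open_domain V -> smooth_connection U N -> smooth_connection V M ->
  diffeo U V Phi -> intertwines U V Phi N M ->
  killing_dim V M n -> killing_dim U N n.
Proof.
  intros U V Phi N M n HU HV SN SM HD HI (b' & Hb' & Hind & Hspan).
  assert (C : exists b : nat -> vfield, forall i, (1 <= i <= n)%nat ->
     smooth_field U (b i) /\ related U Phi (b i) (b' i)).
  { apply (choice _ _ (fun i X => (1 <= i <= n)%nat ->
      smooth_field U X /\ related U Phi X (b' i))).
    intros i. destruct (classic (1 <= i <= n)%nat) as [Hi|Hi].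
    - destruct (related_pull U V Phi (b' i) HU HV HD) as [X HX]; eauto.
      apply Hb', Hi.
    - exists zero_field; tauto. }
  destruct C as [b Hb].
  assert (RL : forall c, related U Phi (lincomb n c b) (lincomb n c b')).
  { intros c. apply related_lincomb. intros i Hi. now apply Hb. }
  exists b. split; [|split].
  - intros i Hi. destruct (Hb i Hi) as [S R].
    apply (related_killing U V Phi N M (b i) (b' i)); auto. now apply Hb'.
  - intros c Hc. apply Hind.
    now apply (related_eq_zero U V Phi _ _ HU HV HD (RL c)).
  - intros X HX. assert (SX := proj1 HX).
    destruct (related_push U V Phi X HU HV HD SX) as (X' & SX' & RX).
    apply (related_killing U V Phi N M X X') in HX; auto.
    destruct (Hspan X' HX) as [c Hc]. exists c.
    assert (Z := proj2 (related_eq_zero U V Phi _ _ HU HV HD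
      (related_sub U Phi X X' _ _ RX (RL c)))).
    assert (Z' : eq_field U (sub_field X (lincomb n c b)) zero_field).
    { apply Z. intros k u v Huv. unfold sub_field, zero_field.
      rewrite Hc by trivial. ring. }
    intros k x y Hxy. specialize (Z' k x y Hxy). unfold sub_field, zero_field in Z'. lra.
Qed.

(** Every translation-invariant structure has such a pair, the two coordinate fields;
    this is how the property is carried to the half-plane. *)
Definition commuting_pair (U : Defs.domain) (N : connection) : Prop :=
  exists X Y, killing U N X /\ killing U N Y /\
    eq_field U (bracket X Y) zero_field /\
    forall s t, eq_field U (fun k x y => s * X k x y + t * Y k x y) zero_field ->
      s = 0 /\ t = 0.

Lemma related_combination : forall U Phi s t X X' Y Y',
  related U Phi X X' -> related U Phi Y Y' ->
  related U Phi (fun k x y => s * X k x y + t * Y k x y)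
                (fun k x y => s * X' k x y + t * Y' k x y).
Proof.
  intros U Phi s t X X' Y Y' RX RY k x y Hxy. rewrite RX, RY by trivial.
  unfold sum_idx. ring.
Qed.

Lemma commuting_pair_transport : forall (U V : Defs.domain) Phi N M,
  open_domain U -> open_domain V -> smooth_connection U N -> smooth_connection V M ->
  diffeo U V Phi -> intertwines U V Phi N M ->
  (commuting_pair U N <-> commuting_pair V M).
Proof.
  intros U V Phi N M HU HV SN SM HD HI.
  assert (T : forall X X' Y Y', smooth_field U X -> smooth_field V X' ->
    smooth_field U Y -> smooth_field V Y' -> related U Phi X X' -> related U Phi Y Y' ->
    (eq_field U (bracket X Y) zero_field <-> eq_field V (bracket X' Y') zero_field) /\
    forall s t,
      (eq_field U (fun k x y => s * X k x y + t * Y k x y) zero_field <->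
       eq_field V (fun k x y => s * X' k x y + t * Y' k x y) zero_field)).
  { intros X X' Y Y' SX SX' SY SY' RX RY. split.
    - apply related_eq_zero with Phi; trivial.
      apply related_bracket with V; trivial. apply HD.
    - intros s t. apply related_eq_zero with Phi; trivial.
      now apply related_combination. }
  split; intros (X & Y & KX & KY & HB & HL);
    assert (SX := proj1 KX); assert (SY := proj1 KY).
  - destruct (related_push U V Phi X HU HV HD SX) as (X' & SX' & RX).
    destruct (related_push U V Phi Y HU HV HD SY) as (Y' & SY' & RY).
    destruct (T X X' Y Y') as [T1 T2]; trivial.
    exists X', Y'. split; [|split; [|split]].
    + now apply (related_killing U V Phi N M X X').
    + now apply (related_killing U V Phi N M Y Y').
    + now apply T1.
    + intros s t H. apply HL. now apply T2.
  - destruct (related_pull U V Phi X HU HV HD SX) as (X' & SX' & RX).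
    destruct (related_pull U V Phi Y HU HV HD SY) as (Y' & SY' & RY).
    destruct (T X' X Y' Y) as [T1 T2]; trivial.
    exists X', Y'. split; [|split; [|split]].
    + now apply (related_killing U V Phi N M X' X).
    + now apply (related_killing U V Phi N M Y' Y).
    + now apply T1.
    + intros s t H. apply HL. now apply T2.
Qed.

(** With constant symbols the coordinate fields are Killing fields. *)
Lemma typeA_commuting_pair : forall M, typeA M ->
  smooth_connection plane M /\ commuting_pair plane M.
Proof.
  intros M (A & _ & HA).
  assert (SM : smooth_connection plane M).
  { intros i j k. apply smooth_ext_on with (fun _ _ => A i j k).
    - apply open_plane.
    - intros; symmetry; now apply HA.
    - apply smooth_const, open_plane. }
  assert (K : forall m, killing plane M (coord_field m)).
  { intros m. apply killing_iff; trivial using open_plane. split.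
    - apply smooth_coord_field, open_plane.
    - intros i j k x y Hxy. unfold lie_connection, sum_idx.
      rewrite !(fun l => partial_ext_on plane l (M i j k) (fun _ _ => A i j k) x y
                 open_plane Hxy (HA i j k)).
      unfold coord_field.
      change (partial j (fun _ _ => match m with
         | i1 => match k with i1 => 1 | i2 => 0 end
         | i2 => match k with i1 => 0 | i2 => 1 end end)) with
        (fun u v : R => partial j (fun _ _ => match m with
         | i1 => match k with i1 => 1 | i2 => 0 end
         | i2 => match k with i1 => 0 | i2 => 1 end end) u v).
      rewrite (partial_ext_on plane i _ (fun _ _ => 0))
        by (auto using open_plane, partial_const).
      rewrite !partial_const. ring. }
  split; trivial.
  exists (coord_field i1), (coord_field i2). split; [|split; [|split]]; auto.
  - intros k x y _. unfold bracket, sum_idx, coord_field.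
    rewrite !partial_const. unfold zero_field. ring.
  - intros s t H. assert (H1 := H i1 0 0 I). assert (H2 := H i2 0 0 I).
    unfold coord_field, zero_field in *. split; lra.
Qed.

Lemma also_typeA_commuting_pair : forall N, smooth_connection half_plane N ->
  also_typeA N -> commuting_pair half_plane N.
Proof.
  intros N SN (M & HM & Phi & HD & HI).
  destruct (typeA_commuting_pair M HM) as [SM HC].
  apply (commuting_pair_transport half_plane plane Phi N M);
    auto using open_half_plane, open_plane.
Qed.

(** * Uniqueness for linear differential equations *)

Definition between (t0 t1 t : R) : Prop := Rmin t0 t1 <= t <= Rmax t0 t1.

(** The bound makes [g] times a decaying exponential monotone. *)
Lemma gronwall_zero : forall g g' K t0 t1,
  (forall t, between t0 t1 t -> is_derive g t (g' t)) ->
  (forall t, between t0 t1 t -> 0 <= g t /\ Rabs (g' t) <= K * g t) ->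
  g t0 = 0 -> g t1 = 0.
Proof.
  intros g g' K t0 t1 Hd Hb H0.
  (* The sign makes the weighted function decrease from t0 towards t1. *)
  pose (s := if Rle_dec t0 t1 then - K else K).
  destruct (MVT_gen (fun t => g t * exp (s * (t - t0))) t0 t1
    (fun t => (g' t + s * g t) * exp (s * (t - t0)))) as (u & Hu & E).
  - intros t Ht. assert (D := Hd t ltac:(unfold between; lra)).
    auto_derive; [now exists (g' t)|].
    change (Derive (fun x => g x) t) with (Derive g t).
    rewrite (is_derive_unique _ _ _ D). unfold Rminus. ring.
  - intros t Ht. assert (D := Hd t Ht).
    apply continuity_pt_filterlim.
    apply (ex_derive_continuous (fun t => g t * exp (s * (t - t0)))).
    auto_derive. now exists (g' t).
  - rewrite H0 in E.
    assert (B1 : between t0 t1 t1) by (unfold between; split; [apply Rmin_r|apply Rmax_r]).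
    destruct (Hb t1 B1) as [G1 _]. destruct (Hb u Hu) as [Gu Gu'].
    apply Rabs_le_between in Gu'.
    assert (P1 := exp_pos (s * (t1 - t0))). assert (Pu := exp_pos (s * (u - t0))).
    assert (L : g t1 * exp (s * (t1 - t0)) <= 0).
    { replace (g t1 * exp (s * (t1 - t0)))
        with (exp (s * (u - t0)) * ((g' u + s * g u) * (t1 - t0))) by lra.
      apply Rmult_le_0_l; [lra|]. unfold s. destruct (Rle_dec t0 t1); nra. }
    nra.
Qed.

(** Closed under sums and under products with bounded coefficients, so that the
    right hand sides of a linear system need not be written as a matrix. *)
Definition dominated (I : R -> Prop) (S e : R -> R) : Prop :=
  exists C, 0 <= C /\ forall t, I t -> Rabs (e t) <= C * S t.

Definition bounded_on (I : R -> Prop) (k : R -> R) : Prop :=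
  exists B, forall t, I t -> Rabs (k t) <= B.

Lemma dominated_plus : forall I S e1 e2, dominated I S e1 -> dominated I S e2 ->
  dominated I S (fun t => e1 t + e2 t).
Proof.
  intros I S e1 e2 (C1 & P1 & H1) (C2 & P2 & H2). exists (C1 + C2). split; [lra|].
  intros t Ht. specialize (H1 t Ht). specialize (H2 t Ht).
  assert (H := Rabs_triang (e1 t) (e2 t)). lra.
Qed.

Lemma dominated_mult : forall I S k e, bounded_on I k -> dominated I S e ->
  dominated I S (fun t => k t * e t).
Proof.
  intros I S k e (B & HB) (C & P & H). exists (Rabs B * C). split.
  - apply Rmult_le_pos; [apply Rabs_pos|trivial].
  - intros t Ht. specialize (H t Ht). specialize (HB t Ht).
    rewrite Rabs_mult, Rmult_assoc. assert (HB' := Rle_abs B).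
    apply Rmult_le_compat; try apply Rabs_pos; lra.
Qed.

Lemma dominated_opp : forall I S e, dominated I S e -> dominated I S (fun t => - e t).
Proof.
  intros I S e (C & P & H). exists C. split; trivial. intros t Ht.
  rewrite Rabs_Ropp. auto.
Qed.

Lemma bounded_const : forall I c, bounded_on I (fun _ => c).
Proof. intros I c. exists (Rabs c). intros; lra. Qed.

Lemma bounded_inv : forall t0 t1, 0 < t0 -> 0 < t1 -> bounded_on (between t0 t1) (fun t => / t).
Proof.
  intros t0 t1 H0 H1. exists (/ Rmin t0 t1). intros t Ht.
  assert (M : 0 < Rmin t0 t1) by now apply Rmin_glb_lt.
  unfold between in Ht.
  rewrite Rabs_pos_eq; [apply Rinv_le_contravar; lra|].
  apply Rlt_le, Rinv_0_lt_compat. lra.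
Qed.

Lemma lsum_nonneg : forall f l, (forall i, In i l -> 0 <= f i) -> 0 <= lsum f l.
Proof.
  intros f l H. induction l as [|a l IH]; unfold lsum in *; simpl; [lra|].
  assert (0 <= f a) by (apply H; now left).
  assert (0 <= fold_right Rplus 0 (map f l)) by (apply IH; intros; apply H; now right).
  lra.
Qed.

Lemma lsum_term_le : forall f l i, (forall i, In i l -> 0 <= f i) -> In i l ->
  f i <= lsum f l.
Proof.
  intros f l i H Hi. destruct (in_split _ _ Hi) as (l1 & l2 & ->).
  change (i :: l2) with ((i :: nil) ++ l2). rewrite !lsum_app.
  assert (0 <= lsum f l1) by (apply lsum_nonneg; intros; apply H, in_app_iff; auto).
  assert (0 <= lsum f l2)
    by (apply lsum_nonneg; intros; apply H, in_app_iff; simpl; auto).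
  unfold lsum at 2; simpl. lra.
Qed.

Lemma lsum_le_const : forall f l B, (forall i, In i l -> f i <= B) ->
  lsum f l <= INR (length l) * B.
Proof.
  intros f l B H. induction l as [|a l IH]; unfold lsum in *.
  - simpl. lra.
  - change (length (a :: l)) with (S (length l)). rewrite S_INR. simpl map.
    simpl fold_right. assert (f a <= B) by (apply H; now left).
    assert (fold_right Rplus 0 (map f l) <= INR (length l) * B)
      by (apply IH; intros; apply H; now right). lra.
Qed.

Lemma is_derive_lsum : forall (f f' : nat -> R -> R) l t,
  (forall i, In i l -> is_derive (f i) t (f' i t)) ->
  is_derive (fun t => lsum (fun i => f i t) l) t (lsum (fun i => f' i t) l).
Proof.
  intros f f' l t H. induction l as [|a l IH]; unfold lsum in *; simpl.
  - apply (is_derive_const 0).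
  - apply (is_derive_plus (f a)); [apply H; now left|].
    apply IH. intros; apply H; now right.
Qed.

(** Gronwall's inequality for the sum of the squares of the components. *)
Lemma linear_ode_zero : forall (l : list nat) (f f' : nat -> R -> R) t0 t1,
  (forall i t, In i l -> between t0 t1 t -> is_derive (f i) t (f' i t)) ->
  (forall i, In i l -> dominated (between t0 t1)
     (fun t => lsum (fun j => Rabs (f j t)) l) (f' i)) ->
  (forall i, In i l -> f i t0 = 0) ->
  forall i, In i l -> f i t1 = 0.
Proof.
  intros l f f' t0 t1 Hd Hb H0.
  pose (g := fun t => lsum (fun i => f i t * f i t) l).
  assert (Gpos : forall t i, In i l -> 0 <= f i t * f i t) by (intros t i _; exact (Rle_0_sqr (f i t))).
  assert (Gle : forall t i, In i l -> f i t * f i t <= g t)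
    by (intros t i Hi; apply (lsum_term_le (fun i => f i t * f i t)); auto).
  assert (HC : exists C, 0 <= C /\ forall i t, In i l -> between t0 t1 t ->
     Rabs (f' i t) <= C * lsum (fun j => Rabs (f j t)) l).
  { assert (HC' : forall l', incl l' l -> exists C, 0 <= C /\ forall i t, In i l' ->
       between t0 t1 t -> Rabs (f' i t) <= C * lsum (fun j => Rabs (f j t)) l).
    { induction l' as [|a l' IH]; intros Hl.
      - exists 0. split; [lra|]. intros i t [].
      - destruct (Hb a) as (C1 & P1 & H1); [apply Hl; now left|].
        destruct IH as (C2 & P2 & H2); [intros k Hk; apply Hl; now right|].
        exists (C1 + C2). split; [lra|]. intros i t Hi Ht.
        assert (0 <= lsum (fun j => Rabs (f j t)) l)
          by (apply lsum_nonneg; intros; apply Rabs_pos).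
        destruct Hi as [<-|Hi]; [specialize (H1 t Ht)|specialize (H2 i t Hi Ht)];
          cbv beta in *; nra. }
    apply HC', incl_refl. }
  destruct HC as (C & PC & HC).
  assert (G1 : g t1 = 0).
  { apply gronwall_zero with
      (fun t => lsum (fun i => f' i t * f i t + f i t * f' i t) l)
      (INR (length l) * (2 * C * INR (length l))) t0.
    - intros t Ht. unfold g.
      apply (is_derive_lsum (fun i t => f i t * f i t)
        (fun i t => f' i t * f i t + f i t * f' i t)).
      intros i Hi. apply (is_derive_mult (f i) (f i)); auto.
      intros; apply Rmult_comm.
    - intros t Ht. split; [unfold g; apply lsum_nonneg; exact (Gpos t)|].
      assert (B : forall i, In i l ->
        Rabs (f' i t * f i t + f i t * f' i t) <= 2 * C * INR (length l) * g t).
      { intros i Hi.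
        replace (f' i t * f i t + f i t * f' i t) with (2 * (f i t * f' i t)) by ring.
        rewrite Rabs_mult, Rabs_mult, (Rabs_pos_eq 2) by lra.
        assert (E : Rabs (f i t) * lsum (fun j => Rabs (f j t)) l
                  <= INR (length l) * g t).
        { replace (Rabs (f i t) * lsum (fun j => Rabs (f j t)) l)
            with (lsum (fun j => 0 + Rabs (f i t) * Rabs (f j t)) l).
          - apply lsum_le_const. intros j Hj.
            assert (Gi := Gle t i Hi). assert (Gj := Gle t j Hj).
            assert (Ai : Rabs (f i t) * Rabs (f i t) = f i t * f i t)
              by (rewrite <- Rabs_mult; apply Rabs_pos_eq; auto).
            assert (Aj : Rabs (f j t) * Rabs (f j t) = f j t * f j t)
              by (rewrite <- Rabs_mult; apply Rabs_pos_eq; auto).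
            nra.
          - rewrite lsum_linear, lsum_zero by trivial. ring. }
        specialize (HC i t Hi Ht). assert (PA := Rabs_pos (f i t)).
        apply Rle_trans with
          (2 * (C * (Rabs (f i t) * lsum (fun j => Rabs (f j t)) l))); nra. }
      rewrite Rmult_assoc. apply Rabs_le. split.
      + assert (L := lsum_le_const
          (fun i => 0 + (-1) * (f' i t * f i t + f i t * f' i t)) l
          (2 * C * INR (length l) * g t)).
        rewrite lsum_linear, lsum_zero in L by trivial.
        assert (L' := L ltac:(intros i Hi; specialize (B i Hi);
          apply Rabs_le_between in B; lra)). lra.
      + apply lsum_le_const. intros i Hi. specialize (B i Hi).
        apply Rabs_le_between in B. lra.
    - unfold g. apply lsum_zero. intros i Hi. rewrite H0 by trivial. ring. }
  intros i Hi. assert (E := Gle t1 i Hi). rewrite G1 in E. nra.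
Qed.

(** * Killing fields of a left-invariant structure on the ax+b group *)

Lemma smooth_of_x : forall f g : R -> R,
  (forall x, 0 < x -> is_derive f x (g x)) ->
  smooth_on half_plane (fun x _ => g x) -> smooth_on half_plane (fun x _ => f x).
Proof.
  intros f g Hf Hg.
  apply smooth_intro with
    (fun i x _ => match i with i1 => g x | i2 => 0 end); auto using open_half_plane.
  - intros [|] u v Huv; simpl; [now apply Hf|apply (is_derive_const (f u))].
  - intros [|]; trivial. apply smooth_const, open_half_plane.
Qed.

Lemma is_derive_Rpower : forall s x, 0 < x ->
  is_derive (fun x => Rpower x s) x (s * Rpower x (s - 1)).
Proof. intros s x Hx. apply is_derive_Reals. now apply derivable_pt_lim_power. Qed.

(** The derivative of a power is a power with another exponent, hence the induction
    on the order for all exponents at once. *)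
Lemma smooth_Rpower : forall s, smooth_on half_plane (fun x _ => Rpower x s).
Proof.
  assert (H : forall n s, Cn half_plane n (fun x _ => Rpower x s)).
  { assert (HD : forall s i u v, half_plane u v ->
      is_partial i (fun x _ => Rpower x s) u v
        (match i with i1 => s * Rpower u (s - 1) | i2 => 0 end)).
    { intros s [|] u v Huv; simpl; [now apply is_derive_Rpower|].
      apply (is_derive_const (Rpower u s)). }
    induction n; intros s.
    - intros x y Hxy. split; [|exact I].
      apply (continuity_1d_2d_pt_comp (fun x => Rpower x s) (fun x _ => x));
        [|apply continuity_2d_pt_id1].
      apply derivable_continuous_pt. exists (s * Rpower x (s - 1)).
      now apply derivable_pt_lim_power.
    - apply Cn_S_intro with
        (fun i u _ => match i with i1 => s * Rpower u (s - 1) | i2 => 0 end);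
        auto using open_half_plane.
      intros [|]; [|apply Cn_const, open_half_plane].
      apply Cn_mult; auto using open_half_plane.
      apply Cn_const, open_half_plane. }
  intros s n. exact (H n s).
Qed.

Lemma Rpower_m1 : forall x, 0 < x -> Rpower x (-1) = / x.
Proof.
  intros x Hx. replace (-1) with (- (1)) by ring.
  now rewrite Rpower_Ropp, Rpower_1.
Qed.

Definition inv_x : R -> R -> R := fun x _ => / x.

Lemma smooth_inv_x : smooth_on half_plane inv_x.
Proof.
  apply smooth_ext_on with (fun x _ => Rpower x (-1)); auto using open_half_plane.
  - intros u v Huv. now apply Rpower_m1.
  - apply smooth_Rpower.
Qed.

Lemma partial_inv_x : forall i x y, half_plane x y ->
  partial i inv_x x y = match i with i1 => - / x * / x | i2 => 0 end.
Proof.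
  intros i x y Hx. unfold half_plane in Hx. apply is_partial_unique.
  unfold inv_x. destruct i; simpl.
  - auto_derive; [lra|]. field. lra.
  - apply (is_derive_const (/ x)).
Qed.

Lemma smooth_NB : forall a b c d e f, smooth_connection half_plane (NB a b c d e f).
Proof.
  intros a b c d e f i j k. unfold NB.
  apply (smooth_mult half_plane inv_x (fun _ _ => Gamma a b c d e f i j k));
    auto using open_half_plane, smooth_inv_x, smooth_const.
Qed.

Lemma partial_NB : forall a b c d e f l i j k x y, half_plane x y ->
  partial l (NB a b c d e f i j k) x y
  = match l with i1 => - / x * / x * Gamma a b c d e f i j k | i2 => 0 end.
Proof.
  intros a b c d e f l i j k x y Hx.
  apply partial_eq with
    (partial l inv_x x y * Gamma a b c d e f i j k + inv_x x y * 0).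
  - apply (is_partial_mult l inv_x (fun _ _ => Gamma a b c d e f i j k)).
    + apply smooth_is_partial with half_plane; trivial using smooth_inv_x.
    + apply is_partial_const.
  - rewrite partial_inv_x by trivial. destruct l; ring.
Qed.

(** The value that the Killing equation prescribes for the second derivative
    [partial i (partial j (X k))] in terms of the 1-jet of [X]. *)
Definition hessian (G : idx -> idx -> idx -> R) (X : vfield) (i j k : idx) : R -> R -> R :=
  fun x y => inv_x x y * (inv_x x y * (G i j k * X i1 x y)
    + sum_idx (fun l => G i j l * partial l (X k) x y
        - G l j k * partial i (X l) x y - G i l k * partial j (X l) x y)).

Lemma killing_NB_iff : forall a b c d e f X,
  killing half_plane (NB a b c d e f) X <->
  smooth_field half_plane X /\
  forall i j k x y, half_plane x y ->
    partial i (partial j (X k)) x y = hessian (Gamma a b c d e f) X i j k x y.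
Proof.
  intros a b c d e f X.
  assert (E : forall i j k x y, half_plane x y ->
    lie_connection (NB a b c d e f) X i j k x y
    = partial i (partial j (X k)) x y - hessian (Gamma a b c d e f) X i j k x y).
  { intros i j k x y Hxy. unfold lie_connection, hessian, sum_idx.
    rewrite !partial_NB by trivial. unfold NB, inv_x. ring. }
  split; intros H.
  - apply killing_iff in H; [|apply open_half_plane|apply smooth_NB].
    destruct H as [S H]. split; trivial. intros i j k x y Hxy.
    specialize (H i j k x y Hxy). rewrite E in H by trivial. lra.
  - destruct H as [S H]. apply killing_iff; [apply open_half_plane|apply smooth_NB|].
    split; trivial. intros i j k x y Hxy. rewrite E, H by trivial. ring.
Qed.

(** The components are numbered so that they can be treated as the unknowns of a
    linear system. *)
Definition jet (X : vfield) (n : nat) : R -> R -> R :=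
  match n with
  | 0 => X i1 | 1 => X i2
  | 2 => partial i1 (X i1) | 3 => partial i1 (X i2)
  | 4 => partial i2 (X i1) | _ => partial i2 (X i2)
  end%nat.

(** The 1-jet solves a linear system of ordinary differential equations along each
    coordinate line. It vanishes along the horizontal line through (1,0), and then
    along every vertical line. *)
Lemma killing_zero_of_jet : forall a b c d e f X,
  killing half_plane (NB a b c d e f) X ->
  (forall k, X k 1 0 = 0) -> (forall i k, partial i (X k) 1 0 = 0) ->
  eq_field half_plane X zero_field.
Proof.
  intros a b c d e f X HK HX HP.
  apply killing_NB_iff in HK. destruct HK as [SX HK].
  pose (l := (0 :: 1 :: 2 :: 3 :: 4 :: 5 :: nil)%nat).
  pose (D := fun m n => match n with
    | 0 => partial m (X i1) | 1 => partial m (X i2)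
    | 2 => hessian (Gamma a b c d e f) X m i1 i1
    | 3 => hessian (Gamma a b c d e f) X m i1 i2
    | 4 => hessian (Gamma a b c d e f) X m i2 i1
    | _ => hessian (Gamma a b c d e f) X m i2 i2 end%nat).
  assert (HD : forall m n x y, half_plane x y ->
    is_partial m (jet X n) x y (D m n x y)).
  { intros m n x y Hxy.
    assert (E : partial m (jet X n) x y = D m n x y).
    { destruct n as [|[|[|[|[|n]]]]]; simpl; trivial; now apply HK. }
    rewrite <- E. apply smooth_is_partial with half_plane; trivial.
    destruct n as [|[|[|[|[|n]]]]]; simpl; auto using smooth_partial. }
  assert (Dom : forall m n (I : R -> Prop) (p q : R -> R),
    In n l -> bounded_on I (fun t => inv_x (p t) (q t)) ->
    dominated I (fun t => lsum (fun j => Rabs (jet X j (p t) (q t))) l)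
      (fun t => D m n (p t) (q t))).
  { intros m n I p q Hn HB.
    assert (J : forall j, In j l -> dominated I
      (fun t => lsum (fun j => Rabs (jet X j (p t) (q t))) l)
      (fun t => jet X j (p t) (q t))).
    { intros j Hj. exists 1. split; [lra|]. intros t Ht. rewrite Rmult_1_l.
      apply (lsum_term_le (fun j => Rabs (jet X j (p t) (q t)))); trivial.
      intros; apply Rabs_pos. }
    assert (JX : forall k, dominated I
      (fun t => lsum (fun j => Rabs (jet X j (p t) (q t))) l)
      (fun t => X k (p t) (q t))).
    { intros [|]; [apply (J 0%nat)|apply (J 1%nat)]; simpl; tauto. }
    assert (JP : forall i k, dominated I
      (fun t => lsum (fun j => Rabs (jet X j (p t) (q t))) l)
      (fun t => partial i (X k) (p t) (q t))).
    { intros [|] [|]; [apply (J 2%nat)|apply (J 3%nat)|apply (J 4%nat)|apply (J 5%nat)];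
        simpl; tauto. }
    assert (JH : forall i j k, dominated I
      (fun t => lsum (fun j => Rabs (jet X j (p t) (q t))) l)
      (fun t => hessian (Gamma a b c d e f) X i j k (p t) (q t))).
    { intros i j k. unfold hessian, sum_idx.
      repeat first
        [ apply JX | apply JP
        | apply (dominated_mult I _ (fun t => inv_x (p t) (q t))); trivial
        | apply (dominated_mult I _ (fun _ => Gamma _ _ _ _ _ _ _ _ _));
            [apply bounded_const|]
        | apply dominated_plus | apply dominated_opp ]. }
    destruct n as [|[|[|[|[|n]]]]]; simpl; trivial. }
  assert (Z0 : forall n, In n l -> jet X n 1 0 = 0).
  { intros n _. destruct n as [|[|[|[|[|n]]]]]; cbv [jet]; auto. }
  assert (Z1 : forall n x, In n l -> 0 < x -> jet X n x 0 = 0).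
  { intros n x Hn Hx.
    apply (linear_ode_zero l (fun n t => jet X n t 0) (fun n t => D i1 n t 0) 1 x); trivial.
    - intros k t Hk Ht. apply (HD i1). unfold half_plane, between in *.
      assert (0 < Rmin 1 x) by (apply Rmin_glb_lt; lra). lra.
    - intros k Hk. apply (Dom i1 k (between 1 x) (fun t => t) (fun _ => 0) Hk).
      apply bounded_inv; lra. }
  intros k x y Hx. unfold half_plane in Hx.
  assert (Z2 : forall n, In n l -> jet X n x y = 0).
  { intros n Hn.
    apply (linear_ode_zero l (fun n t => jet X n x t) (fun n t => D i2 n x t) 0 y); trivial.
    - intros j t Hj Ht. now apply (HD i2).
    - intros j Hj. apply (Dom i2 j (between 0 y) (fun _ => x) (fun t => t) Hj).
      unfold inv_x. apply bounded_const.
    - intros j Hj. now apply Z1. }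
  destruct k; [apply (Z2 0%nat)|apply (Z2 1%nat)]; simpl; tauto.
Qed.

(** * Invariant tensors *)

(** The Ricci tensor times x^2: [ricci i j] is x^2 times the trace of
    Z |-> R(Z, d_j) d_i. *)
Definition ricci (a b c d e f : R) (i j : idx) : R :=
  match i, j with
  | i1, i1 => d * (1 + a - d) + b * (f - c)
  | i1, i2 => c * (d - 1) - b * e
  | i2, i1 => f + c * d - b * e
  | i2, i2 => e * (a - d - 1) + c * (f - c)
  end.

(** Action of the endomorphism e_i |-> sum_l A_i^l e_l, as a derivation, on
    covariant tensors. *)
Definition act1 (t : idx -> R) (A : idx -> idx -> R) (i : idx) : R :=
  sum_idx (fun l => t l * A i l).
Definition act2 (t : idx -> idx -> R) (A : idx -> idx -> R) (i j : idx) : R :=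
  sum_idx (fun l => t l j * A i l + t i l * A j l).
Definition act3 (t : idx -> idx -> idx -> R) (A : idx -> idx -> R) (i j k : idx) : R :=
  sum_idx (fun l => t l j k * A i l + t i l k * A j l + t i j l * A k l).

Definition delta1 (i : idx) : R := match i with i1 => 1 | i2 => 0 end.

(** Covariant derivative of the tensor with components t / x^n, multiplied by
    x^(n+1); the term in [delta1] comes from the derivative of x^-n. *)
Definition cov1 (G : idx -> idx -> idx -> R) (t : idx -> R) (m i : idx) : R :=
  - delta1 m * t i - sum_idx (fun l => G m i l * t l).
Definition cov2 (G : idx -> idx -> idx -> R) (t : idx -> idx -> R) (m i j : idx) : R :=
  - 2 * delta1 m * t i j - sum_idx (fun l => G m i l * t l j + G m j l * t i l).

Definition grad (X : vfield) (x y : R) : idx -> idx -> R :=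
  fun i k => partial i (X k) x y.

(** Lie derivative along [X] of the tensor with components t / x^n, multiplied by
    x^n. *)
Definition lie1 t X i x y := act1 t (grad X x y) i - inv_x x y * X i1 x y * t i.
Definition lie2 t X i j x y := act2 t (grad X x y) i j - 2 * (inv_x x y * X i1 x y) * t i j.
Definition lie3 t X i j k x y :=
  act3 t (grad X x y) i j k - 3 * (inv_x x y * X i1 x y) * t i j k.

(** The connection form of the area form dx dy / x^2, that is theta with
    nabla (dx dy / x^2) = theta (dx dy / x^2), multiplied by x. *)
Definition area_connection (a c d f : R) (i : idx) : R :=
  match i with i1 => - (2 + a + d) | i2 => - (c + f) end.

Section Invariants.
Variables a b c d e f : R.
Let G := Gamma a b c d e f.
Variable X : vfield.
Hypothesis HK : killing half_plane (NB a b c d e f) X.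

Lemma killing_smooth : smooth_field half_plane X.
Proof. exact (proj1 HK). Qed.

Lemma killing_hessian : forall i j k x y, half_plane x y ->
  partial i (partial j (X k)) x y = hessian G X i j k x y.
Proof. apply killing_NB_iff, HK. Qed.


(** This expresses that [L_X] commutes with the covariant derivative when [X] is a
    Killing field; so invariance passes from a tensor to its covariant derivative. *)
Lemma lie1_cov1 : forall t m i x y, half_plane x y ->
  lie2 (cov1 G t) X m i x y
  = x * partial m (lie1 t X i) x y - delta1 m * lie1 t X i x y
    - sum_idx (fun l => G m i l * lie1 t X l x y).
Proof.
  intros t m i x y Hxy. assert (SX := killing_smooth).
  assert (SI := smooth_inv_x).
  unfold lie1 at 1, act1, grad, sum_idx at 1.
  erewrite partial_eq; [|differentiate|reflexivity]. cbv beta.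
  rewrite !killing_hessian, partial_inv_x by trivial.
  assert (Hx : x <> 0) by (unfold half_plane in Hxy; lra).
  unfold lie2, lie1, act2, act1, cov1, grad, sum_idx, hessian, sum_idx, inv_x, G.
  destruct m, i; unfold delta1; cbv [Gamma]; field; trivial.
Qed.

Lemma lie2_cov2 : forall t m i j x y, half_plane x y ->
  lie3 (cov2 G t) X m i j x y
  = x * partial m (lie2 t X i j) x y - 2 * delta1 m * lie2 t X i j x y
    - sum_idx (fun l => G m i l * lie2 t X l j x y + G m j l * lie2 t X i l x y).
Proof.
  intros t m i j x y Hxy. assert (SX := killing_smooth).
  assert (SI := smooth_inv_x).
  unfold lie2 at 1, act2, grad, sum_idx at 1.
  erewrite partial_eq; [|differentiate|reflexivity]. cbv beta.
  rewrite !killing_hessian, partial_inv_x by trivial.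
  assert (Hx : x <> 0) by (unfold half_plane in Hxy; lra).
  unfold lie3, lie2, act3, act2, cov2, grad, sum_idx, hessian, sum_idx, inv_x, G.
  destruct m, i, j; unfold delta1; cbv [Gamma]; field; trivial.
Qed.

Lemma lie1_cov1_zero : forall t,
  (forall i x y, half_plane x y -> lie1 t X i x y = 0) ->
  forall m i x y, half_plane x y -> lie2 (cov1 G t) X m i x y = 0.
Proof.
  intros t H m i x y Hxy. rewrite lie1_cov1 by trivial.
  rewrite (partial_ext_on half_plane m _ (fun _ _ => 0)), partial_const;
    auto using open_half_plane.
  unfold sum_idx. rewrite !H by trivial. ring.
Qed.

Lemma lie2_cov2_zero : forall t,
  (forall i j x y, half_plane x y -> lie2 t X i j x y = 0) ->
  forall m i j x y, half_plane x y -> lie3 (cov2 G t) X m i j x y = 0.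
Proof.
  intros t H m i j x y Hxy. rewrite lie2_cov2 by trivial.
  rewrite (partial_ext_on half_plane m _ (fun _ _ => 0)), partial_const;
    auto using open_half_plane.
  unfold sum_idx. rewrite !H by trivial. ring.
Qed.

Lemma partial_hessian : forall m i j k x y, half_plane x y ->
  partial m (hessian G X i j k) x y =
  partial m inv_x x y * (inv_x x y * (G i j k * X i1 x y)
    + sum_idx (fun l => G i j l * partial l (X k) x y
        - G l j k * partial i (X l) x y - G i l k * partial j (X l) x y))
  + inv_x x y * (partial m inv_x x y * (G i j k * X i1 x y)
    + inv_x x y * (G i j k * partial m (X i1) x y)
    + sum_idx (fun l => G i j l * hessian G X m l k x y
        - G l j k * hessian G X m i l x y - G i l k * hessian G X m j l x y)).
Proof.
  intros m i j k x y Hxy. assert (SX := killing_smooth).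
  assert (SI := smooth_inv_x). unfold hessian at 1, sum_idx.
  erewrite partial_eq; [|differentiate|reflexivity]. cbv beta.
  rewrite !killing_hessian by trivial. ring.
Qed.

(** The third derivatives of [X] can be computed from the Killing equation in two
    ways; the difference is the Lie derivative of the curvature, which in dimension 2
    is that of the Ricci tensor. *)
Lemma lie2_ricci_zero : forall i j x y, half_plane x y ->
  lie2 (ricci a b c d e f) X i j x y = 0.
Proof.
  intros i j x y Hxy. assert (SX := killing_smooth).
  assert (E : forall k, partial i2 (hessian G X i1 i k) x y
                      = partial i1 (hessian G X i2 i k) x y).
  { intros k.
    rewrite <- (fun m => partial_ext_on half_plane m _ _ x y open_half_plane Hxy
      (fun u v Huv => killing_hessian i1 i k u v Huv)).
    rewrite <- (fun m => partial_ext_on half_plane m _ _ x y open_half_plane Hxy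
      (fun u v Huv => killing_hessian i2 i k u v Huv)).
    apply smooth_Schwarz with half_plane; auto using open_half_plane, smooth_partial. }
  assert (Hx : x <> 0) by (unfold half_plane in Hxy; lra).
  assert (R : lie2 (ricci a b c d e f) X i j x y
    = x * x * match j with
      | i1 => partial i1 (hessian G X i2 i i2) x y - partial i2 (hessian G X i1 i i2) x y
      | i2 => partial i2 (hessian G X i1 i i1) x y - partial i1 (hessian G X i2 i i1) x y
      end).
  { rewrite !partial_hessian, !partial_inv_x by trivial.
    unfold lie2, act2, grad, hessian, sum_idx, inv_x, ricci, G.
    destruct i, j; cbv [Gamma]; field; trivial. }
  rewrite R. destruct j; rewrite E; ring.
Qed.

(** If c + f is not zero, the alternating part of the Ricci tensor is an invariant
    area form. A Killing field preserves it, and then also its connection form. *)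
Lemma lie1_area_connection_zero : c + f <> 0 ->
  (forall x y, half_plane x y ->
     partial i1 (X i1) x y + partial i2 (X i2) x y - 2 * (inv_x x y * X i1 x y) = 0) /\
  forall i x y, half_plane x y -> lie1 (area_connection a c d f) X i x y = 0.
Proof.
  intros Hr. assert (SX := killing_smooth). assert (SI := smooth_inv_x).
  assert (T : forall x y, half_plane x y ->
     partial i1 (X i1) x y + partial i2 (X i2) x y - 2 * (inv_x x y * X i1 x y) = 0).
  { intros x y Hxy.
    assert (H1 := lie2_ricci_zero i1 i2 x y Hxy).
    assert (H2 := lie2_ricci_zero i2 i1 x y Hxy).
    unfold lie2, act2, grad, sum_idx, ricci in H1, H2.
    apply Rmult_eq_reg_l with (c + f); [|trivial]. lra. }
  split; trivial. intros i x y Hxy.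
  assert (E : partial i (fun x y => partial i1 (X i1) x y + partial i2 (X i2) x y
                - 2 * (inv_x x y * X i1 x y)) x y = 0).
  { rewrite (partial_ext_on half_plane i _ (fun _ _ => 0)), partial_const;
    auto using open_half_plane. }
  assert (Hx : x <> 0) by (unfold half_plane in Hxy; lra).
  erewrite partial_eq in E; [|differentiate|reflexivity]. cbv beta in E.
  rewrite !killing_hessian, partial_inv_x in E by trivial.
  transitivity (x * 0); [|ring]. rewrite <- E.
  unfold lie1, act1, grad, hessian, sum_idx, inv_x, area_connection, G.
  destruct i; cbv [Gamma]; field; trivial.
Qed.
End Invariants.

(** * The isotropy algebra *)

(** The linear conditions on the first derivatives of a Killing field that vanishes
    at (1,0). The third group is the invariance of the alternating part of
    the Ricci tensor, of its connection form theta and of nabla theta. *)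
Definition isotropy (a b c d e f : R) (A : idx -> idx -> R) : Prop :=
  (forall i j, act2 (ricci a b c d e f) A i j = 0) /\
  (forall m i j, act3 (cov2 (Gamma a b c d e f) (ricci a b c d e f)) A m i j = 0) /\
  (c + f <> 0 ->
     A i1 i1 + A i2 i2 = 0 /\
     (forall i, act1 (area_connection a c d f) A i = 0) /\
     (forall m i, act2 (cov1 (Gamma a b c d e f) (area_connection a c d f)) A m i = 0)).

Lemma killing_isotropy : forall a b c d e f X,
  killing half_plane (NB a b c d e f) X -> (forall k, X k 1 0 = 0) ->
  isotropy a b c d e f (grad X 1 0).
Proof.
  intros a b c d e f X HK HX.
  assert (P : half_plane 1 0) by (unfold half_plane; lra).
  split; [|split].
  - intros i j. assert (H := lie2_ricci_zero a b c d e f X HK i j 1 0 P).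
    unfold lie2 in H. rewrite HX in H. lra.
  - intros m i j.
    assert (H := lie2_cov2_zero a b c d e f X HK _
      (lie2_ricci_zero a b c d e f X HK) m i j 1 0 P).
    unfold lie3 in H. rewrite HX in H. lra.
  - intros Hr. destruct (lie1_area_connection_zero a b c d e f X HK Hr) as [T H1].
    split; [|split].
    + specialize (T 1 0 P). rewrite HX in T. unfold grad. lra.
    + intros i. specialize (H1 i 1 0 P). unfold lie1 in H1. rewrite HX in H1. lra.
    + intros m i.
      assert (H := lie1_cov1_zero a b c d e f X HK _ H1 m i 1 0 P).
      unfold lie2 in H. rewrite HX in H. lra.
Qed.

Definition entry (A : idx -> idx -> R) (n : nat) : R :=
  match n with
  | 2 => A i1 i1 | 3 => A i1 i2 | 4 => A i2 i1 | _ => A i2 i2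
  end%nat.

(** A Killing field is determined by its 1-jet at (1,0), and [s] lists components of
    the jet that determine the others once the isotropy conditions are taken into
    account; the values at (1,0) always come first. *)
Lemma killing_basis_of_jets : forall a b c d e f n (s : nat -> nat) (V : nat -> vfield),
  s 1%nat = 0%nat -> s 2%nat = 1%nat -> (2 <= n)%nat ->
  (forall i, (3 <= i <= n)%nat -> (2 <= s i)%nat) ->
  (forall i, (1 <= i <= n)%nat -> killing half_plane (NB a b c d e f) (V i)) ->
  (forall t, (forall j, (1 <= j <= n)%nat ->
      sum_n_m (fun i => t i * jet (V i) (s j) 1 0) 1 n = 0) ->
    forall i, (1 <= i <= n)%nat -> t i = 0) ->
  (forall A, isotropy a b c d e f A ->
     (forall j, (3 <= j <= n)%nat -> entry A (s j) = 0) -> forall i k, A i k = 0) ->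
  killing_basis half_plane (NB a b c d e f) n V.
Proof.
  intros a b c d e f n s V S1 S2 Hn Hs HV Hind Hiso.
  assert (P : half_plane 1 0) by (unfold half_plane; lra).
  assert (L : forall j, linear_functional half_plane (fun X => jet X (s j) 1 0)).
  { intros j. destruct (s j) as [|[|[|[|[|n']]]]]; cbv [jet];
      auto using linear_functional_eval, linear_functional_partial, open_half_plane. }
  apply killing_basis_intro with (fun j X => jet X (s j) 1 0);
    auto using open_half_plane, smooth_NB.
  - intros t Ht. apply Hind. intros j Hj.
    destruct (linear_functional_lincomb half_plane _ n t V open_half_plane (L j))
      as [_ <-].
    + intros i Hi. apply HV, Hi.
    + rewrite (proj1 (L j) _ zero_field Ht).
      exact (linear_functional_zero half_plane _ open_half_plane (L j)).
  - intros X HK HX.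
    assert (X0 : forall k, X k 1 0 = 0).
    { intros [|]; [specialize (HX 1%nat ltac:(lia)); rewrite S1 in HX
                  |specialize (HX 2%nat ltac:(lia)); rewrite S2 in HX]; exact HX. }
    apply (killing_zero_of_jet a b c d e f X HK X0).
    apply (Hiso (grad X 1 0)).
    + now apply killing_isotropy.
    + intros j Hj. specialize (HX j ltac:(lia)). specialize (Hs j Hj).
      destruct (s j) as [|[|[|[|[|n']]]]]; cbv [jet entry grad] in *; trivial; lia.
Qed.

(** * Explicit Killing fields *)

(** A function together with its first and second partial derivatives; explicit
    vector fields are written with these so that the Killing equation becomes an
    algebraic identity. *)
Record germ := Germ {
  val : R -> R -> R;
  fst_der : idx -> R -> R -> R;
  snd_der : idx -> idx -> R -> R -> R }.

Definition valid (g : germ) : Prop :=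
  smooth_on half_plane (val g) /\
  (forall i x y, half_plane x y -> is_partial i (val g) x y (fst_der g i x y)) /\
  (forall i j x y, half_plane x y ->
     is_partial i (fst_der g j) x y (snd_der g i j x y)).

Definition gconst (c : R) : germ :=
  Germ (fun _ _ => c) (fun _ _ _ => 0) (fun _ _ _ _ => 0).
Definition gx : germ :=
  Germ (fun x _ => x) (fun i _ _ => match i with i1 => 1 | i2 => 0 end)
       (fun _ _ _ _ => 0).
Definition gy : germ :=
  Germ (fun _ y => y) (fun i _ _ => match i with i1 => 0 | i2 => 1 end)
       (fun _ _ _ _ => 0).
Definition gadd (g h : germ) : germ :=
  Germ (fun x y => val g x y + val h x y)
       (fun i x y => fst_der g i x y + fst_der h i x y)
       (fun i j x y => snd_der g i j x y + snd_der h i j x y).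
Definition gmul (g h : germ) : germ :=
  Germ (fun x y => val g x y * val h x y)
       (fun i x y => fst_der g i x y * val h x y + val g x y * fst_der h i x y)
       (fun i j x y => snd_der g i j x y * val h x y + fst_der g j x y * fst_der h i x y
          + (fst_der g i x y * fst_der h j x y + val g x y * snd_der h i j x y)).
Definition of_x (f f' f'' : R -> R) : germ :=
  Germ (fun x _ => f x) (fun i x _ => match i with i1 => f' x | i2 => 0 end)
       (fun i j x _ => match i, j with i1, i1 => f'' x | _, _ => 0 end).
Definition gpow (s : R) : germ :=
  of_x (fun x => Rpower x s) (fun x => s * (Rpower x s * / x))
       (fun x => s * (s - 1) * (Rpower x s * / x * / x)).
Definition gln : germ := of_x ln (fun x => / x) (fun x => - / x * / x).
(** [H] is meant to be a primitive of x^s, which is a power or a logarithm according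
    to [s]; only its derivatives enter the Killing equation. *)
Definition gprim (H : R -> R) (s : R) : germ :=
  of_x H (fun x => Rpower x s) (fun x => s * (Rpower x s * / x)).

Lemma valid_const : forall c, valid (gconst c).
Proof.
  intros c. split; [|split]; simpl.
  - apply smooth_const, open_half_plane.
  - intros; apply is_partial_const.
  - intros; apply is_partial_const.
Qed.

Lemma valid_gx : valid gx.
Proof.
  split; [|split]; simpl.
  - apply smooth_fst, open_half_plane.
  - intros [|] x y _; [apply (is_derive_id x)|apply (is_derive_const x)].
  - intros; apply is_partial_const.
Qed.

Lemma valid_gy : valid gy.
Proof.
  split; [|split]; simpl.
  - apply smooth_snd, open_half_plane.
  - intros [|] x y _; [apply (is_derive_const y)|apply (is_derive_id y)].
  - intros; apply is_partial_const.
Qed.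

Lemma valid_gadd : forall g h, valid g -> valid h -> valid (gadd g h).
Proof.
  intros g h (Sg & Pg & Qg) (Sh & Ph & Qh). split; [|split]; simpl.
  - now apply smooth_plus; [apply open_half_plane| |].
  - intros. apply is_partial_plus; auto.
  - intros. apply is_partial_plus; auto.
Qed.

Lemma valid_gmul : forall g h, valid g -> valid h -> valid (gmul g h).
Proof.
  intros g h (Sg & Pg & Qg) (Sh & Ph & Qh). split; [|split]; simpl.
  - now apply smooth_mult; [apply open_half_plane| |].
  - intros. apply is_partial_mult; auto.
  - intros. apply is_partial_plus; apply is_partial_mult; auto.
Qed.

Lemma valid_of_x : forall f f' f'',
  (forall x, 0 < x -> is_derive f x (f' x)) ->
  (forall x, 0 < x -> is_derive f' x (f'' x)) ->
  smooth_on half_plane (fun x _ => f' x) -> valid (of_x f f' f'').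
Proof.
  intros f f' f'' H1 H2 S. split; [|split]; simpl.
  - now apply smooth_of_x with f'.
  - intros [|] x y Hx; [now apply H1|apply (is_derive_const (f x))].
  - intros [|] [|] x y Hx; simpl; try apply (is_derive_const 0).
    + now apply H2.
    + apply (is_derive_const (f' x)).
Qed.

Lemma Rpower_pred : forall s x, 0 < x -> Rpower x (s - 1) = Rpower x s * / x.
Proof.
  intros s x Hx. unfold Rminus. rewrite Rpower_plus. f_equal. now apply Rpower_m1.
Qed.

Lemma smooth_Rpower_div : forall s t, smooth_on half_plane (fun x _ => t * (Rpower x s * / x)).
Proof.
  intros s t. apply smooth_mult; auto using open_half_plane, smooth_const.
  apply (smooth_mult half_plane (fun x _ => Rpower x s) inv_x);
    auto using open_half_plane, smooth_Rpower, smooth_inv_x.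
Qed.

Lemma valid_gpow : forall s, valid (gpow s).
Proof.
  intros s. assert (D : forall s x, 0 < x -> is_derive (fun x => Rpower x s) x (s * (Rpower x s * / x))).
  { intros t x Hx. rewrite <- Rpower_pred by trivial. now apply is_derive_Rpower. }
  apply valid_of_x; auto using smooth_Rpower_div.
  intros x Hx. apply (is_derive_ext_loc (fun x => s * Rpower x (s - 1))).
  - exists (mkposreal x Hx). simpl. intros y Hy. apply Rabs_def2 in Hy.
    unfold minus, plus, opp in Hy; simpl in Hy. rewrite Rpower_pred by lra. reflexivity.
  - replace (s * (s - 1) * (Rpower x s * / x * / x))
      with (s * ((s - 1) * (Rpower x (s - 1) * / x)))
      by (rewrite Rpower_pred by trivial; ring).
    now apply (is_derive_scal (fun x => Rpower x (s - 1))), D.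
Qed.

Lemma valid_gln : valid gln.
Proof.
  apply valid_of_x.
  - intros x Hx. now apply is_derive_ln.
  - intros x Hx. auto_derive; [lra|field; lra].
  - apply smooth_inv_x.
Qed.

Lemma valid_gprim : forall H s,
  (forall x, 0 < x -> is_derive H x (Rpower x s)) -> valid (gprim H s).
Proof.
  intros H s HH. apply valid_of_x; auto using smooth_Rpower.
  intros x Hx. rewrite <- Rpower_pred by trivial. now apply is_derive_Rpower.
Qed.

(** Normalised at 1 because jets are taken at (1,0). *)
Lemma power_primitive : forall s, exists H, H 1 = 0 /\
  forall x, 0 < x -> is_derive H x (Rpower x s).
Proof.
  intros s. destruct (Req_dec s (-1)) as [->|Hs].
  - exists ln. split; [apply ln_1|]. intros x Hx. rewrite Rpower_m1 by trivial.
    now apply is_derive_ln.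
  - exists (fun x => / (s + 1) * (Rpower x (s + 1) - 1)). split.
    + unfold Rpower. rewrite ln_1, Rmult_0_r, exp_0. ring.
    + intros x Hx.
      replace (Rpower x s) with (/ (s + 1) * ((s + 1) * Rpower x (s + 1 - 1) - 0)).
      * apply (is_derive_scal (fun x => Rpower x (s + 1) - 1)).
        apply (is_derive_minus (fun x => Rpower x (s + 1)) (fun _ => 1)).
        -- now apply is_derive_Rpower.
        -- apply (is_derive_const 1).
      * replace (s + 1 - 1) with s by ring. field. lra.
Qed.

Definition gfield (g : idx -> germ) : vfield := fun k => val (g k).

Lemma killing_gfield : forall a b c d e f g,
  (forall k, valid (g k)) ->
  (forall i j k x y, 0 < x ->
     snd_der (g k) i j x y = / x * (/ x * (Gamma a b c d e f i j k * val (g i1) x y)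
       + sum_idx (fun l => Gamma a b c d e f i j l * fst_der (g k) l x y
           - Gamma a b c d e f l j k * fst_der (g l) i x y
           - Gamma a b c d e f i l k * fst_der (g l) j x y))) ->
  killing half_plane (NB a b c d e f) (gfield g).
Proof.
  intros a b c d e f g Hg H. apply killing_NB_iff. split; [intros k; apply Hg|].
  assert (P : forall i k u v, half_plane u v ->
    partial i (gfield g k) u v = fst_der (g k) i u v)
    by (intros; now apply is_partial_unique, Hg).
  intros i j k x y Hxy.
  rewrite (partial_ext_on half_plane i _ (fst_der (g k) j) x y open_half_plane Hxy
    (fun u v Huv => P j k u v Huv)).
  unfold hessian, sum_idx. rewrite !P by trivial.
  unfold inv_x, gfield. unfold sum_idx in H. rewrite <- H by trivial.
  now apply is_partial_unique, Hg.
Qed.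

Definition gjet (g : idx -> germ) (n : nat) : R :=
  match n with
  | 0 => val (g i1) 1 0 | 1 => val (g i2) 1 0
  | 2 => fst_der (g i1) i1 1 0 | 3 => fst_der (g i2) i1 1 0
  | 4 => fst_der (g i1) i2 1 0 | _ => fst_der (g i2) i2 1 0
  end%nat.

Lemma jet_gfield : forall g n, (forall k, valid (g k)) -> jet (gfield g) n 1 0 = gjet g n.
Proof.
  intros g n Hg. assert (P : half_plane 1 0) by (unfold half_plane; lra).
  destruct n as [|[|[|[|[|n]]]]]; cbv [jet gjet]; trivial;
    now apply is_partial_unique, Hg.
Qed.

Definition gpair (g h : germ) : idx -> germ :=
  fun k => match k with i1 => g | i2 => h end.

Ltac valid :=
  repeat first [apply valid_gadd | apply valid_gmul | apply valid_const
    | apply valid_gx | apply valid_gy | apply valid_gpow | apply valid_gln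
    | apply valid_gprim; assumption].

Ltac killing_equation :=
  apply killing_gfield;
  [intros [|]; cbv [gpair]; valid
  |intros [|] [|] [|] x y Hx;
   cbv [gpair gconst gx gy gadd gmul of_x gpow gln gprim val fst_der snd_der sum_idx Gamma]].

Definition translation : vfield := gfield (gpair (gconst 0) (gconst 1)).
Definition dilation : vfield := gfield (gpair gx gy).

Lemma killing_translation : forall a b c d e f,
  killing half_plane (NB a b c d e f) translation.
Proof. intros. unfold translation. killing_equation; field; lra. Qed.

Lemma killing_dilation : forall a b c d e f,
  killing half_plane (NB a b c d e f) dilation.
Proof. intros. unfold dilation. killing_equation; field; lra. Qed.

Lemma sum_1_S : forall (F : nat -> R) n, sum_n_m F 1 (S n) = sum_n_m F 1 n + F (S n).
Proof. intros F n. apply (@sum_n_Sm R_AbelianMonoid). lia. Qed.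

Lemma sum_1_0 : forall F : nat -> R, sum_n_m F 1 0 = 0.
Proof. intros F. apply (@sum_n_m_zero R_AbelianMonoid). lia. Qed.

Lemma Rpower_one : forall s, Rpower 1 s = 1.
Proof. intros s. unfold Rpower. rewrite ln_1, Rmult_0_r. apply exp_0. Qed.

(** Indices start at 1, as in [lincomb]. *)
Definition nth_field (l : list (idx -> germ)) (i : nat) : vfield :=
  gfield (nth (pred i) l (gpair (gconst 0) (gconst 0))).

Lemma killing_basis_of_germs : forall a b c d e f (s : list nat) (l : list (idx -> germ)),
  length l = length s -> (2 <= length s)%nat ->
  nth 0 s 0%nat = 0%nat -> nth 1 s 0%nat = 1%nat ->
  (forall i, (2 <= i < length s)%nat -> (2 <= nth i s 0)%nat) ->
  (forall g, In g l -> (forall k, valid (g k)) /\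
     killing half_plane (NB a b c d e f) (gfield g)) ->
  (forall t : nat -> R, (forall j, In j s ->
      sum_n_m (fun i => t i * gjet (nth (pred i) l (gpair (gconst 0) (gconst 0))) j)
        1 (length l) = 0) ->
    forall i, (1 <= i <= length l)%nat -> t i = 0) ->
  (forall A, isotropy a b c d e f A ->
     (forall j, In j s -> (2 <= j)%nat -> entry A j = 0) -> forall i k, A i k = 0) ->
  killing_basis half_plane (NB a b c d e f) (length l) (nth_field l).
Proof.
  intros a b c d e f s l Hl H2 S1 S2 Hs HK Hind Hiso.
  assert (Hnth : forall i, (1 <= i <= length l)%nat ->
    In (nth (pred i) l (gpair (gconst 0) (gconst 0))) l)
    by (intros; apply nth_In; lia).
  assert (Hsn : forall j, (1 <= j <= length l)%nat -> In (nth (pred j) s 0%nat) s)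
    by (intros; apply nth_In; lia).
  apply killing_basis_of_jets with (fun j => nth (pred j) s 0%nat); trivial.
  - lia.
  - intros i Hi. apply Hs. lia.
  - intros i Hi. apply HK, Hnth, Hi.
  - intros t Ht. apply Hind. intros j Hj.
    destruct (In_nth s j 0%nat Hj) as (m & Hm & <-).
    refine (eq_trans _ (Ht (S m) ltac:(lia))).
    apply sum_n_m_ext_loc. intros i Hi. cbv beta.
    unfold nth_field. rewrite jet_gfield; trivial. apply HK, Hnth, Hi.
  - intros A HA HE. apply Hiso; trivial. intros j Hj Hj2.
    destruct (In_nth s j 0%nat Hj) as (m & Hm & <-).
    apply (HE (S m)). destruct m as [|[|m]]; simpl in *; lia.
Qed.

Ltac jets H j := let E := fresh "E" in
  assert (E := H j ltac:(simpl; tauto)); cbn [length] in E;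
  rewrite !sum_1_S, sum_1_0 in E;
  cbv [nth pred gjet gpair gconst gx gy gadd gmul of_x gpow gln gprim val fst_der] in E;
  rewrite ?Rpower_one, ?ln_1, ?Rinv_1 in E.

Ltac solve_independent :=
  let i := fresh "i" in let Hi := fresh "Hi" in
  intros i Hi; cbn [length] in Hi;
  assert (i = 1 \/ i = 2 \/ i = 3 \/ i = 4 \/ i = 5 \/ i = 6)%nat as HI by lia;
  repeat (destruct HI as [->|HI]; [try lia; try nra|]); subst; try lia; try nra.

Lemma killing_basis_2 : forall a b c d e f,
  (forall A, isotropy a b c d e f A -> forall i k, A i k = 0) ->
  killing_basis half_plane (NB a b c d e f) 2
    (nth_field (gpair gx gy :: gpair (gconst 0) (gconst 1) :: nil)).
Proof.
  intros a b c d e f HA.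
  apply (killing_basis_of_germs a b c d e f (0 :: 1 :: nil)%nat
    (gpair gx gy :: gpair (gconst 0) (gconst 1) :: nil)); simpl; auto.
  - intros; lia.
  - intros g [<-|[<-|[]]]; (split; [intros [|]; simpl; valid|]).
    + apply killing_dilation.
    + apply killing_translation.
  - intros t H. jets H 0%nat. jets H 1%nat. solve_independent.
Qed.

(** With the translation T and the dilation E it spans a copy of sl(2,R):
    [T,Q] = 2 E and [E,Q] = Q for every value of [q]. *)
Definition gsquare (q : R) : idx -> germ :=
  gpair (gmul (gmul (gconst 2) gx) gy)
        (gadd (gmul gy gy) (gmul (gconst q) (gmul gx gx))).

Lemma killing_basis_3 : forall a b c d e f q,
  killing half_plane (NB a b c d e f) (gfield (gsquare q)) ->
  (forall A, isotropy a b c d e f A -> A i2 i1 = 0 -> forall i k, A i k = 0) ->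
  killing_basis half_plane (NB a b c d e f) 3
    (nth_field (gpair gx gy :: gpair (gconst 0) (gconst 1) :: gsquare q :: nil)).
Proof.
  intros a b c d e f q HQ HA.
  apply (killing_basis_of_germs a b c d e f (0 :: 1 :: 4 :: nil)%nat
    (gpair gx gy :: gpair (gconst 0) (gconst 1) :: gsquare q :: nil)); simpl; auto.
  - intros i Hi. replace i with 2%nat by lia. simpl. lia.
  - intros g [<-|[<-|[<-|[]]]]; (split; [intros [|]; simpl; valid|]); trivial.
    + apply killing_dilation.
    + apply killing_translation.
  - intros t H. unfold gsquare in H. jets H 0%nat. jets H 1%nat. jets H 4%nat.
    solve_independent.
  - intros A HI HE. apply HA; trivial. apply (HE 4%nat); auto.
Qed.

(** With w = y + b x ln x and u = ln x the symbols are constant, and the Killing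
    fields are spanned by E and the vertical fields d/dy, w d/dy and H(x) d/dy with
    H' = x^(a - 2d). *)
Lemma killing_dim_4 : forall a b d, b * (a - 2 * d) = 0 ->
  ricci a b 0 d 0 0 i1 i1 <> 0 ->
  killing_dim half_plane (NB a b 0 d 0 0) 4.
Proof.
  intros a b d Hb Hr.
  destruct (power_primitive (a - 2 * d)) as (P & P1 & HP).
  pose (w := gadd gy (gmul (gconst b) (gmul gx gln))).
  eexists. apply (killing_basis_of_germs a b 0 d 0 0 (0 :: 1 :: 3 :: 5 :: nil)%nat
    (gpair gx gy :: gpair (gconst 0) (gconst 1)
     :: gpair (gconst 0) (gprim P (a - 2 * d)) :: gpair (gconst 0) w :: nil)); simpl; auto.
  - intros i Hi. assert (i = 2 \/ i = 3)%nat as [->| ->] by lia; simpl; lia.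
  - intros g [<-|[<-|[<-|[<-|[]]]]];
      (split; [intros [|]; cbv [gpair w]; valid|]).
    + apply killing_dilation.
    + apply killing_translation.
    + killing_equation; field; lra.
    + unfold w. killing_equation; try (field; lra).
      assert (HE : b * a = b * (2 * d)) by lra.
      transitivity (b * / x + (ln x + 1) * (b * a - b * (2 * d)) * / x);
        [rewrite HE; field; lra|field; lra].
  - intros t H. unfold w in H. jets H 0%nat. jets H 1%nat. jets H 3%nat. jets H 5%nat.
    rewrite P1 in *. solve_independent.
  - intros A (HI & _ & _) HE. cbv [ricci] in Hr.
    assert (E1 := HE 3%nat ltac:(auto) ltac:(auto)).
    assert (E2 := HE 5%nat ltac:(auto) ltac:(auto)). simpl in E1, E2.
    assert (H11 := HI i1 i1). assert (H12 := HI i1 i2).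
    cbv [act2 sum_idx ricci] in H11, H12.
    assert (A11 : A i1 i1 = 0).
    { apply Rmult_eq_reg_l with (d * (1 + a - d)); [nra|]. intros Z; apply Hr; lra. }
    assert (A21 : A i2 i1 = 0).
    { apply Rmult_eq_reg_l with (d * (1 + a - d)); [nra|]. intros Z; apply Hr; lra. }
    intros [|] [|]; trivial.
Qed.

Lemma killing_dim_6_intro : forall a b c d e f (l : list (idx -> germ)),
  length l = 6%nat ->
  (forall g, In g l -> (forall k, valid (g k)) /\
     killing half_plane (NB a b c d e f) (gfield g)) ->
  (forall t : nat -> R, (forall j, In j (0 :: 1 :: 2 :: 3 :: 4 :: 5 :: nil)%nat ->
      sum_n_m (fun i => t i * gjet (nth (pred i) l (gpair (gconst 0) (gconst 0))) j)
        1 (length l) = 0) ->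
    forall i, (1 <= i <= length l)%nat -> t i = 0) ->
  killing_dim half_plane (NB a b c d e f) 6.
Proof.
  intros a b c d e f l Hl HK Hind. rewrite <- Hl.
  eexists. apply (killing_basis_of_germs a b c d e f (0 :: 1 :: 2 :: 3 :: 4 :: 5 :: nil)%nat l);
    try (simpl; lia); trivial.
  - intros i Hi. simpl in Hi.
    assert (i = 2 \/ i = 3 \/ i = 4 \/ i = 5)%nat as [->|[->|[->| ->]]] by lia;
      simpl; lia.
  - intros A _ HE [|] [|]; [apply (HE 2%nat)|apply (HE 3%nat)|apply (HE 4%nat)
      |apply (HE 5%nat)]; simpl; auto 10.
Qed.

Lemma Rpower_opp_field : forall s x, Rpower x (- s) = / Rpower x s /\ Rpower x s <> 0.
Proof.
  intros s x. split; [apply Rpower_Ropp|]. apply Rgt_not_eq, exp_pos.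
Qed.

Ltac six_cases HI :=
  simpl in HI;
  repeat (destruct HI as [<-|HI];
    [split; [intros [|]; cbv [gpair]; valid|killing_equation]|]); [..|contradiction].

(** In each flat case below the basis consists of the products of 1, phi1, phi2 with
    Y1, Y2, where d phi1 and d phi2 are parallel and Y1, Y2 are parallel fields, up
    to linear combinations. Here phi1 = H with H' = x^a and phi2 = y, while
    Y1 = x^-a d/dx and Y2 = d/dy. *)
Lemma killing_dim_6_d0 : forall a, killing_dim half_plane (NB a 0 0 0 0 0) 6.
Proof.
  intros a. destruct (power_primitive a) as (P & P1 & HP).
  apply killing_dim_6_intro with
    (gpair (gconst 0) (gconst 1) :: gpair (gconst 0) gy
     :: gpair (gconst 0) (gprim P a)
     :: gpair (gpow (- a)) (gconst 0) :: gpair (gmul (gpow (- a)) gy) (gconst 0)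
     :: gpair (gmul (gpow (- a)) (gprim P a)) (gconst 0) :: nil); trivial.
  - intros g HI. six_cases HI;
      destruct (Rpower_opp_field a x) as [E N]; try rewrite E; field; lra.
  - intros t H. jets H 0%nat. jets H 1%nat. jets H 2%nat. jets H 3%nat. jets H 4%nat.
    jets H 5%nat. rewrite P1 in *. solve_independent.
Qed.

(** phi1 = x, phi2 = w = y + x ln x, Y1 = d/dx - (ln x + 1) d/dy, Y2 = d/dy. *)
Lemma killing_dim_6_log : killing_dim half_plane (NB 0 1 0 0 0 0) 6.
Proof.
  pose (w := gadd gy (gmul gx gln)).
  pose (m := gadd (gmul (gconst (-1)) gln) (gconst (-1))).
  apply killing_dim_6_intro with
    (gpair (gconst 0) (gconst 1) :: gpair (gconst 0) gx :: gpair (gconst 0) w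
     :: gpair (gconst 1) m :: gpair gx (gmul gx m) :: gpair w (gmul w m) :: nil); trivial.
  - unfold w, m. intros g HI. six_cases HI; field; lra.
  - unfold w, m. intros t H. jets H 0%nat. jets H 1%nat. jets H 2%nat. jets H 3%nat.
    jets H 4%nat. jets H 5%nat. solve_independent.
Qed.

(** phi1 = x^d, phi2 = y x^d, Y1 = x^-d (x d/dx - d y d/dy), Y2 = x^-d d/dy; the
    combinations phi1 Y1 + d phi2 Y2 = x d/dx and phi2 Y2 = y d/dy are used. *)
Lemma killing_dim_6_power : forall d, d <> 0 ->
  killing_dim half_plane (NB (d - 1) 0 0 d 0 0) 6.
Proof.
  intros d Hd. pose (m := gmul (gconst (- d)) gy).
  apply killing_dim_6_intro with
    (gpair (gconst 0) (gpow (- d)) :: gpair (gconst 0) (gconst 1) :: gpair (gconst 0) gy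
     :: gpair gx (gconst 0) :: gpair (gmul (gpow (- d)) gx) (gmul (gpow (- d)) m)
     :: gpair (gmul gy gx) (gmul gy m) :: nil); trivial.
  - unfold m. intros g HI. six_cases HI; field; lra.
  - unfold m. intros t H. jets H 0%nat. jets H 1%nat. jets H 2%nat. jets H 3%nat.
    jets H 4%nat. jets H 5%nat.
    assert (T1 : t 1%nat = 0) by (apply Rmult_eq_reg_l with d; lra).
    assert (T5 : t 5%nat = 0) by (apply Rmult_eq_reg_l with d; lra).
    rewrite T1, T5 in *. solve_independent.
Qed.

(** phi1 = 1/x, phi2 = w/x with w = y + x ln x, Y1 = x (- x d/dx + (x - y) d/dy),
    Y2 = x d/dy. *)
Lemma killing_dim_6_power_log : killing_dim half_plane (NB (-2) 1 0 (-1) 0 0) 6.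
Proof.
  pose (w := gadd gy (gmul gx gln)).
  pose (m := gadd gx (gmul (gconst (-1)) gy)).
  pose (n := gmul (gconst (-1)) gx).
  apply killing_dim_6_intro with
    (gpair (gconst 0) (gconst 1) :: gpair (gconst 0) gx :: gpair (gconst 0) w
     :: gpair n m :: gpair (gmul gx n) (gmul gx m) :: gpair (gmul w n) (gmul w m) :: nil);
    trivial.
  - unfold w, m, n. intros g HI. six_cases HI; field; lra.
  - unfold w, m, n. intros t H. jets H 0%nat. jets H 1%nat. jets H 2%nat. jets H 3%nat.
    jets H 4%nat. jets H 5%nat. solve_independent.
Qed.

(** phi1 = y, phi2 = x^2 + s y^2, Y1 = x^-1 d/dx, Y2 = d/dy - (s y / x) d/dx. *)
Lemma killing_dim_6_quadratic : forall s, is_sign s ->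
  killing_dim half_plane (NB 1 0 0 0 s 0) 6.
Proof.
  intros s Hs.
  pose (r := gpow (-1)).
  pose (w := gadd (gmul gx gx) (gmul (gconst s) (gmul gy gy))).
  pose (m := gmul (gconst (- s)) (gmul gy r)).
  apply killing_dim_6_intro with
    (gpair r (gconst 0) :: gpair (gmul gy r) (gconst 0) :: gpair (gmul w r) (gconst 0)
     :: gpair m (gconst 1) :: gpair (gmul gy m) gy :: gpair (gmul w m) w :: nil);
    trivial.
  - unfold w, m, r. intros g HI. six_cases HI; rewrite Rpower_m1 by trivial; field; lra.
  - unfold w, m, r. intros t H. jets H 0%nat. jets H 1%nat. jets H 2%nat. jets H 3%nat.
    jets H 4%nat. jets H 5%nat. destruct Hs as [-> | ->]; solve_independent.
Qed.

(** * Structures without commuting Killing fields *)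

Definition gcomb (al be ga q : R) : idx -> germ := fun k =>
  gadd (gadd (gmul (gconst al) (gpair gx gy k))
             (gmul (gconst be) (gpair (gconst 0) (gconst 1) k)))
       (gmul (gconst ga) (gsquare q k)).

Lemma valid_gcomb : forall al be ga q k, valid (gcomb al be ga q k).
Proof. intros al be ga q [|]; cbv [gcomb gpair gsquare]; valid. Qed.

Lemma bracket_gfield : forall X Y g h k x y,
  (forall k, valid (g k)) -> (forall k, valid (h k)) ->
  eq_field half_plane X (gfield g) -> eq_field half_plane Y (gfield h) -> 0 < x ->
  bracket X Y k x y = sum_idx (fun i => val (g i) x y * fst_der (h k) i x y
                                      - val (h i) x y * fst_der (g k) i x y).
Proof.
  intros X Y g h k x y Hg Hh EX EY Hx.
  assert (P : forall Z w i, (forall k, valid (w k)) -> eq_field half_plane Z (gfield w) ->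
    partial i (Z k) x y = fst_der (w k) i x y).
  { intros Z w i Hw EZ.
    rewrite (partial_ext_on half_plane i (Z k) (gfield w k));
      auto using open_half_plane.
    apply is_partial_unique. now apply Hw. }
  unfold bracket, sum_idx.
  rewrite !(P X g), !(P Y h), !EX, !EY by trivial. reflexivity.
Qed.

(** In the span of E, T and Q the coefficients of a bracket are, up to nonzero
    factors, the entries of the cross product of the two coefficient vectors, so
    commuting fields are proportional. The span of E and T alone is included by
    taking the third coefficient to be 0. *)
Lemma no_commuting_pair : forall N q,
  (forall X, killing half_plane N X -> exists al be ga,
     eq_field half_plane X (gfield (gcomb al be ga q))) ->
  ~ commuting_pair half_plane N.
Proof.
  intros N q Hspan (X & Y & KX & KY & HB & HL).
  destruct (Hspan X KX) as (a1 & b1 & c1 & EX).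
  destruct (Hspan Y KY) as (a2 & b2 & c2 & EY).
  assert (B : forall k x y, 0 < x -> sum_idx (fun i =>
       val (gcomb a1 b1 c1 q i) x y * fst_der (gcomb a2 b2 c2 q k) i x y
     - val (gcomb a2 b2 c2 q i) x y * fst_der (gcomb a1 b1 c1 q k) i x y) = 0).
  { intros k x y Hx. rewrite <- (bracket_gfield X Y) by auto using valid_gcomb.
    now apply HB. }
  assert (B1 := B i1 1 0 Rlt_0_1). assert (B2 := B i2 1 0 Rlt_0_1).
  assert (B3 := B i1 1 1 Rlt_0_1).
  cbv [sum_idx gcomb gsquare gpair gadd gmul gconst gx gy val fst_der] in B1, B2, B3.
  assert (M1 : b1 * c2 = b2 * c1) by lra.
  assert (M2 : a1 * c2 = a2 * c1) by lra.
  assert (M3 : a1 * b2 = a2 * b1).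
  { replace (a1 * b2) with (a1 * b2 + q * (a2 * c1 - a1 * c2)) by (rewrite M2; ring).
    lra. }
  assert (L : forall s t, s * a1 + t * a2 = 0 -> s * b1 + t * b2 = 0 ->
    s * c1 + t * c2 = 0 -> s = 0 /\ t = 0).
  { intros s t Ha Hb Hc. apply HL. intros k x y Hxy.
    rewrite EX, EY by trivial. unfold zero_field, gfield, gcomb, gadd, gmul, gconst.
    cbn [val].
    transitivity ((s * a1 + t * a2) * val (gpair gx gy k) x y
      + (s * b1 + t * b2) * val (gpair (Germ (fun _ _ => 0) (fun _ _ _ => 0)
           (fun _ _ _ _ => 0)) (Germ (fun _ _ => 1) (fun _ _ _ => 0)
           (fun _ _ _ _ => 0)) k) x y
      + (s * c1 + t * c2) * val (gsquare q k) x y).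
    - ring.
    - rewrite Ha, Hb, Hc. ring. }
  destruct (L a2 (- a1)) as [A2 A1]; try lra.
  destruct (L b2 (- b1)) as [B2' B1']; try lra.
  destruct (L c2 (- c1)) as [C2 C1]; try lra.
  destruct (L 1 1); lra || nra.
Qed.

Lemma killing_basis_2_no_commuting_pair : forall N,
  killing_basis half_plane N 2
    (nth_field (gpair gx gy :: gpair (gconst 0) (gconst 1) :: nil)) ->
  ~ commuting_pair half_plane N.
Proof.
  intros N (_ & _ & Hspan). apply no_commuting_pair with 0. intros X KX.
  destruct (Hspan X KX) as [c Hc]. exists (c 1%nat), (c 2%nat), 0.
  intros k x y Hxy. rewrite Hc by trivial. unfold lincomb.
  rewrite !sum_1_S, sum_1_0.
  cbv [nth_field nth pred gfield gcomb gadd gmul gconst val]. ring.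
Qed.

Lemma killing_basis_3_no_commuting_pair : forall N q,
  killing_basis half_plane N 3
    (nth_field (gpair gx gy :: gpair (gconst 0) (gconst 1) :: gsquare q :: nil)) ->
  ~ commuting_pair half_plane N.
Proof.
  intros N q (_ & _ & Hspan). apply no_commuting_pair with q. intros X KX.
  destruct (Hspan X KX) as [c Hc]. exists (c 1%nat), (c 2%nat), (c 3%nat).
  intros k x y Hxy. rewrite Hc by trivial. unfold lincomb.
  rewrite !sum_1_S, sum_1_0.
  cbv [nth_field nth pred gfield gcomb gadd gmul gconst val]. ring.
Qed.

(** The isotropy is at most one-dimensional: the conditions leave only the entry
    A_2^1 free. *)
Lemma killing_basis_family3 : forall M, family3 M -> exists q,
  killing_basis half_plane M 3
    (nth_field (gpair gx gy :: gpair (gconst 0) (gconst 1) :: gsquare q :: nil)).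
Proof.
  intros M [s Hs|c| |].
  - exists 0. apply killing_basis_3.
    + unfold gsquare. killing_equation; field; lra.
    + intros A (H2 & H3 & _) E.
      assert (R12 := H2 i1 i2). assert (R22 := H2 i2 i2).
      assert (T := H3 i2 i1 i2). assert (T' := H3 i1 i2 i2).
      cbv [act2 act3 cov2 delta1 sum_idx ricci Gamma] in R12, R22, T, T'.
      rewrite E in *. destruct Hs as [-> | ->]; intros [|] [|]; lra.
  - exists 0. apply killing_basis_3.
    + unfold gsquare. killing_equation; field; lra.
    + intros A (_ & _ & H) E. destruct H as (T & H & _); [lra|].
      assert (T1 := H i1). assert (T2 := H i2).
      cbv [act1 sum_idx area_connection] in T1, T2.
      intros [|] [|]; lra.
  - exists 1. apply killing_basis_3.
    + unfold gsquare. killing_equation; field; lra.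
    + intros A (H2 & _ & _) E.
      assert (R11 := H2 i1 i1). assert (R12 := H2 i1 i2). assert (R22 := H2 i2 i2).
      cbv [act2 sum_idx ricci] in R11, R12, R22. intros [|] [|]; lra.
  - exists (-1). apply killing_basis_3.
    + unfold gsquare. killing_equation; field; lra.
    + intros A (H2 & _ & _) E.
      assert (R11 := H2 i1 i1). assert (R12 := H2 i1 i2). assert (R22 := H2 i2 i2).
      cbv [act2 sum_idx ricci] in R11, R12, R22. intros [|] [|]; lra.
Qed.

Lemma killing_dim_family4 : forall M, family4 M -> killing_dim half_plane M 4.
Proof.
  intros M [k H0 H1|k t H0 H1 H2|k H0].
  - apply killing_dim_4; [ring|]. cbv [ricci]. intros E.
    assert (k * (k + 1) <> 0) by (apply Rmult_integral_contrapositive; lra). lra.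
  - apply killing_dim_4; [ring|]. cbv [ricci]. intros E.
    assert (k * (k + t) <> 0) by (apply Rmult_integral_contrapositive; lra). lra.
  - apply killing_dim_4; [ring|]. cbv [ricci]. intros E.
    assert (k * k <> 0) by (apply Rmult_integral_contrapositive; lra). lra.
Qed.

Lemma killing_dim_family6 : forall M, family6 M -> killing_dim half_plane M 6.
Proof.
  intros M [|s Hs|c Hc| | | |c _ _].
  - apply killing_dim_6_d0.
  - now apply killing_dim_6_quadratic.
  - now apply killing_dim_6_power.
  - apply killing_dim_6_power_log.
  - apply killing_dim_6_log.
  - apply killing_dim_6_d0.
  - apply killing_dim_6_d0.
Qed.

(** * Linear equivalence *)

(** The transformation law of the symbols under the map (x, y) |-> (x, s x + t y). As
    this map is linear and preserves x, the law is polynomial and x drops out. *)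
Definition sheared (s t a b c d e f a' b' c' d' e' f' : R) : Prop :=
  t <> 0 /\
  a = a' + 2 * c' * s + e' * s * s /\
  a * s + b * t = b' + 2 * d' * s + f' * s * s /\
  c = (c' + e' * s) * t /\
  c * s + d * t = (d' + f' * s) * t /\
  e = e' * t * t /\
  e * s + f * t = f' * t * t.

Lemma diffeo_shear : forall s t, t <> 0 -> diffeo half_plane half_plane (shear s t).
Proof.
  intros s t Ht.
  assert (M : forall u v, maps_to half_plane half_plane (shear u v)).
  { intros u v. split.
    - intros [|]; unfold shear; smooth; apply open_half_plane.
    - intros x y H. exact H. }
  split; [apply M|]. exists (shear (- s / t) (/ t)).
  split; [apply M|]. split; intros x y _; unfold shear; split; field; trivial.
Qed.

Lemma sheared_linearly_equivalent : forall s t a b c d e f a' b' c' d' e' f',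
  sheared s t a b c d e f a' b' c' d' e' f' ->
  linearly_equivalent (NB a b c d e f) (NB a' b' c' d' e' f').
Proof.
  intros s t a b c d e f a' b' c' d' e' f' (Ht & E1 & E2 & E3 & E4 & E5 & E6).
  exists s, t. split; trivial.
  apply intertwines_of_symbols; try apply open_half_plane; [apply diffeo_shear, Ht|].
  assert (P : forall i k x y, partial i (shear s t k) x y =
    match k, i with i1, i1 => 1 | i1, i2 => 0 | i2, i1 => s | i2, i2 => t end).
  { intros i k x y. apply is_partial_unique.
    destruct i, k; unfold shear; simpl; auto_derive; trivial; ring. }
  intros i j k x y Hxy. unfold half_plane in Hxy.
  rewrite (partial_ext_on half_plane i _ (fun _ _ =>
    match k, j with i1, i1 => 1 | i1, i2 => 0 | i2, i1 => s | i2, i2 => t end))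
    by auto using open_half_plane.
  rewrite partial_const. unfold sum_idx. rewrite !P.
  unfold NB. change (shear s t i1 x y) with x. rewrite Rplus_0_l.
  apply Rmult_eq_reg_l with x; [|lra].
  destruct i, j, k; cbv [Gamma]; field_simplify; try lra.
Qed.

Lemma sheared_exists : forall s t a b c d e f, t <> 0 ->
  exists a' b' c' d' e' f', sheared s t a b c d e f a' b' c' d' e' f'.
Proof.
  intros s t a b c d e f Ht.
  pose (e' := e / t / t). pose (c' := c / t - e' * s).
  pose (f' := (e * s + f * t) / t / t). pose (d' := (c * s + d * t) / t - f' * s).
  exists (a - 2 * c' * s - e' * s * s), (a * s + b * t - 2 * d' * s - f' * s * s),
    c', d', e', f'.
  unfold sheared, d', f', c', e'. repeat split; trivial; field; trivial.
Qed.

Lemma sheared_trans : forall s t s' t' a b c d e f a' b' c' d' e' f' a'' b'' c'' d'' e'' f'',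
  sheared s t a b c d e f a' b' c' d' e' f' ->
  sheared s' t' a' b' c' d' e' f' a'' b'' c'' d'' e'' f'' ->
  sheared (s' + t' * s) (t' * t) a b c d e f a'' b'' c'' d'' e'' f''.
Proof.
  intros s t s' t' a b c d e f a' b' c' d' e' f' a'' b'' c'' d'' e'' f''
    (Ht & E1 & E2 & E3 & E4 & E5 & E6) (Ht' & F1 & F2 & F3 & F4 & F5 & F6).
  split; [now apply Rmult_integral_contrapositive|].
  repeat split.
  - rewrite E1, F1, F3, F5. ring.
  - replace (a * (s' + t' * s) + b * (t' * t))
      with (a * s' + t' * (a * s + b * t)) by ring.
    rewrite E2, E1.
    replace ((a' + 2 * c' * s + e' * s * s) * s' + t' * (b' + 2 * d' * s + f' * s * s))
      with ((a' * s' + b' * t') + 2 * s * (c' * s' + d' * t') + s * s * (e' * s' + f' * t'))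
      by ring.
    rewrite F2, F4, F6. ring.
  - rewrite E3, F3, F5. ring.
  - replace (c * (s' + t' * s) + d * (t' * t))
      with (c * s' + t' * (c * s + d * t)) by ring.
    rewrite E4, E3.
    replace ((c' + e' * s) * t * s' + t' * ((d' + f' * s) * t))
      with (t * ((c' * s' + d' * t') + s * (e' * s' + f' * t'))) by ring.
    rewrite F4, F6. ring.
  - rewrite E5, F5. ring.
  - replace (e * (s' + t' * s) + f * (t' * t))
      with (e * s' + t' * (e * s + f * t)) by ring.
    rewrite E6, E5.
    replace (e' * t * t * s' + t' * (f' * t * t))
      with (t * t * (e' * s' + f' * t')) by ring.
    rewrite F6. ring.
Qed.

(** The shear acts on the Ricci tensor as on any tensor; c + f is its alternating
    part. This is what makes the normal forms below available. *)
Lemma sheared_ricci : forall s t a b c d e f a' b' c' d' e' f',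
  sheared s t a b c d e f a' b' c' d' e' f' ->
  c + f = t * (c' + f') /\
  ricci a b c d e f i1 i1 = ricci a' b' c' d' e' f' i1 i1
    + s * (ricci a' b' c' d' e' f' i1 i2 + ricci a' b' c' d' e' f' i2 i1)
    + s * s * ricci a' b' c' d' e' f' i2 i2 /\
  ricci a b c d e f i1 i2 = t * (ricci a' b' c' d' e' f' i1 i2
    + s * ricci a' b' c' d' e' f' i2 i2) /\
  ricci a b c d e f i2 i2 = t * t * ricci a' b' c' d' e' f' i2 i2.
Proof.
  intros s t a b c d e f a' b' c' d' e' f' (Ht & E1 & E2 & E3 & E4 & E5 & E6).
  assert (Eb : b = (b' + 2 * d' * s + f' * s * s - a * s) / t)
    by (rewrite <- E2; field; trivial).
  assert (Ed : d = d' + f' * s - c * s / t).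
  { apply Rmult_eq_reg_r with t; trivial. rewrite Rmult_minus_distr_r, <- E4. field. trivial. }
  assert (Ef : f = f' * t - e * s / t).
  { apply Rmult_eq_reg_r with t; trivial. rewrite Rmult_minus_distr_r, <- E6. field. trivial. }
  rewrite Eb, Ed, Ef, E1, E3, E5. cbv [ricci].
  repeat split; field; trivial.
Qed.

Lemma sign_square : forall e, e <> 0 -> exists s t, is_sign s /\ t <> 0 /\ e = s * (t * t).
Proof.
  intros e He. destruct (Rlt_le_dec 0 e) as [P|P].
  - exists 1, (sqrt e). assert (Q := sqrt_lt_R0 e P). repeat split.
    + now left.
    + lra.
    + rewrite sqrt_sqrt by lra. ring.
  - exists (-1), (sqrt (- e)). assert (Q := sqrt_lt_R0 (- e) ltac:(lra)). repeat split.
    + now right.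
    + lra.
    + rewrite sqrt_sqrt by lra. ring.
Qed.

(** * Classification *)

(** The connection form theta is not zero because its exterior derivative is the
    alternating part of the Ricci tensor. A is trace free and theta o A = 0, so A is
    nilpotent with kernel ker theta; the hypothesis on a + d says that the shear has
    moved this kernel to d/dx. What remains is that A annihilates nabla theta and the
    Ricci tensor. *)
Lemma isotropy_asymmetric : forall a b c d e f A, isotropy a b c d e f A ->
  c + f <> 0 -> 2 + a + d = 0 ->
  (forall i k, A i k = 0) \/ (a = -(3/2) /\ b = 0 /\ d = -(1/2) /\ f = 2 * c).
Proof.
  intros a b c d e f A (H2 & _ & H) Hr Ha. destruct (H Hr) as (T & H1 & H1').
  assert (T1 := H1 i1). assert (T2 := H1 i2). cbv [act1 sum_idx area_connection] in T1, T2.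
  assert (A12 : A i1 i2 = 0) by (apply Rmult_eq_reg_l with (c + f); nra).
  assert (A22 : A i2 i2 = 0) by (apply Rmult_eq_reg_l with (c + f); nra).
  destruct (Req_dec (A i2 i1) 0) as [A21|A21].
  - left. intros [|] [|]; lra.
  - right. assert (N12 := H1' i1 i2). assert (N22 := H1' i2 i2). assert (R22 := H2 i2 i2).
    cbv [act2 cov1 delta1 area_connection sum_idx Gamma ricci] in N12, N22, R22.
    rewrite A12, A22 in *.
    assert (Hb : b = 0).
    { apply Rmult_eq_reg_l with ((c + f) * A i2 i1);
        [nra|now apply Rmult_integral_contrapositive]. }
    assert (Hd : 1 + 2 * d = 0).
    { apply Rmult_eq_reg_l with ((c + f) * A i2 i1);
        [nra|now apply Rmult_integral_contrapositive]. }
    assert (d = - (1 / 2)) by lra. subst b d.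
    repeat split; try lra.
    apply Rmult_eq_reg_l with (A i2 i1); nra.
Qed.

(** The Ricci tensor is a metric and A generates its rotations or boosts. The
    eigenvalues of A on tensors of degree 3 are odd multiples of those on vectors,
    hence nonzero, so the covariant derivative T of the metric vanishes. *)
Lemma isotropy_metric : forall a b c d e f A, isotropy a b c d e f A ->
  c + f = 0 -> ricci a b c d e f i1 i2 = 0 ->
  ricci a b c d e f i1 i1 <> 0 -> ricci a b c d e f i2 i2 <> 0 ->
  (forall i k, A i k = 0) \/
  (a = -1 /\ b = 0 /\ c = 0 /\ d = -1 /\ f = 0 /\ e <> 0).
Proof.
  intros a b c d e f A (H2 & H3 & _) Hr R12 R11 R22.
  assert (R21 : ricci a b c d e f i2 i1 = 0) by (cbv [ricci] in *; lra).
  remember (ricci a b c d e f) as r eqn:Er.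
  assert (K11 := H2 i1 i1). assert (K12 := H2 i1 i2). assert (K22 := H2 i2 i2).
  cbv [act2 sum_idx] in K11, K12, K22. rewrite R12, R21 in *.
  assert (A11 : A i1 i1 = 0) by (apply Rmult_eq_reg_l with (r i1 i1); lra).
  assert (A22 : A i2 i2 = 0) by (apply Rmult_eq_reg_l with (r i2 i2); lra).
  destruct (Req_dec (A i1 i2) 0) as [A12|A12].
  { left. assert (A i2 i1 = 0) by (apply Rmult_eq_reg_l with (r i1 i1); nra).
    intros [|] [|]; trivial. }
  right.
  pose (k := A i1 i2 / r i1 i1).
  assert (Hk : k <> 0) by (apply Rmult_integral_contrapositive; split; trivial;
    now apply Rinv_neq_0_compat).
  assert (E12 : A i1 i2 = k * r i1 i1) by (unfold k; field; trivial).
  assert (E21 : A i2 i1 = - k * r i2 i2).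
  { apply Rmult_eq_reg_l with (r i1 i1); trivial.
    replace (r i1 i1 * (- k * r i2 i2)) with (- (r i2 i2 * A i1 i2))
      by (rewrite E12; ring). lra. }
  assert (Ts : forall m, cov2 (Gamma a b c d e f) r m i2 i1 = cov2 (Gamma a b c d e f) r m i1 i2).
  { intros m. cbv [cov2 sum_idx]. rewrite R12, R21. ring. }
  remember (cov2 (Gamma a b c d e f) r) as T eqn:ET.
  assert (X : forall u v, k * u = k * v -> u = v).
  { intros u v Huv. apply Rmult_eq_reg_l with k; trivial. }
  assert (H111 := H3 i1 i1 i1). assert (H112 := H3 i1 i1 i2).
  assert (H122 := H3 i1 i2 i2). assert (H211 := H3 i2 i1 i1).
  assert (H212 := H3 i2 i1 i2). assert (H222 := H3 i2 i2 i2).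
  cbv [act3 sum_idx] in *. rewrite A11, A22, E12, E21, !Ts in *.
  assert (P111 : r i1 i1 * T i2 i1 i1 + 2 * (r i1 i1 * T i1 i1 i2) = 0) by (apply X; lra).
  assert (P112 : r i1 i1 * T i2 i1 i2 + r i1 i1 * T i1 i2 i2 = r i2 i2 * T i1 i1 i1)
    by (apply X; lra).
  assert (P122 : r i1 i1 * T i2 i2 i2 = 2 * (r i2 i2 * T i1 i1 i2)) by (apply X; lra).
  assert (P211 : r i2 i2 * T i1 i1 i1 = 2 * (r i1 i1 * T i2 i1 i2)) by (apply X; lra).
  assert (P212 : r i1 i1 * T i2 i2 i2 = r i2 i2 * T i1 i1 i2 + r i2 i2 * T i2 i1 i1)
    by (apply X; lra).
  assert (P222 : r i2 i2 * T i1 i2 i2 + 2 * (r i2 i2 * T i2 i1 i2) = 0) by (apply X; lra).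
  assert (Z122 : T i1 i2 i2 = - 2 * T i2 i1 i2)
    by (apply Rmult_eq_reg_l with (r i2 i2); lra).
  assert (Z211 : T i2 i1 i1 = - 2 * T i1 i1 i2)
    by (apply Rmult_eq_reg_l with (r i1 i1); lra).
  rewrite Z122 in P112. rewrite Z211 in P212.
  assert (Z212 : T i2 i1 i2 = 0) by (apply Rmult_eq_reg_l with (r i1 i1); lra).
  assert (Z112 : T i1 i1 i2 = 0) by (apply Rmult_eq_reg_l with (r i2 i2); lra).
  assert (Z111 : T i1 i1 i1 = 0).
  { apply Rmult_eq_reg_l with (r i2 i2); trivial. rewrite P211, Z212. ring. }
  assert (Z222 : T i2 i2 i2 = 0).
  { apply Rmult_eq_reg_l with (r i1 i1); trivial. rewrite P122, Z112. ring. }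
  rewrite Z212 in Z122. subst T.
  cbv [cov2 delta1 sum_idx Gamma] in Z222, Z122, Z111. rewrite R12, R21 in *.
  assert (Hf : f = 0) by (apply Rmult_eq_reg_l with (r i2 i2); lra).
  assert (Hd : d = -1) by (apply Rmult_eq_reg_l with (r i2 i2); lra).
  assert (Ha : a = -1) by (apply Rmult_eq_reg_l with (r i1 i1); lra).
  assert (Hc : c = 0) by lra. subst a c d f r. cbv [ricci] in *.
  assert (He : e <> 0) by (intros ->; apply R22; ring).
  repeat split; trivial. apply Rmult_eq_reg_l with e; lra.
Qed.

(** The Ricci tensor is a multiple of dy^2 / x^2. With alpha = dy / x, annihilating
    the covariant derivative of the Ricci tensor amounts to annihilating
    nabla alpha. *)
Lemma isotropy_degenerate : forall a b c d e f A, isotropy a b c d e f A ->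
  c + f = 0 -> ricci a b c d e f i1 i2 = 0 ->
  ricci a b c d e f i1 i1 = 0 -> ricci a b c d e f i2 i2 <> 0 ->
  (forall i k, A i k = 0) \/
  (a = -(3/2) /\ b = 0 /\ c = 0 /\ d = -(1/2) /\ f = 0 /\ e <> 0).
Proof.
  intros a b c d e f A (H2 & H3 & _) Hr R12 R11 R22.
  assert (R21 : ricci a b c d e f i2 i1 = 0) by (cbv [ricci] in *; lra).
  remember (ricci a b c d e f) as r eqn:Er.
  assert (K12 := H2 i1 i2). assert (K22 := H2 i2 i2).
  cbv [act2 sum_idx] in K12, K22. rewrite R12, R21, R11 in *.
  assert (A12 : A i1 i2 = 0) by (apply Rmult_eq_reg_l with (r i2 i2); lra).
  assert (A22 : A i2 i2 = 0) by (apply Rmult_eq_reg_l with (r i2 i2); lra).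
  assert (H112 := H3 i1 i1 i2). assert (H212 := H3 i2 i1 i2).
  assert (H122 := H3 i1 i2 i2). assert (H222 := H3 i2 i2 i2).
  cbv [act3 cov2 delta1 sum_idx Gamma] in *. rewrite R12, R21, R11, A12, A22 in *.
  assert (X : forall u v, r i2 i2 * u = r i2 i2 * v -> u = v).
  { intros u v Huv. apply Rmult_eq_reg_l with (r i2 i2); trivial. }
  (* Up to the sign these are the components of the action of A on nabla alpha. *)
  assert (B12 : b * A i2 i1 + (1 + d) * A i1 i1 = 0) by (apply X; lra).
  assert (B112 : b * A i1 i1 = 0) by (apply X; lra).
  assert (B212 : d * A i1 i1 + b * A i2 i1 = 0) by (apply X; lra).
  assert (B22 : (1 + 2 * d) * A i2 i1 = 0) by (apply X; lra).
  assert (A11 : A i1 i1 = 0) by lra.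
  destruct (Req_dec (A i2 i1) 0) as [A21|A21].
  { left. intros [|] [|]; trivial. }
  right.
  assert (Hb : b = 0) by (apply Rmult_eq_reg_l with (A i2 i1); trivial; nra).
  assert (Hd : d = -(1/2)) by (apply Rmult_eq_reg_l with (A i2 i1); trivial; nra).
  subst r b d. cbv [ricci] in *.
  assert (Hc : c = 0) by lra. subst c. assert (Hf : f = 0) by lra. subst f.
  repeat split; trivial; try lra. intros ->. apply R22. ring.
Qed.

(** Both coordinate directions are null, so A = diag (k, -k) and the component T_222
    of the covariant derivative has weight -3k; it is a multiple of e, and e = 0
    contradicts the nondegeneracy. *)
Lemma isotropy_null : forall a b c d e f A, isotropy a b c d e f A ->
  c + f = 0 -> ricci a b c d e f i1 i1 = 0 -> ricci a b c d e f i2 i2 = 0 ->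
  ricci a b c d e f i1 i2 <> 0 -> forall i k, A i k = 0.
Proof.
  intros a b c d e f A (H2 & H3 & _) Hr R11 R22 R12.
  assert (R21 : ricci a b c d e f i2 i1 = ricci a b c d e f i1 i2)
    by (cbv [ricci] in *; lra).
  remember (ricci a b c d e f) as r eqn:Er.
  assert (K11 := H2 i1 i1). assert (K12 := H2 i1 i2). assert (K22 := H2 i2 i2).
  cbv [act2 sum_idx] in K11, K12, K22. rewrite R21, R11, R22 in *.
  assert (A12 : A i1 i2 = 0) by (apply Rmult_eq_reg_l with (r i1 i2); lra).
  assert (A21 : A i2 i1 = 0) by (apply Rmult_eq_reg_l with (r i1 i2); lra).
  assert (A22 : A i2 i2 = - A i1 i1) by (apply Rmult_eq_reg_l with (r i1 i2); lra).
  assert (H222 := H3 i2 i2 i2).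
  cbv [act3 cov2 delta1 sum_idx Gamma] in H222. rewrite R21, R11, R22, A21, A22 in H222.
  assert (E : e * A i1 i1 = 0) by (apply Rmult_eq_reg_l with (r i1 i2); lra).
  assert (A11 : A i1 i1 = 0).
  { destruct (Req_dec (A i1 i1) 0) as [|N]; trivial. exfalso.
    assert (e = 0) by (apply Rmult_eq_reg_l with (A i1 i1); lra).
    subst r e. cbv [ricci] in *. assert (f = - c) by lra. subst f.
    assert (c * c = 0) by lra. assert (c = 0) by nra. subst c. apply R12. ring. }
  rewrite A11 in A22. intros [|] [|]; lra.
Qed.

(** The Ricci tensor is a multiple of dx^2 / x^2, and A annihilates alpha = dx / x and
    nabla alpha. If e is not zero, the latter forces A = 0. *)
Lemma isotropy_translational : forall a b c d e f A, isotropy a b c d e f A ->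
  c + f = 0 -> ricci a b c d e f i1 i2 = 0 -> ricci a b c d e f i2 i2 = 0 ->
  ricci a b c d e f i1 i1 <> 0 ->
  (forall i k, A i k = 0) \/ (c = 0 /\ e = 0 /\ f = 0).
Proof.
  intros a b c d e f A (H2 & H3 & _) Hr R12 R22 R11.
  assert (R21 : ricci a b c d e f i2 i1 = 0) by (cbv [ricci] in *; lra).
  remember (ricci a b c d e f) as r eqn:Er.
  assert (K11 := H2 i1 i1). assert (K12 := H2 i1 i2).
  cbv [act2 sum_idx] in K11, K12. rewrite R21, R12, R22 in *.
  assert (A11 : A i1 i1 = 0) by (apply Rmult_eq_reg_l with (r i1 i1); lra).
  assert (A21 : A i2 i1 = 0) by (apply Rmult_eq_reg_l with (r i1 i1); lra).
  assert (H112 := H3 i1 i1 i2). assert (H212 := H3 i2 i1 i2).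
  cbv [act3 cov2 delta1 sum_idx Gamma] in H112, H212.
  rewrite R21, R12, R22, A11, A21 in *.
  assert (X : forall u v, r i1 i1 * u = r i1 i1 * v -> u = v).
  { intros u v Huv. apply Rmult_eq_reg_l with (r i1 i1); trivial. }
  assert (B12 : e * A i1 i2 + c * A i2 i2 = 0) by (apply X; lra).
  assert (B22 : e * A i2 i2 = 0) by (apply X; lra).
  destruct (Req_dec e 0) as [He|He].
  - right. subst r e. cbv [ricci] in R22. assert (f = - c) by lra. subst f.
    assert (c * c = 0) by lra. assert (c = 0) by nra. subst c. repeat split; lra.
  - left. assert (A22 : A i2 i2 = 0) by (apply Rmult_eq_reg_l with e; lra).
    rewrite A22 in B12.
    assert (A12 : A i1 i2 = 0) by (apply Rmult_eq_reg_l with e; lra).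
    intros [|] [|]; trivial.
Qed.

Lemma linearly_equivalent_transport : forall N M,
  smooth_connection half_plane N -> smooth_connection half_plane M ->
  linearly_equivalent N M ->
  (forall n, killing_dim half_plane M n -> killing_dim half_plane N n) /\
  (commuting_pair half_plane N <-> commuting_pair half_plane M).
Proof.
  intros N M SN SM (s & t & Ht & HI). assert (D := diffeo_shear s t Ht). split.
  - intros n. apply killing_dim_transport with (shear s t);
      auto using open_half_plane.
  - apply commuting_pair_transport with (shear s t); auto using open_half_plane.
Qed.

(** The generic case, in which the Killing algebra is that of the ax+b group. *)
Definition rigid (N : connection) : Prop :=
  killing_dim half_plane N 2 /\ ~ commuting_pair half_plane N.

(** Lets every case of the classification be decided on a sheared normal form. *)
Lemma rigid_of_isotropy : forall s t a b c d e f a' b' c' d' e' f' (special : Prop),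
  sheared s t a b c d e f a' b' c' d' e' f' ->
  (forall A, isotropy a' b' c' d' e' f' A -> (forall i k, A i k = 0) \/ special) ->
  rigid (NB a b c d e f) \/ special.
Proof.
  intros s t a b c d e f a' b' c' d' e' f' special HS HA.
  destruct (classic special) as [|Hn]; [now right|]. left.
  assert (B := killing_basis_2 a' b' c' d' e' f'
    ltac:(intros A HI; destruct (HA A HI); [assumption|contradiction])).
  destruct (linearly_equivalent_transport (NB a b c d e f) (NB a' b' c' d' e' f'))
    as [T1 T2]; try apply smooth_NB.
  { now apply sheared_linearly_equivalent with s t. }
  split.
  - apply T1. eexists; exact B.
  - rewrite T2. now apply killing_basis_2_no_commuting_pair.
Qed.

(** The shear by s moves the kernel of the connection form of the area form to d/dx.
    The remaining freedom scales c to 1. *)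
Lemma classification_asymmetric : forall a b c d e f, c + f <> 0 ->
  rigid (NB a b c d e f) \/
  (exists M, family3 M /\ linearly_equivalent (NB a b c d e f) M).
Proof.
  intros a b c d e f Hr. pose (s := (2 + a + d) / (c + f)).
  destruct (sheared_exists s 1 a b c d e f R1_neq_R0)
    as (a' & b' & c' & d' & e' & f' & HS).
  assert (Hr' := proj1 (sheared_ricci _ _ _ _ _ _ _ _ _ _ _ _ _ _ HS)).
  assert (Ha : 2 + a' + d' = 0).
  { destruct HS as (_ & E1 & E2 & E3 & E4 & E5 & E6).
    assert (2 + a + d = s * (c + f)) by (unfold s; field; trivial). nra. }
  destruct (rigid_of_isotropy _ _ _ _ _ _ _ _ _ _ _ _ _ _ _ HS
    (fun A HA => isotropy_asymmetric a' b' c' d' e' f' A HA ltac:(lra) Ha))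
    as [|(Ea & Eb & Ed & Ef)]; [now left|]. right. subst a' b' d' f'.
  assert (Hc : c' <> 0) by lra.
  exists (NB (-(3/2)) 0 1 (-(1/2)) (e' / c' / c') 2). split; [constructor|].
  eapply sheared_linearly_equivalent, sheared_trans; [exact HS|].
  instantiate (1 := c'). instantiate (1 := 0).
  split; trivial. repeat split; field; trivial.
Qed.

(** The shear diagonalises the Ricci tensor, which is possible because
    Ric(d/dy, d/dy) is not zero; then e is scaled to a standard value. *)
Lemma classification_symmetric : forall a b c d e f, c + f = 0 ->
  ricci a b c d e f i2 i2 <> 0 ->
  rigid (NB a b c d e f) \/
  (exists M, family3 M /\ linearly_equivalent (NB a b c d e f) M).
Proof.
  intros a b c d e f Hr R22.
  pose (s := ricci a b c d e f i1 i2 / ricci a b c d e f i2 i2).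
  destruct (sheared_exists s 1 a b c d e f R1_neq_R0)
    as (a' & b' & c' & d' & e' & f' & HS).
  destruct (sheared_ricci _ _ _ _ _ _ _ _ _ _ _ _ _ _ HS) as (Er & _ & E12 & E22).
  assert (R22' : ricci a' b' c' d' e' f' i2 i2 <> 0) by (intros Z; apply R22; rewrite E22, Z; ring).
  assert (R12' : ricci a' b' c' d' e' f' i1 i2 = 0).
  { assert (Es : ricci a b c d e f i1 i2 = s * ricci a b c d e f i2 i2)
      by (unfold s; field; trivial).
    rewrite E22 in Es. lra. }
  assert (Hr' : c' + f' = 0) by lra.
  destruct (Req_dec (ricci a' b' c' d' e' f' i1 i1) 0) as [R11'|R11'].
  - destruct (rigid_of_isotropy _ _ _ _ _ _ _ _ _ _ _ _ _ _ _ HS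
      (fun A HA => isotropy_degenerate a' b' c' d' e' f' A HA Hr' R12' R11' R22'))
      as [|(Ea & Eb & Ec & Ed & Ef & He)]; [now left|]. right. subst a' b' c' d' f'.
    destruct (sign_square (- (2 * e')) ltac:(lra)) as (u & t & Hu & Ht & Eu).
    exists (NB (-(3/2)) 0 0 (-(1/2)) (- u * (1/2)) 0). split; [now constructor|].
    eapply sheared_linearly_equivalent, sheared_trans; [exact HS|].
    instantiate (1 := t). instantiate (1 := 0).
    split; trivial. repeat split; lra.
  - destruct (rigid_of_isotropy _ _ _ _ _ _ _ _ _ _ _ _ _ _ _ HS
      (fun A HA => isotropy_metric a' b' c' d' e' f' A HA Hr' R12' R11' R22'))
      as [|(Ea & Eb & Ec & Ed & Ef & He)]; [now left|]. right. subst a' b' c' d' f'.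
    destruct (sign_square e' He) as (u & t & Hu & Ht & Eu).
    exists (NB (-1) 0 0 (-1) u 0). split.
    + destruct Hu as [-> | ->]; constructor.
    + eapply sheared_linearly_equivalent, sheared_trans; [exact HS|].
      instantiate (1 := t). instantiate (1 := 0).
      split; trivial. repeat split; lra.
Qed.

Lemma sheared_refl : forall a b c d e f, sheared 0 1 a b c d e f a b c d e f.
Proof. intros. unfold sheared. repeat split; try ring. exact R1_neq_R0. Qed.

Lemma classification : forall a b c d e f,
  (forall i j, ricci a b c d e f i j = 0) \/
  rigid (NB a b c d e f) \/
  (exists M, family3 M /\ linearly_equivalent (NB a b c d e f) M) \/
  (c = 0 /\ e = 0 /\ f = 0).
Proof.
  intros a b c d e f.
  destruct (Req_dec (c + f) 0) as [Hr|Hr];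
    [|destruct (classification_asymmetric a b c d e f Hr); tauto].
  destruct (Req_dec (ricci a b c d e f i2 i2) 0) as [R22|R22];
    [|destruct (classification_symmetric a b c d e f Hr R22); tauto].
  destruct (Req_dec (ricci a b c d e f i1 i2) 0) as [R12|R12].
  - destruct (Req_dec (ricci a b c d e f i1 i1) 0) as [R11|R11].
    + left. intros [|] [|]; trivial. cbv [ricci] in *. lra.
    + destruct (rigid_of_isotropy _ _ _ _ _ _ _ _ _ _ _ _ _ _ _ (sheared_refl a b c d e f)
        (fun A HA => isotropy_translational a b c d e f A HA Hr R12 R22 R11)); tauto.
  - pose (s := ricci a b c d e f i1 i1 / (2 * ricci a b c d e f i1 i2)).
    destruct (sheared_exists s 1 a b c d e f R1_neq_R0)
      as (a' & b' & c' & d' & e' & f' & HS).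
    destruct (sheared_ricci _ _ _ _ _ _ _ _ _ _ _ _ _ _ HS) as (Er & E11 & E12 & E22).
    assert (R22' : ricci a' b' c' d' e' f' i2 i2 = 0) by lra.
    rewrite R22' in *.
    assert (Hr' : c' + f' = 0) by lra.
    assert (R12' : ricci a' b' c' d' e' f' i1 i2 <> 0) by lra.
    assert (R11' : ricci a' b' c' d' e' f' i1 i1 = 0).
    { assert (R21' : ricci a' b' c' d' e' f' i2 i1 = ricci a' b' c' d' e' f' i1 i2)
        by (cbv [ricci] in *; lra).
      rewrite R21' in E11.
      assert (ricci a b c d e f i1 i1 = s * (2 * ricci a b c d e f i1 i2))
        by (unfold s; field; trivial). nra. }
    destruct (rigid_of_isotropy _ _ _ _ _ _ _ _ _ _ _ _ _ _ False HS
      (fun A HA => or_introl (isotropy_null a' b' c' d' e' f' A HA Hr' R11' R22' R12')));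
      tauto.
Qed.

(** A shear by s changes b by (a - 2 d) s, so b can be removed unless a = 2 d, and
    then it can be scaled to 1. *)
Lemma family4_of_ricci : forall a b d, ricci a b 0 d 0 0 i1 i1 <> 0 ->
  exists M, family4 M /\ linearly_equivalent (NB a b 0 d 0 0) M.
Proof.
  intros a b d Hr. cbv [ricci] in Hr.
  assert (Hd : d <> 0) by (intros ->; apply Hr; ring).
  assert (Had : 1 + a - d <> 0).
  { intros E. apply Hr. rewrite E. ring. }
  destruct (Req_dec a (2 * d)) as [->|Ha].
  - destruct (Req_dec b 0) as [->|Hb].
    + exists (NB (2 * d + 1 - 1) 0 0 d 0 0). split; [constructor; lra|].
      apply sheared_linearly_equivalent with 0 1.
      split; [lra|repeat split; ring].
    + exists (NB (2 * d) 1 0 d 0 0). split; [constructor; lra|].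
      apply sheared_linearly_equivalent with 0 (/ b).
      split; [now apply Rinv_neq_0_compat|repeat split; field; trivial].
  - assert (Hs : exists s, b = (2 * d - a) * s)
      by (exists (b / (2 * d - a)); field; lra).
    destruct Hs as [s Hs].
    destruct (Req_dec (a - 2 * d + 1) 0) as [Ht|Ht].
    + exists (NB (2 * d - 1) 0 0 d 0 0). split; [now constructor|].
      apply sheared_linearly_equivalent with s 1.
      split; [lra|repeat split; rewrite ?Hs; try ring; lra].
    + exists (NB (2 * d + (a - 2 * d + 1) - 1) 0 0 d 0 0). split; [constructor; lra|].
      apply sheared_linearly_equivalent with s 1.
      split; [lra|repeat split; rewrite ?Hs; ring].
Qed.

(** If e is not zero, a shear gives c = 0 and the equations leave one structure for
    each sign of e, up to scaling. If e = 0 they force c = f = 0 and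
    d (1 + a - d) = 0, and b is treated as in [family4_of_ricci]. *)
Lemma family6_of_ricci : forall a b c d e f,
  (forall i j, ricci a b c d e f i j = 0) ->
  exists M, family6 M /\ linearly_equivalent (NB a b c d e f) M.
Proof.
  intros a b c d e f HR.
  assert (R11 := HR i1 i1). assert (R12 := HR i1 i2). assert (R21 := HR i2 i1).
  assert (R22 := HR i2 i2).
  destruct (Req_dec e 0) as [He|He].
  - cbv [ricci] in *. subst e. assert (f = - c) by lra. subst f.
    assert (c * c = 0) by lra. assert (c = 0) by nra. subst c.
    replace (- 0) with 0 in * by ring.
    destruct (Req_dec d 0) as [->|Hd].
    + destruct (Req_dec a 0) as [->|Ha].
      * destruct (Req_dec b 0) as [->|Hb].
        -- exists (NB 0 0 0 0 0 0). split; [constructor|].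
           apply sheared_linearly_equivalent with 0 1. apply sheared_refl.
        -- exists (NB 0 1 0 0 0 0). split; [constructor|].
           apply sheared_linearly_equivalent with 0 (/ b).
           split; [now apply Rinv_neq_0_compat|repeat split; field; trivial].
      * exists (NB a 0 0 0 0 0). split.
        -- destruct (Req_dec a (-1)) as [->|H1]; [constructor|now constructor].
        -- apply sheared_linearly_equivalent with (- b / a) 1.
           split; [lra|repeat split; field; trivial].
    + assert (a = d - 1).
      { apply Rmult_eq_reg_l with d; trivial. lra. }
      subst a.
      destruct (Req_dec d (-1)) as [->|H1].
      * destruct (Req_dec b 0) as [->|Hb].
        -- exists (NB (-1 - 1) 0 0 (-1) 0 0). split; [constructor; lra|].
           apply sheared_linearly_equivalent with 0 1. apply sheared_refl.
        -- exists (NB (-2) 1 0 (-1) 0 0). split; [constructor|].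
           apply sheared_linearly_equivalent with 0 (/ b).
           split; [now apply Rinv_neq_0_compat|repeat split; field; trivial].
      * exists (NB (d - 1) 0 0 d 0 0). split; [now constructor|].
        apply sheared_linearly_equivalent with (b / (d + 1)) 1.
        split; [lra|repeat split; field; lra].
  - destruct (sign_square e He) as (u & t & Hu & Ht & Eu).
    destruct (sheared_exists (c * t / e) t a b c d e f Ht)
      as (a' & b' & c' & d' & e' & f' & HS).
    destruct (sheared_ricci _ _ _ _ _ _ _ _ _ _ _ _ _ _ HS) as (Er & E11 & E12 & E22).
    rewrite R11 in E11. rewrite R12 in E12. rewrite R22 in E22.
    assert (R22' : ricci a' b' c' d' e' f' i2 i2 = 0).
    { apply Rmult_eq_reg_l with (t * t); [lra|nra]. }
    rewrite R22' in *.
    assert (R12' : ricci a' b' c' d' e' f' i1 i2 = 0).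
    { apply Rmult_eq_reg_l with t; trivial. lra. }
    assert (Hcf : c + f = 0) by (cbv [ricci] in *; lra).
    assert (Hcf' : c' + f' = 0).
    { apply Rmult_eq_reg_l with t; trivial. lra. }
    assert (R21' : ricci a' b' c' d' e' f' i2 i1 = 0) by (cbv [ricci] in *; lra).
    rewrite R12', R21' in E11.
    assert (R11' : ricci a' b' c' d' e' f' i1 i1 = 0) by lra.
    assert (Ee : e' = u).
    { destruct HS as (_ & _ & _ & _ & _ & E5 & _).
      apply Rmult_eq_reg_r with (t * t); [lra|nra]. }
    assert (Ec : c' = 0).
    { destruct HS as (_ & _ & _ & E3 & _ & E5 & _).
      apply Rmult_eq_reg_r with t; trivial.
      replace (c' * t) with (c - e' * (c * t / e) * t) by lra.
      rewrite E5 at 1. field. split; trivial. intros ->. apply He. rewrite E5. ring. }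
    assert (Hu' : u <> 0) by (destruct Hu; lra).
    subst c' e'. assert (f' = 0) by lra. subst f'.
    cbv [ricci] in R11', R12', R22'.
    assert (b' = 0) by (apply Rmult_eq_reg_l with u; lra). subst b'.
    assert (a' = d' + 1) by (apply Rmult_eq_reg_l with u; lra). subst a'.
    assert (d' = 0) by lra. subst d'.
    replace (0 + 1) with 1 in * by ring.
    exists (NB 1 0 0 0 u 0). split; [now constructor|].
    now apply sheared_linearly_equivalent with (c * t / e) t.
Qed.

(** In dimension 2 the curvature is determined by the Ricci tensor. *)
Lemma curvature_tensor_NB : forall a b c d e f i j k l x y, half_plane x y ->
  curvature_tensor (NB a b c d e f) i j k l x y = / x * / x *
    match i, j with
    | i1, i2 => match l with i1 => ricci a b c d e f k i2 | i2 => - ricci a b c d e f k i1 end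
    | i2, i1 => match l with i1 => - ricci a b c d e f k i2 | i2 => ricci a b c d e f k i1 end
    | _, _ => 0
    end.
Proof.
  intros a b c d e f i j k l x y Hxy. unfold curvature_tensor, sum_idx.
  rewrite !partial_NB by trivial. unfold NB.
  destruct i, j, k, l; cbv [Gamma ricci]; ring.
Qed.

Lemma flat_NB_iff : forall a b c d e f,
  flat half_plane (NB a b c d e f) <-> (forall i j, ricci a b c d e f i j = 0).
Proof.
  intros a b c d e f.
  rewrite flat_iff by (apply open_half_plane || apply smooth_NB). split; intros H.
  - assert (P : half_plane 1 0) by (unfold half_plane; lra).
    intros i [|]; [specialize (H i2 i1 i i2 1 0 P)|specialize (H i1 i2 i i1 1 0 P)];
      rewrite curvature_tensor_NB in H by trivial; lra.
  - intros i j k l x y Hxy. rewrite curvature_tensor_NB by trivial. rewrite !H.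
    destruct i, j, l; ring.
Qed.

Lemma nabla_ext : forall (U : Defs.domain) N N' Y Y' Z Z', open_domain U ->
  eq_connection U N N' -> eq_field U Y Y' -> eq_field U Z Z' ->
  eq_field U (nabla N Y Z) (nabla N' Y' Z').
Proof.
  intros U N N' Y Y' Z Z' HU HN HY HZ k x y Hxy. unfold nabla, sum_idx.
  rewrite !HN, !HY, !HZ by trivial.
  rewrite !(fun i => partial_ext_on U i (Z k) (Z' k) x y HU Hxy (HZ k)). reflexivity.
Qed.

Lemma intertwines_ext : forall (U V : Defs.domain) Phi N N' M, open_domain U ->
  eq_connection U N N' -> intertwines U V Phi N' M -> intertwines U V Phi N M.
Proof.
  intros U V Phi N N' M HU HN HI X Y X' Y' SX SY SX' SY' RX RY k x y Hxy.
  rewrite (HI X Y X' Y' SX SY SX' SY' RX RY k x y Hxy). unfold sum_idx.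
  rewrite !(nabla_ext U N N' X X Y Y HU HN (eq_field_refl U X) (eq_field_refl U Y) _ x y Hxy).
  reflexivity.
Qed.

Lemma flat_ext : forall (U : Defs.domain) N N', open_domain U ->
  eq_connection U N N' -> flat U N' -> flat U N.
Proof.
  intros U N N' HU HN HF X Y Z SX SY SZ k x y Hxy.
  rewrite <- (HF X Y Z SX SY SZ k x y Hxy). unfold sub_field.
  assert (R := eq_field_refl U).
  rewrite (nabla_ext U N N' X X (nabla N Y Z) (nabla N' Y Z)) by (trivial; now apply nabla_ext).
  rewrite (nabla_ext U N N' Y Y (nabla N X Z) (nabla N' X Z)) by (trivial; now apply nabla_ext).
  rewrite (nabla_ext U N N' (bracket X Y) (bracket X Y) Z Z) by trivial.
  reflexivity.
Qed.

Lemma smooth_exp : smooth_on plane (fun u _ => exp u).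
Proof.
  intros n. induction n.
  - intros x y _. split; [|exact I].
    apply (continuity_1d_2d_pt_comp exp (fun x _ => x));
      [apply derivable_continuous_pt, derivable_pt_exp|apply continuity_2d_pt_id1].
  - apply (Cn_S_intro plane n (fun u _ => exp u)
      (fun i u _ => match i with i1 => exp u | i2 => 0 end)).
    + apply open_plane.
    + intros [|] u v _; simpl; [apply is_derive_exp|apply (is_derive_const (exp u))].
    + intros [|]; [exact IHn|apply Cn_const, open_plane].
Qed.

(** The coordinates u = ln x and w = y + sg x + ta x ln x, which map the half-plane
    onto the plane; [sg] and [ta] serve to remove the symbol b. *)
Definition log_chart (sg ta : R) : idx -> germ :=
  gpair gln (gadd gy (gadd (gmul (gconst sg) gx) (gmul (gconst ta) (gmul gx gln)))).

Lemma valid_log_chart : forall sg ta k, valid (log_chart sg ta k).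
Proof. intros sg ta [|]; cbv [log_chart gpair]; valid. Qed.

Lemma diffeo_log_chart : forall sg ta, diffeo half_plane plane (gfield (log_chart sg ta)).
Proof.
  intros sg ta. split.
  - split; [intros k; apply valid_log_chart|intros; exact I].
  - exists (fun k u w => match k with
      | i1 => exp u | i2 => w - sg * exp u - ta * (exp u * u) end).
    split; [|split].
    + split; [|intros u w _; apply exp_pos].
      assert (SE := smooth_exp). assert (O := open_plane).
      intros [|]; smooth.
    + intros x y Hx. unfold half_plane in Hx.
      cbv [gfield log_chart gpair gln gadd gmul gconst gx gy of_x val].
      rewrite exp_ln by trivial. split; ring.
    + intros u w _. cbv [gfield log_chart gpair gln gadd gmul gconst gx gy of_x val].
      rewrite ln_exp. split; ring.
Qed.

(** With u = ln x and w = y + g(x) the symbols are constant as soon as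
    x g'' + (2 d - a) g' = b. A linear g solves this unless a = 2 d, and then
    g = b x ln x does. *)
Lemma also_typeA_NB : forall a b d, affine_iso half_plane plane (NB a b 0 d 0 0)
  (fun i j k _ _ => Gamma (1 + a) 0 0 d 0 0 i j k).
Proof.
  intros a b d.
  assert (Hst : exists sg ta, ta * (2 * d - a) = 0 /\ ta + (2 * d - a) * sg = b).
  { destruct (Req_dec a (2 * d)) as [->|Ha].
    - exists 0, b. split; ring.
    - exists (b / (2 * d - a)), 0. split; [ring|field; lra]. }
  destruct Hst as (sg & ta & H0 & Hb).
  exists (gfield (log_chart sg ta)). split; [apply diffeo_log_chart|].
  apply intertwines_of_symbols;
    [apply open_half_plane|apply open_plane|apply diffeo_log_chart|].
  intros i j k x y Hxy.
  assert (P : forall i k u v, half_plane u v -> partial i (gfield (log_chart sg ta) k) u v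
    = fst_der (log_chart sg ta k) i u v)
    by (intros; now apply is_partial_unique, valid_log_chart).
  rewrite (partial_ext_on half_plane i _ (fst_der (log_chart sg ta k) j))
    by auto using open_half_plane.
  rewrite (is_partial_unique _ _ _ _ _
    (proj2 (proj2 (valid_log_chart sg ta k)) i j x y Hxy)).
  unfold sum_idx. rewrite !P by trivial. unfold NB. unfold half_plane in Hxy.
  assert (T : ta * a = ta * (2 * d)) by lra. rewrite <- Hb.
  destruct i, j, k;
    cbv [log_chart gpair gln gadd gmul gconst gx gy of_x val fst_der snd_der Gamma];
    try (field; lra).
  apply Rminus_diag_uniq.
  transitivity (/ x * (ln x + 1) * (ta * (2 * d) - ta * a)); [field; lra|].
  rewrite T. ring.
Qed.

(** * The theorem *)

Lemma smooth_family3 : forall M, family3 M -> smooth_connection half_plane M.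
Proof. intros M []; apply smooth_NB. Qed.

Lemma smooth_family4 : forall M, family4 M -> smooth_connection half_plane M.
Proof. intros M []; apply smooth_NB. Qed.

Lemma smooth_family6 : forall M, family6 M -> smooth_connection half_plane M.
Proof. intros M []; apply smooth_NB. Qed.

Lemma linearly_equivalent_family3 : forall N, smooth_connection half_plane N ->
  (exists M, family3 M /\ linearly_equivalent N M) ->
  killing_dim half_plane N 3 /\ ~ commuting_pair half_plane N.
Proof.
  intros N SN (M & HM & HL).
  destruct (linearly_equivalent_transport N M SN (smooth_family3 M HM) HL) as [T1 T2].
  destruct (killing_basis_family3 M HM) as [q B]. split.
  - apply T1. eexists; exact B.
  - rewrite T2. now apply killing_basis_3_no_commuting_pair with q.
Qed.

Lemma linearly_equivalent_family4 : forall N, smooth_connection half_plane N ->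
  (exists M, family4 M /\ linearly_equivalent N M) -> killing_dim half_plane N 4.
Proof.
  intros N SN (M & HM & HL).
  apply (linearly_equivalent_transport N M SN (smooth_family4 M HM) HL).
  now apply killing_dim_family4.
Qed.

Lemma linearly_equivalent_family6 : forall N, smooth_connection half_plane N ->
  (exists M, family6 M /\ linearly_equivalent N M) -> killing_dim half_plane N 6.
Proof.
  intros N SN (M & HM & HL).
  apply (linearly_equivalent_transport N M SN (smooth_family6 M HM) HL).
  now apply killing_dim_family6.
Qed.

Lemma typeB_NB : forall N, typeB N -> exists a b c d e f,
  eq_connection half_plane N (NB a b c d e f).
Proof.
  intros N (A & SA & HA).
  exists (A i1 i1 i1), (A i1 i1 i2), (A i1 i2 i1), (A i1 i2 i2), (A i2 i2 i1), (A i2 i2 i2).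
  intros i j k x y Hxy. rewrite HA by trivial. unfold NB. f_equal.
  destruct i, j, k; trivial; apply SA.
Qed.

Theorem theorem1p9 : forall N : connection, typeB N ->
  (killing_dim half_plane N 2 \/ killing_dim half_plane N 3 \/
   killing_dim half_plane N 4 \/ killing_dim half_plane N 6) /\
  (killing_dim half_plane N 3 <->
   exists M, family3 M /\ linearly_equivalent N M) /\
  ((killing_dim half_plane N 4 <->
    exists M, family4 M /\ linearly_equivalent N M) /\
   (killing_dim half_plane N 4 <->
    (also_typeA N /\ ~ flat half_plane N))) /\
  ((killing_dim half_plane N 6 <->
    exists M, family6 M /\ linearly_equivalent N M) /\
   (killing_dim half_plane N 6 <-> flat half_plane N)).
Proof.
  intros N HB. destruct (typeB_NB N HB) as (a & b & c & d & e & f & HN).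
  assert (S0 := smooth_NB a b c d e f).
  assert (O := open_half_plane).
  assert (HN' := eq_connection_sym _ _ _ HN).
  assert (SN : smooth_connection half_plane N) by now apply eq_connection_smooth with (NB a b c d e f).
  assert (L : forall M, linearly_equivalent (NB a b c d e f) M -> linearly_equivalent N M).
  { intros M (s & t & Ht & HI). exists s, t. split; trivial.
    now apply intertwines_ext with (NB a b c d e f). }
  assert (F3 := linearly_equivalent_family3 N SN).
  assert (F4 := linearly_equivalent_family4 N SN).
  assert (F6 := linearly_equivalent_family6 N SN).
  assert (U := killing_dim_unique half_plane N).
  assert (CA := also_typeA_commuting_pair N SN).
  assert (FL : flat half_plane N <-> (forall i j, ricci a b c d e f i j = 0)).
  { rewrite <- flat_NB_iff. split; now apply flat_ext. }
  rewrite FL. clear FL.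
  assert (CL : ((forall i j, ricci a b c d e f i j = 0) /\
       exists M, family6 M /\ linearly_equivalent N M) \/
    (~ (forall i j, ricci a b c d e f i j = 0) /\
      ((exists M, family4 M /\ linearly_equivalent N M) /\ also_typeA N \/
       (exists M, family3 M /\ linearly_equivalent N M) \/
       (killing_dim half_plane N 2 /\ ~ commuting_pair half_plane N)))).
  { destruct (classic (forall i j, ricci a b c d e f i j = 0)) as [R|R].
    - left. split; trivial.
      destruct (family6_of_ricci a b c d e f R) as (M & HM & HL). eauto.
    - right. split; trivial.
      destruct (classification a b c d e f) as [|[[H2 HC]|[(M & HM & HL)|(-> & -> & ->)]]].
      + contradiction.
      + right; right. split.
        * now apply killing_dim_ext with (NB a b c d e f).
        * intros (X & Y & KX & KY & H). apply HC. exists X, Y.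
          split; [|split]; trivial; [apply killing_ext with N X|apply killing_ext with N Y];
            auto using eq_field_refl.
      + right; left. eauto.
      + left. split.
        * destruct (family4_of_ricci a b d) as (M & HM & HL); eauto.
          intros R11. apply R. intros [|] [|]; trivial; cbv [ricci]; ring.
        * exists (fun i j k _ _ => Gamma (1 + a) 0 0 d 0 0 i j k). split.
          -- exists (Gamma (1 + a) 0 0 d 0 0). split; trivial.
             intros [|] [|] k; trivial.
          -- destruct (also_typeA_NB a b d) as (Phi & HD & HI).
             exists Phi. split; trivial. now apply intertwines_ext with (NB a b 0 d 0 0). }
  assert (NE : forall n m, killing_dim half_plane N n -> killing_dim half_plane N m ->
    n <> m -> False) by (intros n m Hn Hm Hnm; exact (Hnm (U n m Hn Hm))).
  assert (N23 : ~ (killing_dim half_plane N 2 /\ killing_dim half_plane N 3))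
    by (intros [X Y]; now apply (NE _ _ X Y)).
  assert (N24 : ~ (killing_dim half_plane N 2 /\ killing_dim half_plane N 4))
    by (intros [X Y]; now apply (NE _ _ X Y)).
  assert (N26 : ~ (killing_dim half_plane N 2 /\ killing_dim half_plane N 6))
    by (intros [X Y]; now apply (NE _ _ X Y)).
  assert (N34 : ~ (killing_dim half_plane N 3 /\ killing_dim half_plane N 4))
    by (intros [X Y]; now apply (NE _ _ X Y)).
  assert (N36 : ~ (killing_dim half_plane N 3 /\ killing_dim half_plane N 6))
    by (intros [X Y]; now apply (NE _ _ X Y)).
  assert (N46 : ~ (killing_dim half_plane N 4 /\ killing_dim half_plane N 6))
    by (intros [X Y]; now apply (NE _ _ X Y)).
  clear - F3 F4 F6 CA CL N23 N24 N26 N34 N36 N46. tauto.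
Qed.
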